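(* Let $n=qp+r$ with integers $q\ge 0$ and $0\leq r<p$. Then $$\dim_k \operatorname{Ext}^2_U(k,S^n)= \begin{cases} 3 \binom{q}{2}+\binom{q+1}{2}-\binom{q-1}{2} & \text{if } r \text{ is even and } r \neq p-1, \\ 3\binom{q+2}{2} & \text{if } r=p-1, \\ 3\binom{q+1}{2} & \text{if } r \text{ is odd.} \end{cases}$$
   Context: $k$ is a field of characteristic $p>2$, $\mathfrak{g}=\mathfrak{sl}_2(k)$, $U=U(\mathfrak{g})$ is its universal enveloping algebra, and $k$ is regarded as the trivial $U$-module. $S^n$ is the $n$th symmetric power of the adjoint $\mathfrak{g}$-module $\mathfrak{g}$ (with $\mathfrak g$ acting by derivations). Binomial coefficients $\binom{m}{2}$ are $0$ for $m<2$ (in particular $\binom{-1}{2}=0$). *)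

(* Defs.v *)
From HB Require Import structures.
From mathcomp Require Import all_boot all_order all_algebra.
From mathcomp Require Import generic_quotient ring_quotient boolp.
From mathcomp Require monalg.

Set Implicit Arguments.
Unset Strict Implicit.
Unset Printing Implicit Defensive.

Import GRing.Theory.
Local Open Scope ring_scope.
Local Open Scope quotient_scope.

Section Submodule.
Variables (R : nzRingType) (V : lmodType R) (S : submodClosed V).

Record submod := Submod { submod_val : V; submodP : submod_val \in S }.

HB.instance Definition _ := [isSub for submod_val].
HB.instance Definition _ := [Choice of submod by <:].
HB.instance Definition _ := [SubChoice_isSubLmodule of submod by <:].

End Submodule.

Section QuotientModule.
Variables (R : nzRingType) (V : lmodType R) (S : submodClosed V).

Definition submod_pred : {pred V} := S.

Fact submod_pred_zmod_closed : zmod_closed submod_pred.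
Proof.
split=> [|u v Su Sv]; first exact: (rpred0 S).
by rewrite -scaleN1r; apply: (@rpredD _ S) => //; exact: (@rpredZ _ _ S).
Qed.
HB.instance Definition _ :=
  GRing.isZmodClosed.Build V submod_pred submod_pred_zmod_closed.

Definition lquot : Type := Quotient.quot submod_pred.
HB.instance Definition _ := GRing.Zmodule.on lquot.

Definition lquot_pi (v : V) : lquot := \pi_(Quotient.quot submod_pred) v.
Definition lquot_repr (x : lquot) : V := repr (x : Quotient.quot submod_pred).

Lemma lquot_reprK : cancel lquot_repr lquot_pi.
Proof. by move=> x; rewrite /lquot_pi reprK. Qed.

Lemma lquot_piP u v : lquot_pi u = lquot_pi v <-> u - v \in S.
Proof.
by split=> [/eqP|uv]; [|apply/eqP]; rewrite -[_ == _]Quotient.idealrBE.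
Qed.

Lemma lquot_piD : {morph lquot_pi : u v / u + v}.
Proof. by move=> u v; rewrite /lquot_pi piE. Qed.

Definition lquot_scale (c : R) (x : lquot) := lquot_pi (c *: lquot_repr x).

Lemma lquot_pi_scale c v : lquot_scale c (lquot_pi v) = lquot_pi (c *: v).
Proof.
apply/lquot_piP; rewrite -scalerBr rpredZ //.
by apply/lquot_piP; rewrite lquot_reprK.
Qed.

Fact lquot_scaleA a b v :
  lquot_scale a (lquot_scale b v) = lquot_scale (a * b) v.
Proof. by rewrite -[v]lquot_reprK !lquot_pi_scale scalerA. Qed.
Fact lquot_scale1 : left_id 1 lquot_scale.
Proof. by move=> v; rewrite -[v]lquot_reprK lquot_pi_scale scale1r. Qed.
Fact lquot_scaleDr : right_distributive lquot_scale +%R.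
Proof.
move=> a u v; rewrite -[u]lquot_reprK -[v]lquot_reprK.
by rewrite -lquot_piD !lquot_pi_scale -lquot_piD scalerDr.
Qed.
Fact lquot_scaleDl v : {morph lquot_scale^~ v : a b / a + b}.
Proof.
by move=> a b; rewrite -[v]lquot_reprK !lquot_pi_scale -lquot_piD scalerDl.
Qed.
HB.instance Definition _ := GRing.Zmodule_isLmodule.Build R lquot
  lquot_scaleA lquot_scale1 lquot_scaleDr lquot_scaleDl.

End QuotientModule.

(* The Prop version of the library's Vector.axiom d V. *)
Definition has_dim (k : fieldType) (V : lmodType k) (d : nat) : Prop :=
  exists2 f : V -> 'rV[k]_d, linear f & bijective f.

(* Presentations of associative unital k-algebras by a vector space V of      *)
(* generators (whose linear structure is preserved) and relations: palg R     *)
(* below is the tensor algebra of V modulo the two-sided ideal generated by   *)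
(* the elements a - b with R a b. It is built directly, as formal expressions *)
(* modulo the smallest congruence containing the algebra axioms and R.        *)
Inductive term (k : fieldType) (V : lmodType k) : Type :=
| TGen of V
| TCst of k
| TAdd of term V & term V
| TMul of term V & term V.

HB.instance Definition _ (k : fieldType) (V : lmodType k) :=
  gen_eqMixin (term V).
HB.instance Definition _ (k : fieldType) (V : lmodType k) :=
  gen_choiceMixin (term V).

Fixpoint counit (k : fieldType) (V : lmodType k) (a : term V) : k :=
  match a with
  | TGen _ => 0
  | TCst c => c
  | TAdd a b => counit a + counit b
  | TMul a b => counit a * counit b
  end.

(* The relations are required to be satisfied when all generators are sent to *)
(* 0 : k, which makes the presented algebra nonzero.                          *)
Record relations (k : fieldType) (V : lmodType k) := Relations {
  relator :> term V -> term V -> Prop;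
  relator_counit : forall a b, relator a b -> counit a = counit b
}.

Inductive cong (k : fieldType) (V : lmodType k) (R : relations V) :
  term V -> term V -> Prop :=
| CongRefl a : cong R a a
| CongSym a b : cong R a b -> cong R b a
| CongTrans a b c : cong R a b -> cong R b c -> cong R a c
| CongAdd a a' b b' :
    cong R a a' -> cong R b b' -> cong R (TAdd a b) (TAdd a' b')
| CongMul a a' b b' :
    cong R a a' -> cong R b b' -> cong R (TMul a b) (TMul a' b')
| CongAddA a b c : cong R (TAdd a (TAdd b c)) (TAdd (TAdd a b) c)
| CongAddC a b : cong R (TAdd a b) (TAdd b a)
| CongAdd0 a : cong R (TAdd (TCst V 0) a) a
| CongMulA a b c : cong R (TMul a (TMul b c)) (TMul (TMul a b) c)
| CongMul1 a : cong R (TMul (TCst V 1) a) a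
| CongMul0 a : cong R (TMul (TCst V 0) a) (TCst V 0)
| CongMulDl a b c :
    cong R (TMul (TAdd a b) c) (TAdd (TMul a c) (TMul b c))
| CongMulDr a b c :
    cong R (TMul a (TAdd b c)) (TAdd (TMul a b) (TMul a c))
| CongCstD x y : cong R (TCst V (x + y)) (TAdd (TCst V x) (TCst V y))
| CongCstM x y : cong R (TCst V (x * y)) (TMul (TCst V x) (TCst V y))
| CongCstC x a : cong R (TMul (TCst V x) a) (TMul a (TCst V x))
| CongGenD u v : cong R (TGen (u + v)) (TAdd (TGen u) (TGen v))
| CongGenZ x v : cong R (TGen (x *: v)) (TMul (TCst V x) (TGen v))
| CongRel a b : R a b -> cong R a b.

Section PresentedAlgebra.
Variables (k : fieldType) (V : lmodType k) (R : relations V).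

Definition congb : rel (term V) := fun a b => `[< cong R a b >].

Fact congb_equiv : equiv_class_of congb.
Proof.
split=> [a|a b|b a c].
- exact/asboolP/CongRefl.
- by apply/asboolP/asboolP; apply: CongSym.
- by move=> /asboolP ab /asboolP bc; apply/asboolP; apply: CongTrans ab bc.
Qed.

Canonical congb_equivRel := EquivRelPack congb_equiv.
Canonical congb_encModRel := defaultEncModRel congb.

Definition palg_quot := {eq_quot congb}.
HB.instance Definition _ : EqQuotient (term V) congb palg_quot :=
  EqQuotient.on palg_quot.
HB.instance Definition _ := Choice.on palg_quot.

Definition palg : Type := palg_quot.
HB.instance Definition _ := Choice.on palg.

Definition palg_pi (a : term V) : palg := \pi_palg_quot a.
Definition palg_repr (x : palg) : term V := repr (x : palg_quot).
Definition palg_gen (v : V) : palg := palg_pi (TGen v).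

Lemma palg_reprK : cancel palg_repr palg_pi.
Proof. by move=> x; rewrite /palg_pi reprK. Qed.

Lemma palg_piP a b : palg_pi a = palg_pi b <-> cong R a b.
Proof.
split=> [/eqmodP/asboolP//|ab]; exact/eqmodP/asboolP.
Qed.

Lemma palg_repr_pi a : cong R (palg_repr (palg_pi a)) a.
Proof. by apply/palg_piP; rewrite palg_reprK. Qed.

Lemma palgW (P : palg -> Prop) : (forall a, P (palg_pi a)) -> forall x, P x.
Proof. by move=> Ppi x; rewrite -[x]palg_reprK. Qed.

Definition palg_add x y := palg_pi (TAdd (palg_repr x) (palg_repr y)).
Definition palg_mul x y := palg_pi (TMul (palg_repr x) (palg_repr y)).
Definition palg_opp x := palg_pi (TMul (TCst V (-1)) (palg_repr x)).
Definition palg_scale c x := palg_pi (TMul (TCst V c) (palg_repr x)).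
Definition palg_cst c := palg_pi (TCst V c).

Lemma palg_pi_add a b :
  palg_add (palg_pi a) (palg_pi b) = palg_pi (TAdd a b).
Proof. by apply/palg_piP/CongAdd; exact: palg_repr_pi. Qed.
Lemma palg_pi_mul a b :
  palg_mul (palg_pi a) (palg_pi b) = palg_pi (TMul a b).
Proof. by apply/palg_piP/CongMul; exact: palg_repr_pi. Qed.
Lemma palg_pi_opp a : palg_opp (palg_pi a) = palg_pi (TMul (TCst V (-1)) a).
Proof. by apply/palg_piP/CongMul; [exact: CongRefl|exact: palg_repr_pi]. Qed.
Lemma palg_pi_scale c a :
  palg_scale c (palg_pi a) = palg_pi (TMul (TCst V c) a).
Proof. by apply/palg_piP/CongMul; [exact: CongRefl|exact: palg_repr_pi]. Qed.

Let piE :=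
  (palg_pi_add, palg_pi_mul, palg_pi_opp, palg_pi_scale).

Fact palg_addA : associative palg_add.
Proof.
do 3!elim/palgW=> ?; rewrite !piE; exact/palg_piP/CongAddA.
Qed.
Fact palg_addC : commutative palg_add.
Proof. do 2!elim/palgW=> ?; rewrite !piE; exact/palg_piP/CongAddC. Qed.
Fact palg_add0 : left_id (palg_cst 0) palg_add.
Proof. elim/palgW=> ?; rewrite !piE; exact/palg_piP/CongAdd0. Qed.
Fact palg_addN : left_inverse (palg_cst 0) palg_opp palg_add.
Proof.
elim/palgW=> a; rewrite !piE; apply/palg_piP.
apply: CongTrans (CongAdd (CongRefl R _) (CongSym (CongMul1 R a))) _.
apply: CongTrans (CongSym (CongMulDl R _ _ _)) _.
apply: CongTrans (CongMul (CongSym (CongCstD R _ _)) (CongRefl R _)) _.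
by rewrite addNr; apply: CongMul0.
Qed.
HB.instance Definition _ :=
  GRing.isZmodule.Build palg palg_addA palg_addC palg_add0 palg_addN.

Fact palg_mulA : associative palg_mul.
Proof.
do 3!elim/palgW=> ?; rewrite !piE; exact/palg_piP/CongMulA.
Qed.
Fact palg_mul1 : left_id (palg_cst 1) palg_mul.
Proof. elim/palgW=> ?; rewrite !piE; exact/palg_piP/CongMul1. Qed.
Fact palg_mulr1 : right_id (palg_cst 1) palg_mul.
Proof.
elim/palgW=> ?; rewrite !piE; apply/palg_piP.
apply: CongTrans (CongSym (CongCstC R _ _)) _; exact: CongMul1.
Qed.
Fact palg_mulDl : left_distributive palg_mul palg_add.
Proof.
do 3!elim/palgW=> ?; rewrite !piE; exact/palg_piP/CongMulDl.
Qed.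
Fact palg_mulDr : right_distributive palg_mul palg_add.
Proof.
do 3!elim/palgW=> ?; rewrite !piE; exact/palg_piP/CongMulDr.
Qed.

Lemma cong_counit a b : cong R a b -> counit a = counit b.
Proof.
elim=> //=.
- by move=> {}a {}b c _ -> _ ->.
- by move=> {}a a' {}b b' _ -> _ ->.
- by move=> {}a a' {}b b' _ -> _ ->.
- by move=> *; rewrite addrA.
- by move=> *; rewrite addrC.
- by move=> *; rewrite add0r.
- by move=> *; rewrite mulrA.
- by move=> *; rewrite mul1r.
- by move=> *; rewrite mul0r.
- by move=> *; rewrite mulrDl.
- by move=> *; rewrite mulrDr.
- by move=> *; rewrite mulrC.
- by move=> *; rewrite addr0.
- by move=> *; rewrite mulr0.
- exact: relator_counit.
Qed.

Fact palg_nz : palg_cst 1 != 0.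
Proof.
by apply/eqP=> /palg_piP/cong_counit /= /eqP; rewrite oner_eq0.
Qed.
HB.instance Definition _ := GRing.Zmodule_isNzRing.Build palg
  palg_mulA palg_mul1 palg_mulr1 palg_mulDl palg_mulDr palg_nz.

Fact palg_scaleA a b x :
  palg_scale a (palg_scale b x) = palg_scale (a * b) x.
Proof.
elim/palgW: x => x; rewrite !piE; apply/palg_piP.
apply: CongTrans (CongMulA R _ _ _) _.
exact: CongMul (CongSym (CongCstM R _ _)) (CongRefl R _).
Qed.
Fact palg_scale1 : left_id 1 palg_scale.
Proof. by elim/palgW=> a; rewrite !piE; exact/palg_piP/CongMul1. Qed.
Fact palg_scaleDr : right_distributive palg_scale +%R.
Proof.
move=> a x y; rewrite -[x]palg_reprK -[y]palg_reprK.
rewrite -[LHS]/(palg_scale _ (palg_add _ _)) -[RHS]/(palg_add _ _) !piE.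
exact/palg_piP/CongMulDr.
Qed.
Fact palg_scaleDl x : {morph palg_scale^~ x : a b / a + b}.
Proof.
move=> a b; rewrite -[x]palg_reprK -[RHS]/(palg_add _ _) !piE.
apply/palg_piP.
apply: CongTrans (CongMul (CongCstD R _ _) (CongRefl R _)) _.
exact: CongMulDl.
Qed.
HB.instance Definition _ := GRing.Zmodule_isLmodule.Build k palg
  palg_scaleA palg_scale1 palg_scaleDr palg_scaleDl.

Fact palg_scaleAl (c : k) (x y : palg) : c *: (x * y) = (c *: x) * y.
Proof.
rewrite -[x]palg_reprK -[y]palg_reprK.
rewrite -[LHS]/(palg_scale _ (palg_mul _ _)).
rewrite -[RHS]/(palg_mul (palg_scale _ _) _) !piE.
exact/palg_piP/CongMulA.
Qed.
HB.instance Definition _ := GRing.Lmodule_isLalgebra.Build k palg palg_scaleAl.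

Fact palg_scaleAr (c : k) (x y : palg) : c *: (x * y) = x * (c *: y).
Proof.
rewrite -[x]palg_reprK -[y]palg_reprK.
rewrite -[LHS]/(palg_scale _ (palg_mul _ _)).
rewrite -[RHS]/(palg_mul _ (palg_scale _ _)) !piE.
apply/palg_piP; apply: CongTrans (CongMulA R _ _ _) _.
apply: CongTrans (CongMul (CongCstC R _ _) (CongRefl R _)) _.
exact: CongSym (CongMulA R _ _ _).
Qed.
HB.instance Definition _ :=
  GRing.Lalgebra_isAlgebra.Build k palg palg_scaleAr.

Lemma palg_piD a b : palg_pi (TAdd a b) = palg_pi a + palg_pi b.
Proof. by rewrite -palg_pi_add. Qed.
Lemma palg_piM a b : palg_pi (TMul a b) = palg_pi a * palg_pi b.
Proof. by rewrite -palg_pi_mul. Qed.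
Lemma palg_piC c : palg_pi (TCst V c) = c%:A.
Proof.
rewrite -[RHS]/(palg_scale c (palg_cst 1)) /palg_cst piE; apply/palg_piP.
rewrite -[c in X in cong R X _]mulr1; exact: CongCstM.
Qed.

Fact palg_gen_linear : linear palg_gen.
Proof.
move=> c u v.
have ->: c *: palg_gen u = palg_pi (TMul (TCst V c) (TGen u)).
  exact: palg_pi_scale.
rewrite -palg_piD.
apply/palg_piP; apply: CongTrans (CongGenD R _ _) _.
exact: CongAdd (CongGenZ R _ _) (CongRefl R _).
Qed.
HB.instance Definition _ :=
  GRing.isLinear.Build k V palg _ palg_gen palg_gen_linear.

End PresentedAlgebra.

HB.mixin Record isLie (k : fieldType) L of GRing.Lmodule k L := {
  lie : L -> L -> L;
  lie_linearl : forall c x y z, lie (c *: x + y) z = c *: lie x z + lie y z;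
  lie_linearr : forall c x y z, lie z (c *: x + y) = c *: lie z x + lie z y;
  liexx : forall x, lie x x = 0;
  lie_jacobi : forall x y z,
    lie x (lie y z) + lie y (lie z x) + lie z (lie x y) = 0
}.

#[short(type="lieAlgType")]
HB.structure Definition LieAlgebra (k : fieldType) :=
  { L of isLie k L & GRing.Lmodule k L }.

Record lie_rep (k : fieldType) (L : lieAlgType k) (V : lmodType k) := LieRep {
  rep_act :> L -> V -> V;
  rep_linearl : forall c x y v,
    rep_act (c *: x + y) v = c *: rep_act x v + rep_act y v;
  rep_linearr : forall x, linear (rep_act x);
  rep_lie : forall x y v,
    rep_act (lie x y) v = rep_act x (rep_act y v) - rep_act y (rep_act x v)
}.

Section AdjointRepresentation.
Variables (k : fieldType) (L : lieAlgType k).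
Implicit Types x y z : L.

Fact lieDl x y z : lie (x + y) z = lie x z + lie y z.
Proof. by rewrite -[x]scale1r lie_linearl !scale1r. Qed.
Fact lieDr x y z : lie z (x + y) = lie z x + lie z y.
Proof. by rewrite -[x]scale1r lie_linearr !scale1r. Qed.
Fact lieC x y : lie y x = - lie x y.
Proof.
apply/eqP; rewrite -addr_eq0; apply/eqP.
by have := liexx (y + x); rewrite lieDl !lieDr !liexx add0r addr0.
Qed.
Fact lieN x y : lie x (- y) = - lie x y.
Proof.
have lie0 : lie x 0 = 0.
  by apply: (addIr (lie x 0)); rewrite -lieDr !add0r.
by apply/eqP; rewrite -addr_eq0 -lieDr addNr lie0.
Qed.
Fact adjoint_lie x y z :
  lie (lie x y) z = lie x (lie y z) - lie y (lie x z).
Proof.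
rewrite (lieC z (lie x y)) (lieC z x) lieN opprK.
by apply/esym/eqP; rewrite -addr_eq0 lie_jacobi.
Qed.

Fact adjoint_linearr x : linear (lie x).
Proof. by move=> c u v; rewrite lie_linearr. Qed.

Definition adjoint_rep : lie_rep L L :=
  LieRep (fun c x y v => lie_linearl c x y v) adjoint_linearr adjoint_lie.

Fact trivial_linearl (c : k) (x y : L) (v : k^o) : (0 : k^o) = c *: 0 + 0.
Proof. by rewrite scaler0 addr0. Qed.
Fact trivial_linearr (x : L) : linear ((fun=> 0) : k^o -> k^o).
Proof. by move=> c u v; rewrite scaler0 addr0. Qed.
Fact trivial_lie (x y : L) (v : k^o) : (0 : k^o) = 0 - 0.
Proof. by rewrite subr0. Qed.

Definition trivial_rep : lie_rep L k^o :=
  @LieRep k L k^o (fun _ _ => 0) trivial_linearl trivial_linearr trivial_lie.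

End AdjointRepresentation.

Section SpecialLinear.
Variables (k : fieldType) (m : nat).

Definition traceless : {pred 'M[k]_m} := [pred A | \tr A == 0].

Fact traceless_closed : submod_closed traceless.
Proof.
split=> [|c A B]; rewrite !inE ?linear0 // => /eqP A0 /eqP B0.
by rewrite linearP /= A0 B0 mulr0 addr0.
Qed.
HB.instance Definition _ :=
  GRing.isSubmodClosed.Build k 'M[k]_m traceless traceless_closed.

Definition sl : Type := submod traceless.
HB.instance Definition _ := GRing.Lmodule.on sl.

Fact commutator_traceless (A B : 'M[k]_m) : A *m B - B *m A \in traceless.
Proof. by rewrite inE linearB /= mxtrace_mulC subrr. Qed.

Definition sl_lie (x y : sl) : sl :=
  Submod (commutator_traceless (submod_val x) (submod_val y)).

Fact sl_lie_linearl c x y z :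
  sl_lie (c *: x + y) z = c *: sl_lie x z + sl_lie y z.
Proof.
apply: val_inj; rewrite /= mulmxDl mulmxDr -scalemxAl -scalemxAr scalerBr.
by rewrite opprD addrACA.
Qed.
Fact sl_lie_linearr c x y z :
  sl_lie z (c *: x + y) = c *: sl_lie z x + sl_lie z y.
Proof.
apply: val_inj; rewrite /= mulmxDl mulmxDr -scalemxAl -scalemxAr scalerBr.
by rewrite opprD addrACA.
Qed.
Fact sl_liexx x : sl_lie x x = 0.
Proof. by apply: val_inj; rewrite /= subrr. Qed.
Fact sl_lie_jacobi x y z :
  sl_lie x (sl_lie y z) + sl_lie y (sl_lie z x) + sl_lie z (sl_lie x y) = 0.
Proof.
apply: val_inj => /=; rewrite !(mulmxBl, mulmxBr) !mulmxA !opprB.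
rewrite (AC ((2*2)*(2*2)*(2*2))
            ((1*12)*(2*7)*(3*10)*(4*5)*(6*11)*(8*9)))/=.
by rewrite !subrr !addNr !addr0.
Qed.
HB.instance Definition _ :=
  isLie.Build k sl sl_lie_linearl sl_lie_linearr sl_liexx sl_lie_jacobi.

End SpecialLinear.

Section EnvelopingAlgebra.
Variables (k : fieldType) (L : lieAlgType k).

Definition env_relator (a b : term L) : Prop :=
  exists x y : L, a = TMul (TGen x) (TGen y) /\
    b = TAdd (TMul (TGen y) (TGen x)) (TGen (lie x y)).

Fact env_relator_counit a b : env_relator a b -> counit a = counit b.
Proof. by case=> [x [y [-> ->]]] /=; rewrite !mul0r addr0. Qed.

Definition env_relations := Relations env_relator_counit.

Definition env : Type := palg env_relations.
HB.instance Definition _ := GRing.Algebra.on env.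

Definition env_gen : L -> env := @palg_gen k L env_relations.
HB.instance Definition _ := GRing.Linear.on env_gen.

Lemma env_lie x y :
  env_gen (lie x y) = env_gen x * env_gen y - env_gen y * env_gen x.
Proof.
apply/eqP; rewrite eq_sym subr_eq addrC -[_ * _]palg_piM -[_ * _ in X in _ == X]palg_piM.
rewrite -[_ + _]palg_piD; apply/eqP/palg_piP/CongRel.
by exists x, y.
Qed.

Variables (V : lmodType k) (rho : lie_rep L V).

Fixpoint term_act (a : term L) (v : V) : V :=
  match a with
  | TGen x => rho x v
  | TCst c => c *: v
  | TAdd a b => term_act a v + term_act b v
  | TMul a b => term_act a (term_act b v)
  end.

Fact term_act_linear a : linear (term_act a).
Proof.
elim: a => [x|c|a IHa b IHb|a IHa b IHb] d u v /=.
- exact: rep_linearr.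
- by rewrite scalerDr !scalerA mulrC.
- by rewrite IHa IHb scalerDr addrACA.
- by rewrite IHb IHa.
Qed.

Fact term_actD a u v : term_act a (u + v) = term_act a u + term_act a v.
Proof. by rewrite -[u]scale1r term_act_linear !scale1r. Qed.
Fact term_act0 a : term_act a 0 = 0.
Proof. by apply: (addIr (term_act a 0)); rewrite -term_actD !add0r. Qed.
Fact term_actZ a c u : term_act a (c *: u) = c *: term_act a u.
Proof. by rewrite -[c *: u]addr0 term_act_linear term_act0 addr0. Qed.

Fact cong_act a b : cong env_relations a b -> term_act a =1 term_act b.
Proof.
elim=> //=.
- by move=> {}a {}b _ IH v; rewrite IH.
- by move=> {}a {}b c _ IH _ IH' v; rewrite IH.
- by move=> {}a a' {}b b' _ IH _ IH' v; rewrite IH IH'.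
- by move=> {}a a' {}b b' _ IH _ IH' v; rewrite IH IH'.
- by move=> {}a {}b c v; rewrite addrA.
- by move=> {}a {}b v; rewrite addrC.
- by move=> {}a v; rewrite scale0r add0r.
- by move=> {}a v; rewrite scale1r.
- by move=> {}a v; rewrite !scale0r.
- by move=> {}a {}b c v; rewrite term_actD.
- by move=> x y v; rewrite scalerDl.
- by move=> x y v; rewrite scalerA.
- by move=> x {}a v; rewrite term_actZ.
- by move=> u w v; rewrite -[u]scale1r rep_linearl !scale1r.
- move=> x u v; have rho0 : rho 0 v = 0.
    have := rep_linearl rho 1 0 0 v; rewrite !scale1r addr0 => /eqP.
    by rewrite -subr_eq subrr eq_sym => /eqP.
  by rewrite -[x *: u]addr0 rep_linearl rho0 addr0.
- move=> {}a {}b [x [y [-> ->]]] v /=.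
  by rewrite rep_lie addrC subrK.
Qed.

Definition env_mod (_ : lie_rep L V) : Type := V.
Local Notation rhoM := (env_mod rho).
HB.instance Definition _ := GRing.Zmodule.copy rhoM V.

Definition env_scale (u : env) (v : rhoM) : rhoM :=
  term_act (palg_repr u) v.

Fact env_scale_pi a v : env_scale (palg_pi env_relations a) v = term_act a v.
Proof. exact/cong_act/palg_repr_pi. Qed.

Fact env_scaleA a b v : env_scale a (env_scale b v) = env_scale (a * b) v.
Proof.
by rewrite -[a]palg_reprK -[b]palg_reprK -[_ * _]palg_piM !env_scale_pi.
Qed.
Fact env_scale1 : left_id 1 env_scale.
Proof. by move=> v; rewrite [LHS]env_scale_pi /= scale1r. Qed.
Fact env_scaleDr : right_distributive env_scale +%R.
Proof. by move=> a u v; exact: term_actD. Qed.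
Fact env_scaleDl v : {morph env_scale^~ v : a b / a + b}.
Proof.
move=> a b; rewrite -[a]palg_reprK -[b]palg_reprK.
by rewrite -[_ + _]palg_piD !env_scale_pi.
Qed.
HB.instance Definition _ := GRing.Zmodule_isLmodule.Build env rhoM
  env_scaleA env_scale1 env_scaleDr env_scaleDl.

Lemma env_scale_gen (x : L) (v : rhoM) : env_gen x *: v = rho x v.
Proof. exact: env_scale_pi. Qed.
Lemma env_scale_cst (c : k) (v : rhoM) : (c%:A : env) *: v = c *: (v : V).
Proof. by rewrite -[c%:A](palg_piC env_relations) [LHS]env_scale_pi. Qed.

End EnvelopingAlgebra.

Section SymmetricAlgebra.
Variables (k : fieldType) (V : lmodType k).

Definition sym_relator (a b : term V) : Prop :=
  exists u v : V, a = TMul (TGen u) (TGen v) /\ b = TMul (TGen v) (TGen u).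

Fact sym_relator_counit a b : sym_relator a b -> counit a = counit b.
Proof. by case=> [u [v [-> ->]]] /=; rewrite !mul0r. Qed.

Definition sym_relations := Relations sym_relator_counit.

Definition sym : Type := palg sym_relations.
HB.instance Definition _ := GRing.Algebra.on sym.

Definition sym_gen : V -> sym := @palg_gen k V sym_relations.
HB.instance Definition _ := GRing.Linear.on sym_gen.

Fact sym_genC u (s : sym) : GRing.comm (sym_gen u) s.
Proof.
rewrite -[s]palg_reprK; elim: (palg_repr s) => [v|c|a IHa b IHb|a IHa b IHb].
- rewrite /GRing.comm -[_ * _]palg_piM -[RHS]palg_piM.
  by apply/palg_piP/CongRel; exists u, v.
- by rewrite palg_piC /GRing.comm mulr_algr mulr_algl.
- by rewrite palg_piD; apply: commrD.
- by rewrite palg_piM; apply: commrM.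
Qed.

Fact sym_mulC : commutative (@GRing.mul sym).
Proof.
move=> s t; rewrite -[t]palg_reprK.
elim: (palg_repr t) => [v|c|a IHa b IHb|a IHa b IHb].
- exact/esym/sym_genC.
- by rewrite palg_piC mulr_algr mulr_algl.
- by rewrite palg_piD mulrDl mulrDr IHa IHb.
- by rewrite palg_piM mulrA IHa -mulrA IHb mulrA.
Qed.
HB.instance Definition _ := GRing.PzRing_hasCommutativeMul.Build sym sym_mulC.

(* The degree n component of the symmetric algebra, i.e. the image of the n-th *)
(* tensor power of V: the span of the products of n elements of V.            *)
Definition sym_homog (n : nat) : {pred sym} := fun s =>
  `[< exists (m : nat) (c : 'I_m -> k) (v : 'I_m -> 'I_n -> V),
        s = \sum_(i < m) c i *: \prod_(j < n) sym_gen (v i j) >].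

Fact sym_homog_closed n : submod_closed (sym_homog n).
Proof.
split=> [|a s t].
  by apply/asboolP; exists 0, (fun=> 0), (fun _ _ => 0); rewrite big_ord0.
move=> /asboolP[m [c [v ->]]] /asboolP[m' [c' [v' ->]]]; apply/asboolP.
exists (m + m')%N.
exists (fun i => match split i with inl i => a * c i | inr i => c' i end).
exists (fun i => match split i with inl i => v i | inr i => v' i end).
rewrite big_split_ord /= scaler_sumr; congr (_ + _); apply: eq_bigr => i _.
  by rewrite (unsplitK (inl i)) scalerA.
by rewrite (unsplitK (inr i)).
Qed.
HB.instance Definition _ n :=
  GRing.isSubmodClosed.Build k sym (sym_homog n) (sym_homog_closed n).

Definition sym_pow (n : nat) : Type := submod (sym_homog n).
HB.instance Definition _ n := GRing.Lmodule.on (sym_pow n).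

End SymmetricAlgebra.

Arguments sym_homog [k] V n _.

Section SymmetricPowerRep.
Variables (k : fieldType) (L : lieAlgType k) (V : lmodType k).
Variable rho : lie_rep L V.

Fixpoint term_der (x : L) (a : term V) : sym V :=
  match a with
  | TGen v => sym_gen (rho x v)
  | TCst _ => 0
  | TAdd a b => term_der x a + term_der x b
  | TMul a b =>
      term_der x a * palg_pi _ b + palg_pi (sym_relations V) a * term_der x b
  end.

Fact cong_der x a b :
  cong (sym_relations V) a b -> term_der x a = term_der x b.
Proof.
have rhoD u v : rho x (u + v) = rho x u + rho x v.
  by rewrite -[u]scale1r rep_linearr !scale1r.
have rho0 : rho x 0 = 0.
  by apply: (addIr (rho x 0)); rewrite -rhoD !add0r.
have piE c : palg_pi (sym_relations V) (TCst V c) = c%:A := palg_piC _ c.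
elim=> //=.
- by move=> {}a {}b c _ -> _ ->.
- by move=> {}a a' {}b b' _ -> _ ->.
- by move=> {}a a' {}b b' /palg_piP -> -> /palg_piP -> ->.
- by move=> *; rewrite addrA.
- by move=> *; rewrite addrC.
- by move=> *; rewrite add0r.
- by move=> *; rewrite !palg_piM mulrDl mulrDr !mulrA addrA.
- by move=> *; rewrite piE mul0r add0r scale1r mul1r.
- by move=> *; rewrite piE mul0r scale0r mul0r addr0.
- by move=> *; rewrite palg_piD !mulrDl addrACA.
- by move=> *; rewrite palg_piD !mulrDr addrACA.
- by rewrite addr0.
- by move=> *; rewrite mul0r mulr0 addr0.
- by move=> *; rewrite mul0r mulr0 addr0 add0r piE mulr_algr mulr_algl.
- by move=> u v; rewrite rhoD linearD.
- move=> c v; rewrite mul0r add0r piE mulr_algl -linearZ /=.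
  by rewrite -[c *: v]addr0 rep_linearr rho0 addr0.
- move=> {}a {}b [u [v [-> ->]]] /=.
  by rewrite addrC; congr (_ + _); exact: sym_mulC.
Qed.

Definition sym_der (x : L) (s : sym V) : sym V := term_der x (palg_repr s).

Lemma sym_der_pi x a : sym_der x (palg_pi _ a) = term_der x a.
Proof. exact/cong_der/palg_repr_pi. Qed.

Lemma sym_der_gen x v : sym_der x (sym_gen v) = sym_gen (rho x v).
Proof. exact: sym_der_pi. Qed.

Lemma sym_derD x s t : sym_der x (s + t) = sym_der x s + sym_der x t.
Proof.
by rewrite -[s]palg_reprK -[t]palg_reprK -[_ + _]palg_piD !sym_der_pi.
Qed.

Lemma sym_derM x s t :
  sym_der x (s * t) = sym_der x s * t + s * sym_der x t.
Proof.
by rewrite -[s]palg_reprK -[t]palg_reprK -[_ * _]palg_piM !sym_der_pi.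
Qed.

Lemma sym_derC x c : sym_der x c%:A = 0.
Proof. by rewrite -(palg_piC (sym_relations V)) sym_der_pi. Qed.

Lemma sym_der0 x : sym_der x 0 = 0.
Proof. by rewrite -[X in sym_der x X](scale0r (1 : sym V)) sym_derC. Qed.

Lemma sym_derZ x c s : sym_der x (c *: s) = c *: sym_der x s.
Proof. by rewrite -mulr_algl sym_derM sym_derC mul0r add0r mulr_algl. Qed.

Lemma sym_der_sum x m (F : 'I_m -> sym V) :
  sym_der x (\sum_(i < m) F i) = \sum_(i < m) sym_der x (F i).
Proof.
elim: m F => [|m IHm] F; last by rewrite !big_ord_recl sym_derD IHm.
by rewrite !big_ord0 sym_der0.
Qed.

Fact sym_homog_prod n (v : 'I_n -> V) :
  \prod_(j < n) sym_gen (v j) \in sym_homog V n.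
Proof.
apply/asboolP; exists 1, (fun=> 1), (fun=> v).
by rewrite big_ord1 scale1r.
Qed.

Fact sym_der_prod x n (v : 'I_n -> V) :
  sym_der x (\prod_(j < n) sym_gen (v j)) =
  \sum_(i < n)
     \prod_(j < n) sym_gen (if j == i then rho x (v j) else v j).
Proof.
elim: n v => [|n IHn] v.
  by rewrite !big_ord0 -[1](scale1r 1) sym_derC.
rewrite big_ord_recl sym_derM IHn sym_der_gen [RHS]big_ord_recl.
congr (_ + _).
  by rewrite [RHS]big_ord_recl eqxx; congr (_ * _); apply: eq_bigr.
rewrite mulr_sumr; apply: eq_bigr => i _.
by rewrite [RHS]big_ord_recl /=; congr (_ * _).
Qed.

Fact sym_der_homog n x s : s \in sym_homog V n -> sym_der x s \in sym_homog V n.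
Proof.
move=> /asboolP[m [c [v ->]]]; rewrite sym_der_sum rpred_sum // => i _.
rewrite sym_derZ rpredZ // sym_der_prod rpred_sum // => j _.
exact: sym_homog_prod.
Qed.

Definition sym_pow_act n (x : L) (s : sym_pow V n) : sym_pow V n :=
  Submod (sym_der_homog x (submodP s)).

Fact sym_der_linearl c x y s :
  sym_der (c *: x + y) s = c *: sym_der x s + sym_der y s.
Proof.
rewrite -[s]palg_reprK !sym_der_pi.
elim: (palg_repr s) => [v|d|a IHa b IHb|a IHa b IHb] /=.
- by rewrite rep_linearl linearP.
- by rewrite scaler0 addr0.
- by rewrite IHa IHb scalerDr addrACA.
- by rewrite IHa IHb mulrDl mulrDr scalerDr -scalerAl -scalerAr addrACA.
Qed.

Fact sym_der_lie x y s :
  sym_der (lie x y) s = sym_der x (sym_der y s) - sym_der y (sym_der x s).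
Proof.
rewrite -[s]palg_reprK; elim: (palg_repr s) => [v|d|a IHa b IHb|a IHa b IHb].
- by rewrite !sym_der_gen rep_lie linearB.
- have der_cst z : sym_der z (palg_pi _ (TCst V d)) = 0 by exact: sym_der_pi.
  by rewrite !der_cst !sym_der0 subrr.
- by rewrite palg_piD !sym_derD IHa IHb opprD addrACA.
- rewrite palg_piM !sym_derM !sym_derD !sym_derM IHa IHb mulrBl mulrBr !opprD.
  rewrite [RHS](AC ((2*2)*(2*2)) ((1*5)*(4*8)*(2*7)*(3*6)))/=.
  by rewrite !subrr !addr0.
Qed.

Fact sym_pow_linearl n c x y (s : sym_pow V n) :
  sym_pow_act (c *: x + y) s = c *: sym_pow_act x s + sym_pow_act y s.
Proof. by apply: val_inj; rewrite /= sym_der_linearl. Qed.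
Fact sym_pow_linearr n x : linear (@sym_pow_act n x).
Proof.
by move=> c s t; apply: val_inj; rewrite /= sym_derD sym_derZ.
Qed.
Fact sym_pow_lie n x y (s : sym_pow V n) :
  sym_pow_act (lie x y) s =
  sym_pow_act x (sym_pow_act y s) - sym_pow_act y (sym_pow_act x s).
Proof. by apply: val_inj; rewrite /= sym_der_lie. Qed.

Definition sym_pow_rep (n : nat) : lie_rep L (sym_pow V n) :=
  LieRep (@sym_pow_linearl n) (@sym_pow_linearr n) (@sym_pow_lie n).

End SymmetricPowerRep.

Section HomSpace.
Variables (k : fieldType) (U : algType k) (P N : lmodType U).

(* Hom_U(P, N), a vector space over k through the central map c |-> c%:A of k *)
(* into U.                                                                    *)
Record hom := Hom { hom_fun :> P -> N; hom_linear : linear hom_fun }.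

HB.instance Definition _ (f : hom) :=
  GRing.isLinear.Build U P N _ (hom_fun f) (@hom_linear f).
HB.instance Definition _ := gen_eqMixin hom.
HB.instance Definition _ := gen_choiceMixin hom.

Lemma homP (f g : hom) : hom_fun f =1 hom_fun g <-> f = g.
Proof.
split=> [|->//]; case: f g => [f fl] [g gl] /= /funext fg.
by case: _ / fg gl => gl; congr Hom; exact: Prop_irrelevance.
Qed.

Fact hom_zero_linear : linear ((fun=> 0) : P -> N).
Proof. by move=> c u v; rewrite scaler0 addr0. Qed.
Fact hom_add_linear (f g : hom) : linear (fun x => f x + g x).
Proof. by move=> c u v; rewrite !linearP scalerDr addrACA. Qed.
Fact hom_opp_linear (f : hom) : linear (fun x => - f x).
Proof. by move=> c u v; rewrite linearP opprD scalerN. Qed.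
Fact hom_scale_linear (c : k) (f : hom) : linear (fun x => c%:A *: f x).
Proof.
by move=> u x y; rewrite linearP scalerDr !scalerA mulr_algl mulr_algr.
Qed.

Definition hom_zero := Hom hom_zero_linear.
Definition hom_add f g := Hom (hom_add_linear f g).
Definition hom_opp f := Hom (hom_opp_linear f).
Definition hom_scale c f := Hom (hom_scale_linear c f).

Fact hom_addA : associative hom_add.
Proof. by move=> f g h; apply/homP => x /=; rewrite addrA. Qed.
Fact hom_addC : commutative hom_add.
Proof. by move=> f g; apply/homP => x /=; rewrite addrC. Qed.
Fact hom_add0 : left_id hom_zero hom_add.
Proof. by move=> f; apply/homP => x /=; rewrite add0r. Qed.
Fact hom_addN : left_inverse hom_zero hom_opp hom_add.
Proof. by move=> f; apply/homP => x /=; rewrite addNr. Qed.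
HB.instance Definition _ :=
  GRing.isZmodule.Build hom hom_addA hom_addC hom_add0 hom_addN.

Fact hom_scaleA a b f : hom_scale a (hom_scale b f) = hom_scale (a * b) f.
Proof.
by apply/homP => x /=; rewrite scalerA mulr_algl scalerA.
Qed.
Fact hom_scale1 : left_id 1 hom_scale.
Proof. by move=> f; apply/homP => x /=; rewrite !scale1r. Qed.
Fact hom_scaleDr : right_distributive hom_scale +%R.
Proof. by move=> a f g; apply/homP => x /=; rewrite scalerDr. Qed.
Fact hom_scaleDl f : {morph hom_scale^~ f : a b / a + b}.
Proof. by move=> a b; apply/homP => x /=; rewrite !scalerDl. Qed.
HB.instance Definition _ := GRing.Zmodule_isLmodule.Build k hom
  hom_scaleA hom_scale1 hom_scaleDr hom_scaleDl.

End HomSpace.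

Definition projective (U : nzRingType) (P : lmodType U) : Prop :=
  forall (A B : lmodType U) (g : {linear A -> B}) (f : {linear P -> B}),
    (forall b, exists a, g a = b) ->
    exists h : {linear P -> A}, forall x, g (h x) = f x.

Record proj_resolution (U : nzRingType) (M : lmodType U) := ProjResolution {
  res_obj :> nat -> lmodType U;
  res_dif : forall i, {linear res_obj i.+1 -> res_obj i};
  res_aug : {linear res_obj 0 -> M};
  res_projective : forall i, projective (res_obj i);
  res_aug_surj : forall m, exists x, res_aug x = m;
  res_exact0 : forall x, res_aug x = 0 <-> exists y, res_dif 0 y = x;
  res_exact : forall i x, res_dif i x = 0 <-> exists y, res_dif i.+1 y = x
}.

Section Ext.
Variables (k : fieldType) (U : algType k) (M : lmodType U).
Variables (P : proj_resolution M) (N : lmodType U).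

Definition cocycle (i : nat) : {pred hom (P i) N} :=
  fun f => `[< forall x, f (res_dif P i x) = 0 >].

Arguments cocycle : clear implicits.

Fact cocycle_closed i : submod_closed (cocycle i).
Proof.
split=> [|c f g]; first exact/asboolP.
move=> /asboolP f0 /asboolP g0; apply/asboolP => x /=.
by rewrite f0 g0 scaler0 addr0.
Qed.
HB.instance Definition _ i :=
  GRing.isSubmodClosed.Build k (hom (P i) N) (cocycle i) (cocycle_closed i).

Definition is_coboundary (i : nat) : hom (P i) N -> Prop :=
  match i with
  | 0 => fun f => f = 0
  | j.+1 => fun f => exists g : hom (P j) N, forall x, f x = g (res_dif P j x)
  end.

Definition coboundary (i : nat) : {pred submod (cocycle i)} :=
  fun z => `[< is_coboundary (submod_val z) >].

Arguments coboundary : clear implicits.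

Fact coboundary_closed i : submod_closed (coboundary i).
Proof.
split=> [|c f g].
  by apply/asboolP; case: i => [|i] //=; exists 0.
move=> /asboolP f0 /asboolP g0; apply/asboolP.
case: i f g f0 g0 => [|i] f g /=; first by move=> -> ->; rewrite scaler0 addr0.
move=> [f' ff'] [g' gg']; exists (c *: f' + g') => x.
by rewrite /= ff' gg'.
Qed.
HB.instance Definition _ i :=
  GRing.isSubmodClosed.Build k (submod (cocycle i)) (coboundary i)
    (coboundary_closed i).

(* Ext^i_U(M, N) = H^i(Hom_U(P, N)), for a projective resolution P of M; it is *)
(* independent of P up to isomorphism, and free_resolution M is one such P.  *)
Definition Ext (i : nat) : lmodType k := lquot (coboundary i).

End Ext.

Arguments cocycle [k U M] P N i _.
Arguments coboundary [k U M] P N i _.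

(* Every module has a (free, hence) projective resolution. *)
Section FreeResolution.
Import finmap monalg.
Variable U : nzRingType.

Definition free_mod (X : choiceType) : lmodType U := malg X U.

Definition free_lift_fun (X : choiceType) (A : lmodType U) (g : X -> A)
    (u : free_mod X) : A :=
  \sum_(x <- msupp u) mcoeff x u *: g x.

Lemma free_liftEw (X : choiceType) (A : lmodType U) (g : X -> A)
    (d : {fset X}) (u : free_mod X) :
  fsubset (msupp u) d -> free_lift_fun g u = \sum_(x <- d) mcoeff x u *: g x.
Proof.
move=> le; rewrite /free_lift_fun (big_fset_incl _ le) // => x xd.
by move/mcoeff_outdom=> ->; rewrite scale0r.
Qed.

Fact free_lift_linear (X : choiceType) (A : lmodType U) (g : X -> A) :
  linear (free_lift_fun g).
Proof.
move=> c u v; pose d := fsetU (msupp (c *: u + v)) (fsetU (msupp u) (msupp v)).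
rewrite !(@free_liftEw _ _ g d) ?fsubsetUl //; last 2 first.
- by rewrite fsubsetU // fsubsetUr orbT.
- by rewrite fsubsetU // fsubsetUl orbT.
rewrite scaler_sumr -big_split /=; apply: eq_bigr => x _.
by rewrite mcoeffD [mcoeff x (c *: u)]fgscaleE scalerDl scalerA.
Qed.
HB.instance Definition _ (X : choiceType) (A : lmodType U) (g : X -> A) :=
  GRing.isLinear.Build U (free_mod X) A _ (free_lift_fun g)
    (@free_lift_linear X A g).

Lemma free_lift_gen (X : choiceType) (A : lmodType U) (g : X -> A) x :
  free_lift_fun g (mkmalgU x 1) = g x.
Proof.
rewrite (@free_liftEw _ _ _ (fset1 x)) ?msuppU_le //.
by rewrite big_seq_fset1 mcoeffUU scale1r.
Qed.

Lemma free_genE (X : choiceType) (A : lmodType U) (f : {linear free_mod X -> A})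
    (u : free_mod X) :
  f u = free_lift_fun (fun x => f (mkmalgU x 1)) u.
Proof.
rewrite {1}[u]monalgE linear_sum; apply: eq_bigr => x _.
rewrite -linearZ; congr (f _); apply/malgP => y.
by rewrite [RHS]fgscaleE !mcoeffU mulrnAr mulr1.
Qed.

Lemma free_projective (X : choiceType) : projective (free_mod X).
Proof.
move=> A B g f gs; pose h0 (x : X) := projT1 (cid (gs (f (mkmalgU x 1)))).
have h0E x : g (h0 x) = f (mkmalgU x 1) by rewrite /h0; case: cid.
exists (free_lift_fun h0) => u; rewrite [RHS]free_genE linear_sum.
by apply: eq_bigr => x _; rewrite linearZ /= h0E.
Qed.

Definition ker_pred (A B : lmodType U) (f : {linear A -> B}) : {pred A} :=
  fun x => f x == 0.

Fact ker_closed (A B : lmodType U) (f : {linear A -> B}) :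
  submod_closed (ker_pred f).
Proof.
split=> [|c x y]; first by rewrite unfold_in linear0.
by rewrite !unfold_in linearP => /eqP-> /eqP->; rewrite scaler0 addr0.
Qed.
HB.instance Definition _ (A B : lmodType U) (f : {linear A -> B}) :=
  GRing.isSubmodClosed.Build U A (ker_pred f) (ker_closed f).

Definition cover (A : lmodType U) : {linear free_mod A -> A} :=
  free_lift_fun id.

Lemma cover_surj (A : lmodType U) (a : A) : exists x, cover A x = a.
Proof. by exists (mkmalgU a 1); apply: free_lift_gen. Qed.

Variable M : lmodType U.

Fixpoint syzygy (i : nat) : lmodType U :=
  match i with
  | 0 => M
  | j.+1 => submod (ker_pred (cover (syzygy j)))
  end.

Definition free_res (i : nat) : lmodType U := free_mod (syzygy i).

Definition free_dif (i : nat) : {linear free_res i.+1 -> free_res i} :=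
  (val : syzygy i.+1 -> free_res i) \o cover (syzygy i.+1).

Lemma free_dif_im i x :
  cover (syzygy i) x = 0 <-> exists y, free_dif i y = x.
Proof.
split=> [/eqP x0|[y <-]]; last exact/eqP/(submodP (cover (syzygy i.+1) y)).
have [y yE] := cover_surj (@Submod U _ (ker_pred (cover (syzygy i))) x x0 : syzygy i.+1).
by exists y; rewrite /= [cover _ y]yE.
Qed.

Lemma free_dif_ker i x : free_dif i x = 0 <-> cover (syzygy i.+1) x = 0.
Proof.
split=> [x0|x0]; first exact: val_inj.
by rewrite /free_dif /= [cover _ x]x0.
Qed.

Definition free_resolution : proj_resolution M.
Proof.
apply: (@ProjResolution U M free_res free_dif (cover M)).
- by move=> i; apply: free_projective.
- exact: cover_surj.
- exact: (@free_dif_im 0).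
- by move=> i x; rewrite free_dif_ker; exact: (@free_dif_im i.+1).
Defined.

End FreeResolution.

(* Main.v *)
From HB Require Import structures.
Require Import Defs.
From mathcomp Require Import all_boot all_algebra.
From mathcomp Require Import boolp ring ssrAC zify.
Set Implicit Arguments.
Unset Strict Implicit.
Unset Printing Implicit Defensive.
Import GRing.Theory Defs.
Local Open Scope ring_scope.

(** The trivial module over U = U(sl_2) has the Chevalley-Eilenberg resolution
    0 -> U -> U^3 -> U^3 -> U, whose exactness comes from a PBW basis of U. Since Ext does
    not depend on the resolution, Ext^2(k, V) is computed by this one; subtracting the
    obvious coboundaries turns a 2-cocycle into a pair (a, b) of vectors of V with
    e b = f a, and makes it trivial when, for some ne and nf and with g = e nf - f ne, it
    is (e g - h ne + 2 ne, f g - h nf - 2 nf).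

    For V = S^n, the Casimir element C = h^2 + 4 e f of the symmetric algebra is
    invariant, and as 2 is invertible S^n has the basis e^w C^i h^c, f^w C^i h^c with
    w + 2 i + c = n. The exponent i is determined by w and c, so the part of weight w, on
    which h acts by 2w, is a space of polynomials in one variable X (the class of h when
    C = 1), namely those of degree at most n - w with the parity of n - w. There e acts as
    -2 d/dX, from weight w to w + 1, and f comes from the quadric T = 1 - X^2: when w = 0
    in k it is half of q |-> (T q)', from weight w + 1 to w. Exchanging e with f and
    negating h is a symmetry, so that only weights w >= 0 have to be studied, for both of
    its signs.

    The element h acts by 2w in weight w and by zero on cohomology, so only w = p i
    contributes. Let alpha be the polynomial of a in weight w + 1, beta that of b in
    weight w - 1, and rho = 4 beta + T alpha; for w = 0, beta lives on the other side of
    the symmetry and rho = T (alpha + beta(-X)). In these weights, (a, b) is a cocycle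
    when all rho' = 0, and a coboundary when all rho = 0 and all alpha are second
    derivatives of suitable polynomials. In characteristic p, a polynomial with zero
    derivative has only exponents divisible by p, and a polynomial is a second derivative
    exactly when its exponents congruent to -1 and -2 modulo p are absent. Hence the
    coefficients of rho at X^(p c), and those of alpha at X^(p c + p - 1) and
    X^(p c + p - 2), are coordinates on Ext^2 (cobound_coord_eq0, cobound_of_coords and
    coord_dual). For i = 0, rho is divisible by T, hence rho(1) = 0 and the coefficient at
    X^0 or X^p is dropped.

    Whether a coordinate occurs depends only on j = i + c, through a bound on p j and a
    parity. Each j comes from 2j + 1 pairs of a signed i and a c, and the sum of 2j + 1
    over the j of one parity is a binomial coefficient; card_index_set adds these up. *)

(** * Comparison of projective resolutions *)

Section Comparison.
Variable (U : nzRingType).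

(** The form in which projectivity is used: a map into a kernel lifts along any map onto
    that kernel, because the target of a lifting problem may be cut down to the kernel. *)
Lemma projective_lift (P A B C : lmodType U) (d : {linear A -> B})
    (d' : {linear B -> C}) (f : {linear P -> B}) :
  projective P -> (forall b, d' b = 0 <-> exists a, d a = b) ->
  (forall x, d' (f x) = 0) ->
  exists h : {linear P -> A}, forall x, d (h x) = f x.
Proof.
move=> Pp ex f0; pose K : lmodType U := submod (ker_pred d').
have dK a : d a \in ker_pred d' by apply/eqP/ex; exists a.
have fK x : f x \in ker_pred d' by apply/eqP.
pose dK' a : K := Submod (dK a); pose fK' x : K := Submod (fK x).
have dl : linear dK' by move=> c u v; apply: val_inj; rewrite /= linearP.
have fl : linear fK' by move=> c u v; apply: val_inj; rewrite /= linearP.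
pose dm := GRing.isLinear.Build U A K _ dK' dl.
pose fm := GRing.isLinear.Build U P K _ fK' fl.
pose dL : {linear A -> K} := HB.pack dK' dm.
pose fL : {linear P -> K} := HB.pack fK' fm.
have ds b : exists a, dL a = b.
  have /ex[a da] : d' (submod_val b) = 0 by apply/eqP; exact: submodP b.
  by exists a; apply: val_inj.
by have [h hE] := Pp A K dL fL ds; exists h => x; have /(congr1 val) := hE x.
Qed.

Variables (M : lmodType U).
Implicit Types P Q : proj_resolution M.

Lemma res_dif_dif P i x : res_dif P i (res_dif P i.+1 x) = 0.
Proof. by apply/res_exact; exists x. Qed.

Lemma res_aug_dif P x : res_aug P (res_dif P 0 x) = 0.
Proof. by apply/res_exact0; exists x. Qed.

(** In degree j + 1 the maps factoring through the differential play the role of s d in a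
    homotopy; in degree 0 there is no differential, and only the zero map is left. *)
Definition factors_dif P i : (P i -> P i) -> Prop :=
  match i with
  | 0 => fun u => forall x, u x = 0
  | j.+1 => fun u =>
      exists g : {linear P j -> P j.+1}, forall x, u x = g (res_dif P j x)
  end.

Definition commutes_dif P Q i (f : P i -> Q i) (f' : P i.+1 -> Q i.+1) :=
  forall x, res_dif Q i (f' x) = f (res_dif P i x).

(** Homotopy to the identity at the single spot i: u - 1 = d s up to maps that factor
    through the outgoing differential. Stating it for one i, rather than for a whole
    homotopy, lets the comparison theorem be an induction without dependent choices. *)
Definition homotopic_id P i (u : P i -> P i) :=
  exists s : {linear P i -> P i.+1},
    factors_dif (fun x => u x - x - res_dif P i (s x)).

(** Chain maps extend upwards: f' d lands in the kernel of d, where it lifts. *)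
Lemma lift_next P Q i (f : {linear P i -> Q i}) (f' : {linear P i.+1 -> Q i.+1}) :
  commutes_dif f f' -> exists f'' : {linear P i.+2 -> Q i.+2}, commutes_dif f' f''.
Proof.
move=> ff'.
apply: (@projective_lift _ _ _ _ (res_dif Q i.+1) (res_dif Q i) (f' \o res_dif P i.+1)).
- exact: res_projective.
- exact: res_exact.
- by move=> x; rewrite /= ff' res_dif_dif linear0.
Qed.

(** Homotopies extend upwards: u' - 1 - s d is killed by d, so it is d s' for some s'. *)
Lemma homotopy_next P i (u : {linear P i -> P i}) (u' : {linear P i.+1 -> P i.+1}) :
  commutes_dif u u' -> homotopic_id u -> homotopic_id u'.
Proof.
move=> uu' [s su].
have [|x|s' s'E] := @projective_lift _ _ _ _ (res_dif P i.+1) (res_dif P i)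
  ((u' \- idfun) \- (s \o res_dif P i)) (@res_projective _ _ P i.+1).
- exact: res_exact.
- rewrite /= !linearB /= uu'.
  by case: i u u' uu' s su x => [|i] u u' uu' s /=
    => [su x|[g gE] x]; rewrite ?su ?gE ?res_dif_dif ?linear0.
by exists s', s => x; rewrite s'E /= subKr.
Qed.

(** Maps in degrees i and i + 1 both ways, inverse up to homotopy at i. Degree 0 lifts the
    identity of M through the augmentations, and the higher degrees are the extensions
    above. *)
Lemma comparison P Q i :
  exists (f : {linear P i -> Q i}) (f' : {linear P i.+1 -> Q i.+1})
         (g : {linear Q i -> P i}) (g' : {linear Q i.+1 -> P i.+1}),
  [/\ commutes_dif f f', commutes_dif g g',
      homotopic_id (g \o f) & homotopic_id (f \o g)].
Proof.
elim: i => [|i [f [f' [g [g' [ff' gg' hP hQ]]]]]].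
  (* The identity of M lifted to degree 0 and then to degree 1. *)
  have start P1 P2 : exists (f : {linear P1 0%N -> P2 0%N})
      (f' : {linear P1 1 -> P2 1}), commutes_dif f f' /\
      forall x, res_aug P2 (f x) = res_aug P1 x.
    have [f fE] := @res_projective _ _ P1 0 _ _ (res_aug P2) (res_aug P1)
      (@res_aug_surj _ _ P2).
    have [|x|f' f'E] := @projective_lift _ _ _ _ (res_dif P2 0) (res_aug P2)
      (f \o res_dif P1 0) (@res_projective _ _ P1 1).
    - exact: res_exact0.
    - by rewrite /= fE res_aug_dif.
    by exists f, f'.
  (* A lift of the identity differs from the identity by a map into the kernel of the
     augmentation, which is the image of the differential. *)
  have hid P1 (u : {linear P1 0%N -> P1 0%N}) :
      (forall x, res_aug P1 (u x) = res_aug P1 x) -> homotopic_id u.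
    move=> uE.
    have [|x|s sE] := @projective_lift _ _ _ _ (res_dif P1 0) (res_aug P1)
      (u \- idfun) (@res_projective _ _ P1 0).
    - exact: res_exact0.
    - by rewrite /= linearB /= uE subrr.
    by exists s => x; rewrite sE subrr.
  have [f [f' [ff' fa]]] := start P Q; have [g [g' [gg' ga]]] := start Q P.
  exists f, f', g, g'; split=> //; apply: hid => x /=; first by rewrite ga fa.
  by rewrite fa ga.
have [f'' ff''] := lift_next ff'; have [g'' gg''] := lift_next gg'.
exists f', f'', g', g''; split=> //.
- by apply: homotopy_next hP => x /=; rewrite gg' ff'.
- by apply: homotopy_next hQ => x /=; rewrite ff' gg'.
Qed.
End Comparison.

(** * Linear coordinates on Ext *)

Section ExtDimension.
Variables (k : fieldType) (U : algType k) (M N : lmodType U).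
Implicit Types P Q : proj_resolution M.

Definition comp_hom (A B : lmodType U) (f : hom B N) (g : {linear A -> B}) : hom A N :=
  Hom (linearP (f \o g)).

Lemma comp_hom_linear (A B : lmodType U) (g : {linear A -> B}) :
  linear (fun f : hom B N => comp_hom f g).
Proof. by move=> c f f'; apply/homP. Qed.

Lemma is_coboundary_comp P Q i (g : {linear P i -> Q i}) (g' : {linear P i.+1 -> Q i.+1})
    (f : hom (Q i.+1) N) :
  commutes_dif g g' -> is_coboundary f -> is_coboundary (comp_hom f g').
Proof.
by move=> gg' [t tE]; exists (comp_hom t g) => x; rewrite /= tE gg'.
Qed.

Lemma cocycle_comp P Q i (g : {linear P i -> Q i}) (g' : {linear P i.+1 -> Q i.+1})
    (f : hom (Q i) N) :
  commutes_dif g g' -> f \in cocycle Q N i -> comp_hom f g \in cocycle P N i.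
Proof. by move=> gg' /asboolP f0; apply/asboolP => x /=; rewrite -gg' f0. Qed.

(** On a cocycle f the term d s of a homotopy contributes f d s = 0, and the term that
    factors through the differential contributes a coboundary. *)
Lemma is_coboundary_homotopic P i (u : {linear P i -> P i}) (f : hom (P i) N) :
  homotopic_id u -> f \in cocycle P N i -> is_coboundary (comp_hom f u - f).
Proof.
move=> [s su] /asboolP f0.
case: i u f s su f0 => [|i] u f s /= su f0.
  apply/homP => x /=; rewrite -linearB -[u x - x](subrK (res_dif P 0 (s x))) su.
  by rewrite add0r; apply: f0.
have [g gE] := su; exists (comp_hom f g) => x.
rewrite /= -linearB -[u x - x](subrK (res_dif P _ (s x))) linearD /= gE.
by rewrite [X in _ + X](f0 (s x)) addr0.
Qed.

(** A concrete form of an isomorphism of Ext^i with k^I that is convenient to transfer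
    between resolutions. *)
Definition ext_coordinates P i (I : finType) (lam : hom (P i) N -> I -> k) :=
  [/\ forall c f g j, lam (c *: f + g) j = c * lam f j + lam g j,
      forall f, f \in cocycle P N i -> (is_coboundary f <-> forall j, lam f j = 0)
    & forall j, exists2 f, f \in cocycle P N i & forall j', lam f j' = (j' == j)%:R].

Lemma is_coboundaryD P i (f g : hom (P i) N) :
  is_coboundary f -> is_coboundary g -> is_coboundary (f + g).
Proof.
case: i f g => [|i] f g /=; first by move=> -> ->; rewrite addr0.
by move=> [f' fE] [g' gE]; exists (f' + g') => x /=; rewrite fE gE.
Qed.

Lemma is_coboundaryN P i (f : hom (P i) N) : is_coboundary f -> is_coboundary (- f).
Proof.
case: i f => [|i] f /=; first by move=> ->; rewrite oppr0.
by move=> [f' fE]; exists (- f') => x /=; rewrite fE.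
Qed.

Lemma is_coboundary_cocycle P i (f : hom (P i) N) : is_coboundary f -> f \in cocycle P N i.
Proof.
case: i f => [|i] f /=; first by move=> ->; apply/asboolP.
by move=> [g gE]; apply/asboolP => x; rewrite gE res_dif_dif linear0.
Qed.

(** Ext does not depend on the resolution: precomposition with the comparison maps carries
    cocycles to cocycles and coboundaries to coboundaries, and by homotopy the two
    directions are inverse to each other up to coboundaries. *)
Lemma ext_coordinates_resolution P Q i (I : finType) (lam : hom (Q i.+1) N -> I -> k) :
  ext_coordinates lam ->
  exists lam' : hom (P i.+1) N -> I -> k, ext_coordinates lam'.
Proof.
move=> [lamL lam0 lam1].
have lam_cob f g j : is_coboundary (f - g) -> lam f j = lam g j.
  move=> fg; rewrite -[f](subrK g) -[f - g]scale1r lamL mul1r.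
  by rewrite (lam0 _ (is_coboundary_cocycle fg)).1 // add0r.
have [f [f' [g [g' [ff' gg' hP hQ]]]]] := comparison P Q i.
have [f'' ff''] := lift_next ff'; have [g'' gg''] := lift_next gg'.
have hP' : homotopic_id (g' \o f').
  by apply: homotopy_next hP => x /=; rewrite gg' ff'.
have hQ' : homotopic_id (f' \o g').
  by apply: homotopy_next hQ => x /=; rewrite ff' gg'.
exists (fun t => lam (comp_hom t g')); split=> [c t t' j|t tZ|j].
- by rewrite comp_hom_linear lamL.
- have tgZ := cocycle_comp gg'' tZ; split=> [tB|tg0].
    by apply/(lam0 _ tgZ); apply: is_coboundary_comp gg' tB.
  have /(is_coboundary_comp ff') tgfB := (lam0 _ tgZ).2 tg0.
  have /is_coboundaryN tgfB' := is_coboundary_homotopic hP' tZ.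
  have := is_coboundaryD tgfB' tgfB; congr is_coboundary.
  by apply/homP => x /=; rewrite opprB subrK.
- have [t tZ tE] := lam1 j; exists (comp_hom t f').
    exact: cocycle_comp ff'' tZ.
  move=> j'; rewrite -tE; apply: lam_cob.
  exact: is_coboundary_homotopic hQ' tZ.
Qed.

(** The functionals vanish on coboundaries and hence descend to Ext; they are injective
    there by the detection property, and the dual cocycles give the inverse. *)
Lemma ext_coordinates_dim P i (I : finType) (lam : hom (P i) N -> I -> k) :
  ext_coordinates lam -> has_dim (Ext P N i) #|I|.
Proof.
move=> [lamL lam0 lam1].
pose F (x : Ext P N i) : 'rV[k]_#|I| :=
  \row_j lam (submod_val (lquot_repr x)) (enum_val j).
have FE (z : submod (cocycle P N i)) j :
    F (lquot_pi (coboundary P N i) z) 0 j = lam (submod_val z) (enum_val j).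
  have /lquot_piP/asboolP zB := lquot_reprK (lquot_pi (coboundary P N i) z).
  rewrite mxE -[submod_val (lquot_repr _)](subrK (submod_val z)).
  rewrite -[X in lam (X + _)]scale1r lamL mul1r.
  by rewrite (lam0 _ (is_coboundary_cocycle zB)).1 ?add0r.
have Fl : linear F.
  move=> c x y; rewrite -[x]lquot_reprK -[y]lquot_reprK.
  rewrite -[_ *: lquot_pi _ _]/(lquot_scale _ _) lquot_pi_scale -lquot_piD.
  by apply/rowP => j; rewrite [RHS]mxE [X in _ = X + _]mxE !FE /= lamL.
exists F => //.
pose t j := s2val (cid2 (lam1 j)).
have tE j : forall j', lam (t j) j' = (j' == j)%:R := s2valP' (cid2 (lam1 j)).
pose z j : submod (cocycle P N i) := Submod (s2valP (cid2 (lam1 j))).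
pose G (v : 'rV[k]_#|I|) : Ext P N i :=
  \sum_j v 0 j *: lquot_pi (coboundary P N i) (z (enum_val j)).
pose Fm := GRing.isLinear.Build k (Ext P N i) 'rV[k]_#|I| _ F Fl.
pose FL : {linear Ext P N i -> 'rV[k]_#|I|} := HB.pack F Fm.
have FZ c x : F (c *: x) = c *: F x by exact: (linearZ_LR FL c x).
have GK : cancel G F.
  move=> v; rewrite -[F]/(FL : _ -> _) /G linear_sum; apply/rowP => j.
  rewrite summxE (bigD1 j) //= big1 ?addr0 => [|j' j'j]; rewrite FZ mxE FE.
    by rewrite /= tE eqxx mulr1.
  by rewrite /= tE (inj_eq enum_val_inj) eq_sym (negPf j'j) mulr0.
have Finj : injective F.
  move=> x y xy; apply/eqP; rewrite -subr_eq0; apply/eqP.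
  have : FL (x - y) = 0 by rewrite linearB /= xy subrr.
  rewrite -[x - y]lquot_reprK; move: (lquot_repr _) => {x y xy} w w0.
  have <- : lquot_pi (coboundary P N i) 0 = 0.
    by apply: (addIr (lquot_pi (coboundary P N i) 0)); rewrite -lquot_piD !add0r.
  apply/lquot_piP; rewrite subr0; apply/asboolP/lam0 => [|j].
    exact: submodP.
  have := FE w (enum_rank j); rewrite enum_rankK => <-.
  by rewrite -[F]/(FL : _ -> _) w0 mxE.
by exists G => // x; apply: Finj; rewrite GK.
Qed.

End ExtDimension.

(** * The Lie algebra sl_2 *)

Section Sl2.
Variable k : fieldType.
Local Notation g := (sl k 2).

Fact sl2_e_subproof : delta_mx 0 1 \in @traceless k 2.
Proof. by rewrite inE /mxtrace !big_ord_recl big_ord0 !mxE /= !addr0. Qed.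
Fact sl2_f_subproof : delta_mx 1 0 \in @traceless k 2.
Proof. by rewrite inE /mxtrace !big_ord_recl big_ord0 !mxE /= !addr0. Qed.
Fact sl2_h_subproof : delta_mx 0 0 - delta_mx 1 1 \in @traceless k 2.
Proof. by rewrite inE /mxtrace !big_ord_recl big_ord0 !mxE /= subr0 addr0 sub0r subrr. Qed.

Definition sl2_e : g := Submod sl2_e_subproof.
Definition sl2_f : g := Submod sl2_f_subproof.
Definition sl2_h : g := Submod sl2_h_subproof.

(** The trace is zero. *)
Lemma sl2_11 (x : g) : submod_val x 1 1 = - submod_val x 0 0.
Proof.
have := submodP x; rewrite inE /mxtrace !big_ord_recl big_ord0 addr0.
have -> : lift ord0 ord0 = 1 :> 'I_2 by apply: val_inj.
by rewrite addrC addr_eq0 => /eqP.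
Qed.

Lemma sl2_basis (x : g) :
  x = submod_val x 0 1 *: sl2_e + submod_val x 1 0 *: sl2_f + submod_val x 0 0 *: sl2_h.
Proof.
apply: val_inj; apply/matrixP => i j; rewrite !mxE /=.
have [] : i = 0 \/ i = 1 by case: i => [[|[|i]] ?] //; [left|right]; apply: val_inj.
all: have [] : j = 0 \/ j = 1 by case: j => [[|[|j]] ?] //; [left|right]; apply: val_inj.
all: move=> -> ->; rewrite /= ?sl2_11; ring.
Qed.

Lemma sl2_lieE (x y : g) :
  [/\ submod_val (lie x y) 0 0 = submod_val x 0 1 * submod_val y 1 0 - submod_val y 0 1 *
    submod_val x 1 0,
      submod_val (lie x y) 0 1 = 2 * (submod_val x 0 0 * submod_val y 0 1 - submod_val y 0 0 *
        submod_val x 0 1)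
    & submod_val (lie x y) 1 0 = 2 * (submod_val x 1 0 * submod_val y 0 0 - submod_val y 1 0 *
      submod_val x 0 0)].
Proof.
have o1 : lift ord0 ord0 = 1 :> 'I_2 by apply: val_inj.
have o0 : ord0 = 0 :> 'I_2 by apply: val_inj.
by split; rewrite !mxE !big_ord_recl !big_ord0 o1 o0 ?sl2_11; ring.
Qed.

Lemma lie_ef : lie sl2_e sl2_f = sl2_h.
Proof.
have [h00 h01 h10] := sl2_lieE sl2_e sl2_f.
by rewrite [LHS]sl2_basis h00 h01 h10 !mxE /= !(mulr0, mulr1, subr0) !scale0r !add0r scale1r.
Qed.
Lemma lie_he : lie sl2_h sl2_e = 2 *: sl2_e.
Proof.
have [h00 h01 h10] := sl2_lieE sl2_h sl2_e.
by rewrite [LHS]sl2_basis h00 h01 h10 !mxE /= !(mulr0, mul0r, mulr1, subr0) !scale0r !addr0.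
Qed.
Lemma lie_hf : lie sl2_h sl2_f = - 2 *: sl2_f.
Proof.
have [h00 h01 h10] := sl2_lieE sl2_h sl2_f.
by rewrite [LHS]sl2_basis h00 h01 h10 !mxE /= !(mulr0, mul0r, mul1r, mulr1, subr0, sub0r)
  !scale0r addr0 oppr0 mulr0 scale0r add0r mulrN1.
Qed.

End Sl2.

(** * A representation of sl_2 by differential-difference operators *)

Section Operators.
Variables (k : fieldType) (D : comNzRingType) (cst : {rmorphism k -> D}).
Variables (s s' : {rmorphism D -> D}) (df : {additive D -> D}) (h f e : D).
Hypotheses (s_h : s h = h + 2) (s_f : s f = f) (s_e : s e = e).
Hypotheses (s'_h : s' h = h - 2) (s'_f : s' f = f).
Hypotheses (s_cst : forall c, s (cst c) = cst c) (s'_cst : forall c, s' (cst c) = cst c).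
Hypotheses (sK : cancel s s') (s'K : cancel s' s).
Hypotheses (df_s : forall d, df (s d) = s (df d)).
Hypotheses (df_f : forall d, df (f * d) = d + f * df d).
Hypotheses (df_h : forall d, df (h * d) = h * df d).
Hypotheses (df_cst : forall c d, df (cst c * d) = cst c * df d).
Local Notation g := (sl k 2).

(** The ring D as a k-module through c; the tag c lets the module structure be found from
    the type. *)
Definition scalars_of (c : {rmorphism k -> D}) : Type := D.
Local Notation scalars := (scalars_of cst).
HB.instance Definition _ := GRing.ComNzRing.on scalars.
Definition scalars_scale (c : k) (d : scalars) : scalars := cst c * d.
Fact scalars_scaleA a b d : scalars_scale a (scalars_scale b d) = scalars_scale (a * b) d.
Proof. by rewrite /scalars_scale mulrA rmorphM. Qed.
Fact scalars_scale1 : left_id 1 scalars_scale.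
Proof. by move=> d; rewrite /scalars_scale rmorph1 mul1r. Qed.
Fact scalars_scaleDr : right_distributive scalars_scale +%R.
Proof. by move=> a u v; rewrite /scalars_scale mulrDr. Qed.
Fact scalars_scaleDl v : {morph scalars_scale^~ v : a b / a + b}.
Proof. by move=> a b; rewrite /scalars_scale rmorphD mulrDl. Qed.
HB.instance Definition _ := GRing.Zmodule_isLmodule.Build k scalars
  scalars_scaleA scalars_scale1 scalars_scaleDr scalars_scaleDl.

Definition opH (d : D) : D := h * d.
Definition opF (d : D) : D := f * s d.

(** The action of e by left multiplication on the PBW basis: from e h = (h - 2) e and [e,
    f^a] = a h f^(a-1) + a (a - 1) f^(a-1), moving e to the right through h^b f^a shifts h
    and leaves terms in the first two derivatives with respect to f. *)
Definition opE (d : D) : D := e * s' d + h * df (s' d) + f * df (df (s' d)).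

Let op_lin := (fun (c : k) (op : D -> D) => forall u v, op (cst c * u + v) = cst c * op u + op v).

Lemma opH_linear c : op_lin c opH.
Proof. by move=> u v; rewrite /opH; ring. Qed.
Lemma opF_linear c : op_lin c opF.
Proof. by move=> u v; rewrite /opF rmorphD rmorphM s_cst; ring. Qed.
Lemma opE_linear c : op_lin c opE.
Proof.
by move=> u v; rewrite /opE rmorphD rmorphM s'_cst !(raddfD, df_cst); ring.
Qed.

Lemma op_HE d : opH (opE d) = 2 * opE d + opE (opH d).
Proof.
rewrite /opH /opE rmorphM s'_h !mulrBl !(raddfB, raddfD, df_h).
have df2 u : df (2 * u) = 2 * df u by rewrite !mulr_natl raddfMn.
rewrite !df2; ring.
Qed.

Lemma op_HF d : opH (opF d) = - 2 * opF d + opF (opH d).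
Proof. rewrite /opH /opF rmorphM s_h; ring. Qed.

Lemma op_EF d : opE (opF d) = opH d + opF (opE d).
Proof.
rewrite /opH /opE /opF !rmorphD !rmorphM s'_f sK s_h s_f s_e -!df_s s'K.
rewrite !(df_f, raddfD); ring.
Qed.

Definition op_act (x : g) (d : D) : D :=
  cst (submod_val x 0 1) * opE d + cst (submod_val x 1 0) * opF d
  + cst (submod_val x 0 0) * opH d.

Lemma op_act_e d : op_act (sl2_e k) d = opE d.
Proof. by rewrite /op_act !mxE /= !rmorph0 rmorph1 !mul0r !addr0 mul1r. Qed.
Lemma op_act_f d : op_act (sl2_f k) d = opF d.
Proof. by rewrite /op_act !mxE /= !rmorph0 rmorph1 !mul0r addr0 add0r mul1r. Qed.
Lemma op_act_h d : op_act (sl2_h k) d = opH d.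
Proof. by rewrite /op_act !mxE /= !subr0 !rmorph0 rmorph1 !mul0r !add0r mul1r. Qed.

Lemma op_act_linearl (c : k) (x y : g) (d : D) :
  op_act (c *: x + y) d = cst c * op_act x d + op_act y d.
Proof. by rewrite /op_act /= !mxE !rmorphD !rmorphM; ring. Qed.

Lemma op_act_linearr (x : g) c : op_lin c (op_act x).
Proof.
by move=> u v; rewrite /op_act opE_linear opF_linear opH_linear; ring.
Qed.

Lemma op_act_lie (x y : g) (d : D) :
  op_act (lie x y) d = op_act x (op_act y d) - op_act y (op_act x d).
Proof.
have linP op (opl : forall c, op_lin c op) a b c u v w :
    op (cst a * u + cst b * v + cst c * w)
    = cst a * op u + cst b * op v + cst c * op w.
  have op0 : op 0 = 0.
    by apply: (addIr (op 0)); have := opl 1 0 0; rewrite rmorph1 !mul1r !add0r.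
  by rewrite -addrA !opl -[cst c * w]addr0 opl op0 addr0 addrA.
have [h00 h01 h10] := sl2_lieE x y.
rewrite /op_act h00 h01 h10 !(linP _ opE_linear) !(linP _ opF_linear) !(linP _ opH_linear).
rewrite op_HE op_HF op_EF !rmorphM !rmorphB !rmorphM !rmorph_nat; ring.
Qed.

Fact op_rep_linearl (c : k) (x y : g) (d : scalars) :
  (op_act (c *: x + y) d : scalars) = c *: (op_act x d : scalars) + op_act y d.
Proof. exact: op_act_linearl. Qed.

Fact op_rep_linearr (x : g) : linear (op_act x : scalars -> scalars).
Proof. move=> c; exact: op_act_linearr. Qed.

Definition op_rep : lie_rep g scalars :=
  @LieRep _ _ scalars op_act op_rep_linearl op_rep_linearr op_act_lie.

End Operators.

(** * The PBW basis of U(sl_2) *)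

Section AdditiveHorner.
Variables (R S : nzRingType) (th : {additive R -> S}) (x : S).

(** Evaluation with coefficients on the left, for a non-commutative target: th need not be
    multiplicative, and p |-> sum th(p_i) x^i is still additive. *)
Definition add_horner (p : {poly R}) : S := (map_poly th p).[x].

Fact add_horner_is_additive : zmod_morphism add_horner.
Proof. by move=> p q; rewrite /add_horner raddfB hornerD hornerN. Qed.
HB.instance Definition _ :=
  GRing.isZmodMorphism.Build {poly R} S add_horner add_horner_is_additive.

Lemma add_hornerMXaddC p c : add_horner (p * 'X + c%:P) = add_horner p * x + th c.
Proof.
rewrite /add_horner -hornerMXaddC; congr (_.[x]); apply/polyP => i.
rewrite !(coef_map, coefD, coefMX, coefC) /= raddfD /=.
by case: (i == 0)%N; rewrite ?raddf0.
Qed.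

Lemma add_hornerC c : add_horner c%:P = th c.
Proof. by rewrite -[c%:P]add0r -[0 in LHS](mul0r 'X) add_hornerMXaddC raddf0 mul0r add0r. Qed.

Lemma add_hornerMX p : add_horner (p * 'X) = add_horner p * x.
Proof. by rewrite -[p * 'X]addr0 -[0 in LHS]polyC0 add_hornerMXaddC raddf0 addr0. Qed.
End AdditiveHorner.

Section PBW.
Variable k : fieldType.
Local Notation g := (sl k 2).
Local Notation D := {poly {poly {poly k}}}.

Definition pbw_cst : {rmorphism k -> D} := polyC \o polyC \o polyC.

(** A tower of polynomial rings in h, then f, then e, mirroring the order h^b f^a e^c of
    the PBW monomials. *)
Definition pbw_h : D := 'X%:P%:P.
Definition pbw_f : D := 'X%:P.
Definition pbw_e : D := 'X.

Definition pbw_shift (c : k) : {rmorphism D -> D} :=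
  map_poly (map_poly (comp_poly ('X + c%:P))).

Definition pbw_df : {additive D -> D} := map_poly (@deriv {poly k}).

Lemma pbw_shift_cst c a : pbw_shift c (pbw_cst a) = pbw_cst a.
Proof. by rewrite /= !map_polyC /= map_polyC /= comp_polyC. Qed.
Lemma pbw_shift_h c : pbw_shift c pbw_h = pbw_h + pbw_cst c.
Proof. by rewrite /= !map_polyC /= map_polyC /= comp_polyX !polyCD. Qed.
Lemma pbw_shift_f c : pbw_shift c pbw_f = pbw_f.
Proof. by rewrite /= map_polyC /= map_polyX. Qed.
Lemma pbw_shift_e c : pbw_shift c pbw_e = pbw_e.
Proof. by rewrite /= map_polyX. Qed.

Lemma pbw_shiftK a b : a + b = 0 -> cancel (pbw_shift a) (pbw_shift b).
Proof.
move=> ab d; have cK : cancel (comp_poly ('X + a%:P)) (comp_poly ('X + b%:P)).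
  move=> p; rewrite -comp_polyA comp_polyD comp_polyX comp_polyC -addrA -polyCD.
  by rewrite [b + a]addrC ab addr0 comp_polyXr.
rewrite /pbw_shift /=; apply/polyP => i; rewrite !coef_map /=.
by apply/polyP => j; rewrite !coef_map /= cK.
Qed.

Lemma pbw_df_shift c d : pbw_df (pbw_shift c d) = pbw_shift c (pbw_df d).
Proof.
apply/polyP => i; rewrite /pbw_df /pbw_shift /= !coef_map /=.
by apply/polyP => j; rewrite !(coef_map, coef_deriv) /= raddfMn.
Qed.

Lemma pbw_df_f d : pbw_df (pbw_f * d) = d + pbw_f * pbw_df d.
Proof.
apply/polyP => i; rewrite /pbw_df /pbw_f /= coefD !coefCM !coef_map /= coefCM.
by rewrite derivM derivX mul1r.
Qed.

Lemma pbw_df_polyC (a : {poly k}) d : pbw_df (a%:P%:P * d) = a%:P%:P * pbw_df d.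
Proof.
apply/polyP => i; rewrite /pbw_df /= !coefCM !coef_map /= coefCM.
by rewrite derivM derivC mul0r add0r.
Qed.

Lemma pbw_cst2 : pbw_cst 2 = 2.
Proof. exact: rmorph_nat. Qed.

(** The representation of sl_2 on k[h][f][e] that left multiplication on PBW monomials
    would give; its existence is what makes the PBW monomials independent. *)
Definition pbw_rep : lie_rep g (scalars_of pbw_cst).
Proof.
apply: (@op_rep _ _ pbw_cst (pbw_shift 2) (pbw_shift (-2)) pbw_df pbw_h pbw_f pbw_e).
- by rewrite pbw_shift_h pbw_cst2.
- exact: pbw_shift_f.
- exact: pbw_shift_e.
- by rewrite pbw_shift_h rmorphN pbw_cst2.
- exact: pbw_shift_f.
- exact: pbw_shift_cst.
- exact: pbw_shift_cst.
- by apply: pbw_shiftK; rewrite addrN.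
- by apply: pbw_shiftK; rewrite addNr.
- exact: pbw_df_shift.
- exact: pbw_df_f.
- exact: pbw_df_polyC.
- by move=> c; apply: pbw_df_polyC.
Defined.

Local Notation U := (env g).
Definition env_e : U := env_gen (sl2_e k).
Definition env_f : U := env_gen (sl2_f k).
Definition env_h : U := env_gen (sl2_h k).
Local Notation e := env_e.
Local Notation f := env_f.
Local Notation h := env_h.

Lemma env_ef : e * f = f * e + h.
Proof. by rewrite /env_h -lie_ef env_lie addrC subrK. Qed.
Lemma env_he : h * e = e * h + 2 *: e.
Proof. by rewrite -linearZ /= -lie_he env_lie addrC subrK. Qed.
Lemma env_hf : h * f = f * h - 2 *: f.
Proof. by rewrite -scaleNr -linearZ /= -lie_hf env_lie addrC subrK. Qed.

Definition pbw1 : env_mod pbw_rep := (1 : D).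

(** The orbit map of 1; it sends h^b f^a e^c to the corresponding monomial. *)
Definition to_pbw (u : U) : D := u *: pbw1.

Lemma to_pbwD u v : to_pbw (u + v) = to_pbw u + to_pbw v.
Proof. exact: (scalerDl pbw1 u v). Qed.

Lemma to_pbw_gen x u : to_pbw (env_gen x * u) = pbw_rep x (to_pbw u).
Proof. by rewrite /to_pbw -scalerA env_scale_gen. Qed.

Lemma to_pbw_h u : to_pbw (h * u) = pbw_h * to_pbw u.
Proof. rewrite to_pbw_gen; exact: op_act_h. Qed.
Lemma to_pbw_f u : to_pbw (f * u) = pbw_f * pbw_shift 2 (to_pbw u).
Proof. rewrite to_pbw_gen; exact: op_act_f. Qed.
Lemma to_pbw_e u : to_pbw (e * u) = opE (pbw_shift (-2)) pbw_df pbw_h pbw_f pbw_e (to_pbw u).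
Proof. rewrite to_pbw_gen; exact: op_act_e. Qed.
Lemma to_pbw_cst (c : k) u : to_pbw (c *: u) = pbw_cst c * to_pbw u.
Proof. by rewrite /to_pbw -mulr_algl -scalerA env_scale_cst. Qed.
Lemma to_pbw1 : to_pbw 1 = 1.
Proof. exact: (scale1r pbw1). Qed.

(** Polynomials in h as elements of U, and below polynomials in h and f (the Borel part),
    then all PBW expressions. *)
Definition of_torus : {additive {poly k} -> U} := horner_alg h.
Definition of_borel : {additive {poly {poly k}} -> U} := add_horner of_torus f.
Definition of_pbw : {additive D -> U} := add_horner of_borel e.

Lemma of_torusX : of_torus 'X = h. Proof. exact: horner_algX. Qed.
Lemma of_torusC c : of_torus c%:P = c%:A. Proof. exact: horner_algC. Qed.
Lemma of_torusM p q : of_torus (p * q) = of_torus p * of_torus q. Proof. exact: rmorphM. Qed.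

(** As f h = (h + 2) f, moving f through a polynomial in h translates the polynomial. *)
Lemma f_of_torus p : f * of_torus p = of_torus (p \Po ('X + 2%:P)) * f.
Proof.
elim/poly_ind: p => [|p c IH]; first by rewrite comp_poly0 !raddf0 mulr0 mul0r.
rewrite comp_polyD comp_polyM comp_polyX comp_polyC !(raddfD of_torus) !of_torusM !of_torusC.
rewrite mulrDr mulrA IH mulrDl -!mulrA (raddfD of_torus 'X) of_torusX of_torusC mulrDl env_hf.
by rewrite mulr_algl subrK mulr_algl mulr_algr.
Qed.

Lemma e_of_torus p : e * of_torus p = of_torus (p \Po ('X - 2%:P)) * e.
Proof.
elim/poly_ind: p => [|p c IH]; first by rewrite comp_poly0 !raddf0 mulr0 mul0r.
rewrite comp_polyD comp_polyM comp_polyX comp_polyC !(raddfD of_torus) !of_torusM !of_torusC.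
rewrite mulrDr mulrA IH mulrDl -!mulrA (raddfB of_torus 'X) of_torusX of_torusC mulrBl env_he.
by rewrite mulr_algl addrK mulr_algl mulr_algr.
Qed.

Lemma of_borelC p : of_borel p%:P = of_torus p. Proof. exact: add_hornerC. Qed.
Lemma of_borelX p : of_borel (p * 'X) = of_borel p * f. Proof. exact: add_hornerMX. Qed.
Lemma of_pbwC p : of_pbw p%:P = of_borel p. Proof. exact: add_hornerC. Qed.
Lemma of_pbwX p : of_pbw (p * 'X) = of_pbw p * e. Proof. exact: add_hornerMX. Qed.

Definition in_borel u := exists q, u = of_borel q.

Lemma in_borelD u v : in_borel u -> in_borel v -> in_borel (u + v).
Proof. by move=> [p ->] [q ->]; exists (p + q); rewrite raddfD. Qed.
Lemma in_borel_torus p : in_borel (of_torus p).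
Proof. by exists p%:P; rewrite of_borelC. Qed.
Lemma in_borelMf u : in_borel u -> in_borel (u * f).
Proof. by move=> [p ->]; exists (p * 'X); rewrite of_borelX. Qed.
Lemma of_borelMXaddC p c : of_borel (p * 'X + c%:P) = of_borel p * f + of_torus c.
Proof. exact: add_hornerMXaddC. Qed.
Lemma of_pbwMXaddC p c : of_pbw (p * 'X + c%:P) = of_pbw p * e + of_borel c.
Proof. exact: add_hornerMXaddC. Qed.

(** As f^a (h + c) = (h + c + 2 a) f^a, right multiplication by h + c keeps the Borel
    part, and multiplies each coefficient by a nonzero polynomial, hence is injective
    there. *)
Lemma of_borelMh q c : exists q',
  of_borel q * (h + c%:A) = of_borel q' /\ (q' = 0 -> q = 0).
Proof.
elim/poly_ind: q c => [|q p IH] c; first by exists 0; rewrite raddf0 mul0r.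
have [q' [q'E q'0]] := IH (c + 2); exists (q' * 'X + (p * ('X + c%:P))%:P).
split; last first.
  move=> /polyP q0; have := q0 0%N; rewrite coefD coefMX coefC coef0 /= add0r.
  move/eqP; rewrite mulf_eq0 [X in _ || X](_ : _ = false) ?orbF;
    last by rewrite -size_poly_eq0 size_XaddC.
  move=> /eqP ->.
  rewrite addr0 q'0 ?mul0r //; apply/polyP => i; have := q0 i.+1.
  by rewrite coefD coefMX coefC /= addr0 !coef0.
rewrite !of_borelMXaddC -q'E of_torusM (raddfD of_torus) of_torusX of_torusC mulrDl; congr (_ + _).
rewrite -!mulrA; congr (_ * _); rewrite mulrDr mulr_algr mulrDl mulr_algl env_hf.
by rewrite scalerDl [c *: f + _]addrC addrA subrK.
Qed.

Lemma in_borelMh u : in_borel u -> in_borel (u * h).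
Proof.
move=> [q ->]; have [q' [q'E _]] := of_borelMh q 0.
by exists q'; rewrite -q'E scale0r addr0.
Qed.

Lemma h_in_borel u : in_borel u -> in_borel (h * u).
Proof.
move=> [q ->]; elim/poly_ind: q => [|q p IH]; first by exists 0; rewrite raddf0 mulr0.
rewrite of_borelMXaddC mulrDr mulrA -of_torusX -of_torusM; apply: in_borelD;
  last exact: in_borel_torus.
by rewrite of_torusX; apply: in_borelMf.
Qed.

Lemma f_in_borel u : in_borel u -> in_borel (f * u).
Proof.
move=> [q ->]; elim/poly_ind: q => [|q p IH]; first by exists 0; rewrite raddf0 mulr0.
rewrite of_borelMXaddC mulrDr mulrA f_of_torus; apply: in_borelD; apply: in_borelMf => //;
  exact: in_borel_torus.
Qed.

(** The commutators of e with h and f stay in the Borel part. *)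
Lemma e_in_borel u : in_borel u -> exists v w, [/\ in_borel v, in_borel w & e * u = v + w * e].
Proof.
move=> [q ->]; elim/poly_ind: q => [|q p [v [w [vW wW IH]]]].
  by exists 0, 0; split; rewrite ?raddf0 ?mulr0 ?mul0r ?add0r //; exists 0; rewrite raddf0.
(* From e u f = (v + w e) f = v f + w (f e + h). *)
exists (v * f + w * h), (w * f + of_torus (p \Po ('X - 2%:P))); split.
- by apply: in_borelD; [apply: in_borelMf | apply: in_borelMh].
- by apply: in_borelD; [apply: in_borelMf | apply: in_borel_torus].
rewrite of_borelMXaddC mulrDr mulrA IH mulrDl -[w * e * f]mulrA env_ef e_of_torus mulrDr !mulrDl
  !mulrA.
by rewrite !addrA; congr (_ + _); rewrite -addrA [w * f * e + _]addrC addrA.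
Qed.

Definition in_pbw u := exists d, u = of_pbw d.

Lemma in_pbwD u v : in_pbw u -> in_pbw v -> in_pbw (u + v).
Proof. by move=> [p ->] [q ->]; exists (p + q); rewrite raddfD. Qed.
Lemma in_pbwMe u : in_pbw u -> in_pbw (u * e).
Proof. by move=> [p ->]; exists (p * 'X); rewrite of_pbwX. Qed.
Lemma borel_in_pbw u : in_borel u -> in_pbw u.
Proof. by move=> [q ->]; exists q%:P; rewrite of_pbwC. Qed.

Lemma left_in_pbw x : (forall u, in_borel u -> in_pbw (x * u)) -> forall u, in_pbw u -> in_pbw (x
  * u).
Proof.
move=> xW u [d ->]; elim/poly_ind: d => [|d p IH].
  by exists 0; rewrite !raddf0 mulr0.
rewrite of_pbwMXaddC mulrDr mulrA; apply: in_pbwD; first exact: in_pbwMe.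
by apply: xW; exists p.
Qed.

(** The image of of_pbw is stable under left multiplication by scalars and generators, so
    it is a left ideal, and it contains 1. *)
Lemma of_pbw_surj u : in_pbw u.
Proof.
suff left : forall v, in_pbw v -> in_pbw (u * v).
  by rewrite -[u]mulr1; apply: left; apply: borel_in_pbw; rewrite -[1]scale1r -of_torusC;
    apply: in_borel_torus.
have cstl (c : k) v : in_pbw v -> in_pbw (c *: v).
  move=> [d ->]; elim/poly_ind: d => [|d p IH]; first by exists 0; rewrite !raddf0.
  rewrite of_pbwMXaddC scalerDr scalerAl; apply: in_pbwD; first exact: in_pbwMe.
  apply: borel_in_pbw; elim/poly_ind: p => [|p q IHp]; first by exists 0; rewrite !raddf0.
  rewrite of_borelMXaddC scalerDr scalerAl; apply: in_borelD; first exact: in_borelMf.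
  by rewrite -mulr_algl -of_torusC -of_torusM; apply: in_borel_torus.
rewrite -[u]palg_reprK; elim: (palg_repr u) => [x|c|a IHa b IHb|a IHa b IHb] v vP.
- rewrite -[palg_pi _ _]/(env_gen x) (sl2_basis x) !linearD !linearZ /= !mulrDl -!scalerAl.
  rewrite -/e -/f -/h; apply: in_pbwD; last first.
    by apply: cstl; apply: left_in_pbw vP => w wW; apply: borel_in_pbw; apply: h_in_borel.
  apply: in_pbwD; last first.
    by apply: cstl; apply: left_in_pbw vP => w wW; apply: borel_in_pbw; apply: f_in_borel.
  apply: cstl; apply: left_in_pbw vP => w /e_in_borel[w1 [w2 [w1W w2W ->]]].
  by apply: in_pbwD; [apply: borel_in_pbw|apply: in_pbwMe; apply: borel_in_pbw].
- by rewrite palg_piC [_ * _]mulr_algl; apply: cstl.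
- by rewrite palg_piD [_ * _]mulrDl; apply: in_pbwD; [apply: IHa|apply: IHb].
- by rewrite palg_piM -[_ * _]mulrA; apply: IHa; apply: IHb.
Qed.

Lemma to_pbw_e_exp n : to_pbw (e ^+ n) = pbw_e ^+ n.
Proof.
elim: n => [|n IH]; first by rewrite !expr0 to_pbw1.
have df0 : pbw_df (pbw_e ^+ n) = 0.
  apply/polyP => i; rewrite /pbw_e coef_map coefXn coef0 /=.
  by case: (_ == _); rewrite -?polyC1 ?derivC ?raddf0.
by rewrite !exprS to_pbw_e /opE IH rmorphXn pbw_shift_e df0 raddf0 !mulr0 !addr0.
Qed.

Lemma to_pbw_fe_exp m n : to_pbw (f ^+ m * e ^+ n) = pbw_f ^+ m * pbw_e ^+ n.
Proof.
elim: m => [|m IH]; first by rewrite !expr0 !mul1r to_pbw_e_exp.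
by rewrite !exprS -!mulrA to_pbw_f IH rmorphM !rmorphXn pbw_shift_f pbw_shift_e.
Qed.

Lemma to_pbw_torus p u : to_pbw (of_torus p * u) = p%:P%:P * to_pbw u.
Proof.
elim/poly_ind: p u => [|p c IH] u.
  by rewrite !raddf0 !mul0r; apply: (scale0r pbw1).
rewrite raddfD of_torusM of_torusX of_torusC mulrDl to_pbwD -mulrA IH to_pbw_h mulr_algl to_pbw_cst.
by rewrite mulrA -!polyCM -mulrDl -!polyCD.
Qed.

Lemma to_pbw_borel q m n : to_pbw (of_borel q * (f ^+ m * e ^+ n)) = q%:P * (pbw_f ^+ m * pbw_e
  ^+ n).
Proof.
elim/poly_ind: q m => [|q p IH] m.
  by rewrite !raddf0 !mul0r; apply: (scale0r pbw1).
rewrite of_borelMXaddC mulrDl to_pbwD to_pbw_torus to_pbw_fe_exp -mulrA [f * _]mulrA -exprS IH.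
by rewrite polyCD polyCM mulrDl exprS !mulrA.
Qed.

(** Applied to 1, the PBW monomials of U give the monomials of k[h][f][e], so the orbit
    map is a left inverse, and PBW monomials are linearly independent in U. *)
Lemma of_pbwK d : to_pbw (of_pbw d) = d.
Proof.
suff dE n : to_pbw (of_pbw d * e ^+ n) = d * pbw_e ^+ n by have := dE 0%N; rewrite !expr0 !mulr1.
elim/poly_ind: d n => [|d q IH] n.
  by rewrite !raddf0 !mul0r; apply: (scale0r pbw1).
rewrite of_pbwMXaddC !mulrDl to_pbwD -[_ * e * _]mulrA -exprS IH.
have := to_pbw_borel q 0 n; rewrite !expr0 !mul1r => ->.
by rewrite exprS mulrA.
Qed.

Lemma of_pbw_inj : injective of_pbw.
Proof. exact: can_inj of_pbwK. Qed.

End PBW.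

(** * The Chevalley-Eilenberg resolution of the trivial module *)

Section Projectivity.
Variable U : nzRingType.

Lemma projective_regular : projective U^o.
Proof.
move=> A B p q ps; have [a aE] := ps (q 1).
have hl : linear (fun u : U^o => u *: a) by move=> c u v; rewrite scalerDl scalerA.
pose hm := GRing.isLinear.Build U U^o A _ (fun u : U^o => u *: a) hl.
exists (HB.pack_for {linear U^o -> A} (fun u : U^o => u *: a) hm) => u /=.
by rewrite linearZ /= aE -linearZ /=; congr (q _); exact: mulr1.
Qed.

Lemma pair_linP (A B : lmodType U) (c : U) (a a' : A) (b b' : B) :
  (c *: a + a', c *: b + b') = c *: (a, b) + (a', b').
Proof. by []. Qed.

Lemma projective_pair (P Q : lmodType U) :
  projective P -> projective Q -> projective (P * Q)%type.
Proof.
move=> Pp Qp A B p q ps.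
have ql : linear (fun x : P => q (x, 0)).
  by move=> c x y; rewrite -linearP; congr (q _); congr pair; rewrite /= ?scaler0 ?addr0.
have qr : linear (fun x : Q => q (0, x)).
  by move=> c x y; rewrite -linearP; congr (q _); congr pair; rewrite /= ?scaler0 ?addr0.
pose qlm := GRing.isLinear.Build U P B _ _ ql.
pose qrm := GRing.isLinear.Build U Q B _ _ qr.
have [h1 h1E] := Pp A B p (HB.pack_for {linear P -> B} (fun x : P => q (x, 0)) qlm) ps.
have [h2 h2E] := Qp A B p (HB.pack_for {linear Q -> B} (fun x : Q => q (0, x)) qrm) ps.
have hl : linear (fun x : P * Q => h1 x.1 + h2 x.2).
  by move=> c x y; rewrite /= !linearP scalerDr addrACA.
pose hm := GRing.isLinear.Build U (P * Q)%type A _ _ hl.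
exists (HB.pack_for {linear (P * Q)%type -> A} (fun x : P * Q => h1 x.1 + h2 x.2) hm).
move=> [x y] /=; rewrite linearD h1E h2E /= -linearD; congr (q _).
by congr pair; rewrite /= ?addr0 ?add0r.
Qed.

(** Used above degree 3, where the resolution is zero. *)
Lemma projective_trivial (P : lmodType U) : (forall x : P, x = 0) -> projective P.
Proof. by move=> P0 A B p q _; exists \0 => x; rewrite [x]P0 !linear0. Qed.

End Projectivity.

Section Koszul.
Variable k : fieldType.
Local Notation g := (sl k 2).
Local Notation U := (env g).
Local Notation e := (env_e k).
Local Notation f := (env_f k).
Local Notation h := (env_h k).
Local Notation of_torus := (of_torus k).

Lemma polyMXaddC_eq0 (R : nzRingType) (p : {poly R}) c : p * 'X + c%:P = 0 -> p = 0 /\ c = 0.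
Proof.
move=> /polyP pc0; split.
  by apply/polyP => i; have := pc0 i.+1; rewrite coefD coefMX coefC addr0 !coef0.
by have := pc0 0%N; rewrite coefD coefMX coefC add0r coef0.
Qed.

Lemma in_borel0 : in_borel (0 : U).
Proof. by exists 0; rewrite raddf0. Qed.

(** U = U e + W, where W is the Borel part; the sum is direct by env_split_inj. *)
Lemma env_split u : exists v w : U, in_borel w /\ u = v * e + w.
Proof.
have [d ->] := of_pbw_surj u; elim/poly_ind: d => [|d q _].
  by exists 0, 0; rewrite !raddf0 mul0r addr0; split=> //; exists 0; rewrite raddf0.
by exists (of_pbw k d), (of_borel k q); rewrite of_pbwMXaddC; split=> //; exists q.
Qed.

Lemma env_split_inj (v w : U) : in_borel w -> v * e + w = 0 -> v = 0 /\ w = 0.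
Proof.
have [d ->] := of_pbw_surj v; move=> [q ->]; rewrite -of_pbwMXaddC -[0](raddf0 (of_pbw k)).
by move/(@of_pbw_inj k)/polyMXaddC_eq0 => [-> ->]; rewrite !raddf0.
Qed.

Lemma env_Me_eq0 (v : U) : v * e = 0 -> v = 0.
Proof.
by move=> v0; have [] := @env_split_inj v 0 in_borel0; rewrite ?addr0.
Qed.

(** W = W f + k[h], again a direct sum. *)
Lemma borel_split (w : U) : in_borel w -> exists v p, in_borel v /\ w = v * f + of_torus p.
Proof.
move=> [q ->]; elim/poly_ind: q => [|q p _].
  by exists 0, 0; rewrite !raddf0 mul0r addr0; split=> //; exists 0; rewrite raddf0.
by exists (of_borel k q), p; rewrite of_borelMXaddC; split=> //; exists q.
Qed.

Lemma of_borel_inj : injective (of_borel k).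
Proof. by move=> p q pq; apply: polyC_inj; apply: (@of_pbw_inj k); rewrite !of_pbwC. Qed.

Lemma of_borel_eq0 q : of_borel k q = 0 -> q = 0.
Proof. by move=> q0; apply: of_borel_inj; rewrite q0 raddf0. Qed.

Lemma borel_split_inj (v : U) p : in_borel v -> v * f + of_torus p = 0 -> v = 0 /\ p = 0.
Proof.
move=> [q ->]; rewrite -of_borelMXaddC.
by move/of_borel_eq0/polyMXaddC_eq0 => [-> ->]; rewrite !raddf0.
Qed.

Lemma borel_Mh2_inj (w : U) : in_borel w -> w * (h + 2%:A) = 0 -> w = 0.
Proof.
move=> [q ->]; have [q' [-> q'0]] := of_borelMh q 2.
move=> /of_borel_eq0/q'0 ->; exact: raddf0.
Qed.

Definition env_reg : lmodType U := U^o.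
Definition env_cube : lmodType U := (U^o * U^o * U^o)%type.
Local Notation U1 := env_reg.
Local Notation U3 := env_cube.

(** The Chevalley-Eilenberg complex, U tensor the exterior powers of sl_2, in the bases
    (e, f, h) in degree 1, (e^f, e^h, f^h) in degree 2 and e^f^h in degree 3; the
    differentials multiply by matrices on the right. *)
Definition koszul_obj (i : nat) : lmodType U :=
  match i with
  | 0 | 3 => U1
  | 1 | 2 => U3
  | _ => 'rV[U]_0
  end.

Definition lin3 (a b c : U) (x : U3) : U1 := x.1.1 * a + x.1.2 * b + x.2 * c.

Fact lin3_linear a b c : linear (lin3 a b c).
Proof.
move=> r [[x1 x2] x3] [[y1 y2] y3]; rewrite /lin3 /=.
rewrite -![r *: _]/(r * _) !mulrDl !mulrDr !mulrA.
by rewrite [LHS](AC (2*2*2) (1*3*5*(2*4*6))).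
Qed.
HB.instance Definition _ a b c :=
  GRing.isLinear.Build U U3 U1 _ (lin3 a b c) (lin3_linear a b c).

Definition koszul1 : {linear U3 -> U1} := lin3 e f h.

Definition koszul2_fun (x : U3) : U3 :=
  (lin3 (- f) (2%:A - h) 0 x, lin3 e 0 (- (h + 2%:A)) x, lin3 (-1) e f x).
Fact koszul2_linear : linear koszul2_fun.
Proof. move=> c x y; rewrite /koszul2_fun.
rewrite (lin3_linear _ _ _ c x y).
rewrite (lin3_linear _ _ _ c x y).
rewrite (lin3_linear _ _ _ c x y).
by rewrite !pair_linP. Qed.
HB.instance Definition _ :=
  GRing.isLinear.Build U U3 U3 _ koszul2_fun koszul2_linear.
Definition koszul2 : {linear U3 -> U3} := koszul2_fun.

Definition koszul3_fun (u : U1) : U3 := (u * h, - (u * f), u * e).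
Fact koszul3_linear : linear koszul3_fun.
Proof.
move=> c x y; rewrite /koszul3_fun -[c *: x]/(c * x) !mulrDl -!mulrA.
by congr (_, _, _); rewrite /= -?[c *: _]/(c * _) // opprD mulrN.
Qed.
HB.instance Definition _ :=
  GRing.isLinear.Build U U1 U3 _ koszul3_fun koszul3_linear.
Definition koszul3 : {linear U1 -> U3} := koszul3_fun.

Definition koszul_dif (i : nat) : {linear koszul_obj i.+1 -> koszul_obj i} :=
  match i with
  | 0 => koszul1
  | 1 => koszul2
  | 2 => koszul3
  | _ => \0
  end.

Definition trivial_mod : lmodType U := env_mod (trivial_rep g).
Definition triv1 : trivial_mod := (1 : k).
Definition koszul_aug_fun (u : U1) : trivial_mod := (u : U) *: triv1.
Fact koszul_aug_linear : linear koszul_aug_fun.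
Proof. by move=> c x y; rewrite /koszul_aug_fun scalerDl scalerA. Qed.
HB.instance Definition _ :=
  GRing.isLinear.Build U U1 trivial_mod _ koszul_aug_fun koszul_aug_linear.
Definition koszul_aug : {linear koszul_obj 0 -> trivial_mod} := koszul_aug_fun.

Lemma koszul_projective i : projective (koszul_obj i).
Proof.
have U3p : projective U3.
  apply: projective_pair; last exact: projective_regular.
  by apply: projective_pair; exact: projective_regular.
case: i => [|[|[|[|i]]]] //=; try exact: projective_regular.
by apply: projective_trivial => x; apply/rowP => -[].
Qed.

Lemma triv_gen (x : g) (v : trivial_mod) : env_gen x *: v = 0.
Proof. exact: env_scale_gen. Qed.

Lemma koszul_aug_surj (m : trivial_mod) : exists x, koszul_aug x = m.
Proof.
exists ((m : k)%:A : U); rewrite /= /koszul_aug_fun [LHS]env_scale_cst.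
exact: mulr1.
Qed.

Lemma env_gen_basis (x : g) : env_gen x = (submod_val x 0 1)%:A * e
  + (submod_val x 1 0)%:A * f + (submod_val x 0 0)%:A * h.
Proof. by rewrite !mulr_algl {1}(sl2_basis x) !linearD !linearZ. Qed.

Lemma augmentationM (a b : U) (c d : k) (x y : U3) :
  a = c%:A + koszul1 x -> b = d%:A + koszul1 y ->
  a * b = (c * d)%:A + koszul1 ((d%:A : U) *: x + a *: y).
Proof.
move=> aE bE; rewrite linearD !linearZ {1}bE mulrDr addrA; congr (_ + _).
rewrite [LHS]mulr_algr {1}aE scalerDr scalerA mulrC; congr (_ + _).
exact/esym/mulr_algl.
Qed.

Lemma augmentationD (a b : U) (c d : k) (x y : U3) :
  a = c%:A + koszul1 x -> b = d%:A + koszul1 y ->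
  a + b = (c + d)%:A + koszul1 (x + y).
Proof. by move=> -> ->; rewrite linearD scalerDl addrACA. Qed.

(** The augmentation ideal is the left ideal generated by e, f and h: an element is a
    constant plus a combination of generators, by induction on its expression. *)
Lemma env_augmentation (u : U) : exists (c : k) (x : U3), u = c%:A + koszul1 x.
Proof.
rewrite -[u]palg_reprK; elim: (palg_repr u) => [x|c|a IHa b IHb|a IHa b IHb].
- exists 0, (((submod_val x 0 1)%:A, (submod_val x 1 0)%:A), (submod_val x 0 0)%:A).
  by rewrite scale0r add0r; apply: env_gen_basis.
- by exists c, 0; rewrite palg_piC linear0 addr0.
- have [c [x aE]] := IHa; have [d [y bE]] := IHb; exists (c + d), (x + y).
  by rewrite palg_piD; apply: (augmentationD aE bE).
- have [c [x aE]] := IHa; have [d [y bE]] := IHb.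
  exists (c * d), ((d%:A : U) *: x + (palg_pi _ a : U) *: y).
  by rewrite palg_piM; apply: (augmentationM aE bE).
Qed.

Lemma koszul_aug1 (x : U3) : koszul_aug (koszul1 x) = 0.
Proof.
rewrite /= /koszul_aug_fun /= /lin3 !scalerDl -!scalerA.
by rewrite !triv_gen !scaler0 !addr0.
Qed.

Lemma koszul_exact0 (x : U1) : koszul_aug x = 0 <-> exists y, koszul1 y = x.
Proof.
split=> [x0|[y <-]]; last exact: koszul_aug1.
have [c [y xE]] := env_augmentation x; exists y.
move: x0; rewrite xE linearD koszul_aug1 addr0.
have -> : koszul_aug (c%:A : U1) = c.
  by rewrite /= /koszul_aug_fun [LHS]env_scale_cst; apply: mulr1.
by move=> ->; rewrite scale0r add0r.
Qed.

Lemma koszul12 (x : U3) : koszul1 (koszul2 x) = 0.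
Proof.
case: x => [[x1 x2] x3].
suff: (x1 * (- f) + x2 * (2%:A - h) + x3 * 0) * e
    + (x1 * e + x2 * 0 + x3 * (- (h + 2%:A))) * f
    + (x1 * -1 + x2 * e + x3 * f) * h = 0 :> U by [].
have Ee : - f * e + e * f + -1 * h = 0 :> U.
  by rewrite env_ef mulN1r mulNr addrA addNr add0r subrr.
have Eh : (2%:A - h) * e + e * h = 0 :> U.
  by rewrite mulrBl mulr_algl env_he [e * h + _]addrC opprD addrA subrr sub0r addNr.
have Ef : - (h + 2%:A) * f + f * h = 0 :> U.
  by rewrite mulNr mulrDl mulr_algl env_hf subrK addNr.
rewrite !mulr0 !addr0 !mulrDl -!mulrA.
rewrite (AC (2*2*3) ((1*3*5)*(2*6)*(4*7))) /= -!mulrDr Ee Eh Ef !mulr0.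
by rewrite !addr0.
Qed.

Lemma koszul23 (u : U) : koszul2 (koszul3 u) = 0.
Proof.
suff: (u * h * (- f) + (- (u * f)) * (2%:A - h) + u * e * 0,
       u * h * e + (- (u * f)) * 0 + u * e * (- (h + 2%:A)),
       u * h * (-1) + (- (u * f)) * e + u * e * f) = (0, 0, 0) :> U * U * U by [].
rewrite !mulr0 !addr0 -!mulrN -!mulrA -!mulrDr.
have -> : h * - f + - f * (2%:A - h) = 0 :> U.
  by rewrite mulrN env_hf mulNr mulrBr mulr_algr opprB subrr.
have -> : h * e + e * - (h + 2%:A) = 0 :> U.
  by rewrite env_he mulrN mulrDr mulr_algr addrN.
have -> : h * -1 + - f * e + e * f = 0 :> U.
  by rewrite env_ef mulNr mulrN1 addrA subrK addNr.
by rewrite mulr0.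
Qed.

(** A relation x1 e + x2 f + x3 h = 0 in normal form (x2 in W, x3 in k[h]) is trivial:
    read it in U e + W, then in W f + k[h]. *)
Lemma koszul1_normal (x1 x2 : U) p :
  in_borel x2 -> x1 * e + x2 * f + of_torus p * h = 0 -> [/\ x1 = 0, x2 = 0 & of_torus p = 0].
Proof.
move=> x2W; rewrite -addrA => x0.
have [||-> ] := @env_split_inj x1 (x2 * f + of_torus p * h) => //.
  by apply: in_borelD; [apply: in_borelMf|apply: in_borelMh; apply: in_borel_torus].
rewrite -of_torusX -of_torusM => /(borel_split_inj x2W)[-> /eqP].
by rewrite mulf_eq0 polyX_eq0 orbF => /eqP ->; rewrite raddf0.
Qed.

(** Modulo the image of koszul2, a relation between e, f and h can be brought to the
    normal form of koszul1_normal: the syzygies with entries e remove the parts in U e of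
    the second and third components, and the one with entry f then removes the part in W f
    of the third. *)
Lemma koszul_exact1 (x : U3) : koszul1 x = 0 <-> exists y, koszul2 y = x.
Proof.
split=> [x0|[y <-]]; last exact: koszul12.
case: x x0 => [[x1 x2] x3] x0.
have [v2 [w2 [w2W x2E]]] := env_split x2.
have [v3 [w3 [w3W x3E]]] := env_split (x3 + v2).
have [v [p [vW w3E]]] := borel_split w3W.
exists (v2, v3, v); apply/eqP; rewrite eq_sym -subr_eq0; apply/eqP.
(* The components of x - koszul2 (v2, v3, v). *)
pose r1 : U := x1 - (v2 * - f + v3 * (2%:A - h) + v * 0).
pose r2 : U := x2 - (v2 * e + v3 * 0 + v * - (h + 2%:A)).
pose r3 : U := x3 - (v2 * -1 + v3 * e + v * f).
suff : [/\ r1 = 0, r2 = 0 & r3 = 0] by move=> [r10 r20 r30]; congr (_, _, _).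
have r0 : r1 * e + r2 * f + r3 * h = 0.
  by have := linearB koszul1 (x1, x2, x3) (koszul2 (v2, v3, v)); rewrite x0 koszul12 subr0.
have r2E : r2 = w2 + v * (h + 2%:A).
  by rewrite /r2 x2E mulr0 addr0 mulrN opprB addrCA [v2 * e + w2]addrC addrK addrC.
have r3E : r3 = of_torus p.
  by rewrite /r3 mulrN1 -addrA opprD opprK addrA x3E w3E addrA addrC addKr.
rewrite r3E in r0 *; apply: koszul1_normal => //; rewrite r2E; apply: in_borelD => //.
by rewrite mulrDr mulr_algr; apply: in_borelD; [apply: in_borelMh | rewrite scaler_nat mulr2n;
  apply: in_borelD].
Qed.

(** The same reduction, one degree higher: subtracting koszul3 v leaves the third
    component in W, where the second equation splits along U e + W and forces it to
    vanish. *)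
Lemma koszul_exact2 (x : U3) : koszul2 x = 0 <-> exists y, koszul3 y = x.
Proof.
split=> [x0|[y <-]]; last exact: koszul23.
case: x x0 => [[x1 x2] x3] x0.
have [v [w [wW x3E]]] := env_split x3.
exists v; apply/eqP; rewrite eq_sym -subr_eq0; apply/eqP.
(* The components of x - koszul3 v. *)
pose r1 : U := x1 - v * h; pose r2 : U := x2 - - (v * f); pose r3 : U := x3 - v * e.
suff : [/\ r1 = 0, r2 = 0 & r3 = 0] by move=> [r10 r20 r30]; congr (_, _, _).
have r0 : (r1 * - f + r2 * (2%:A - h) + r3 * 0,
   r1 * e + r2 * 0 + r3 * - (h + 2%:A), r1 * -1 + r2 * e + r3 * f) = (0, 0, 0) :> U * U * U.
  by have := linearB koszul2 (x1, x2, x3) (koszul3 v); rewrite x0 koszul23 subr0.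
have r3E : r3 = w by rewrite /r3 x3E addrC addKr.
have whW : in_borel (w * - (h + 2%:A)).
  have [q ->] := wW; have [q' [E _]] := of_borelMh q 2.
  by exists (- q'); rewrite mulrN E raddfN.
move: r0; rewrite !mulr0 !addr0 r3E => -[_ r20 r30].
have [r10 wh0] := env_split_inj whW r20.
have w0 : w = 0.
  by apply: borel_Mh2_inj => //; apply/eqP; rewrite -oppr_eq0 -mulrN wh0.
by move: r30; rewrite r10 w0 !mul0r addr0 add0r => /env_Me_eq0.
Qed.

Lemma koszul_exact3 (u : U1) : koszul3 u = 0 -> u = 0.
Proof. by case=> _ _ /env_Me_eq0. Qed.

Definition koszul_resolution : proj_resolution trivial_mod.
Proof.
apply: (@ProjResolution U trivial_mod koszul_obj koszul_dif koszul_aug).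
- exact: koszul_projective.
- exact: koszul_aug_surj.
- exact: koszul_exact0.
move=> [|[|[|i]]] x.
- exact: koszul_exact1.
- exact: koszul_exact2.
- split=> [/koszul_exact3 ->|[y <-]]; first by exists 0; rewrite linear0.
  exact: (linear0 koszul3).
- split=> [_|_ //]; exists 0; rewrite linear0; apply/esym.
  by case: i x => [|i] x; apply/rowP => -[].
Defined.

End Koszul.

(** * Ext^2 by pairs of vectors *)

Section SecondExt.
Variables (k : fieldType) (V : lmodType k) (rho : lie_rep (sl k 2) V).
Local Notation U := (env (sl k 2)).
Local Notation N := (env_mod rho).
Local Notation U3 := (env_cube k).
Local Notation e := (rho (sl2_e k)).
Local Notation f := (rho (sl2_f k)).
Local Notation h := (rho (sl2_h k)).

Lemma rep_linP x c u v : rho x (c *: u + v) = c *: rho x u + rho x v.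
Proof. exact: rep_linearr. Qed.
Lemma repD x u v : rho x (u + v) = rho x u + rho x v.
Proof. by rewrite -[u]scale1r rep_linP !scale1r. Qed.
Lemma rep0 x : rho x 0 = 0.
Proof. by apply: (addIr (rho x 0)); rewrite -repD !add0r. Qed.
Lemma repZ x c u : rho x (c *: u) = c *: rho x u.
Proof. by rewrite -[c *: u]addr0 rep_linP rep0 addr0. Qed.
Lemma repN x u : rho x (- u) = - rho x u.
Proof. by rewrite -scaleN1r repZ scaleN1r. Qed.
Lemma repB x u v : rho x (u - v) = rho x u - rho x v.
Proof. by rewrite repD repN. Qed.

Lemma repl0 v : rho 0 v = 0.
Proof.
apply: (addIr (rho 0 v)); have := rep_linearl rho 1 0 0 v.
by rewrite !scale1r addr0 add0r => <-.
Qed.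
Lemma replN x v : rho (- x) v = - rho x v.
Proof. by have := rep_linearl rho (-1) x 0 v; rewrite repl0 !addr0 !scaleN1r. Qed.

Lemma rep_ef v : e (f v) = f (e v) + h v.
Proof. by rewrite -lie_ef rep_lie addrC subrK. Qed.

Definition pair_cocycle (a b : V) := e b = f a.

Definition pair_coboundary (a b : V) := exists ne nf,
  let g := e nf - f ne in a = e g - h ne + 2 *: ne /\ b = f g - h nf - 2 *: nf.

Definition of_triple (n1 n2 n3 : N) (x : U3) : N :=
  (x.1.1 : U) *: n1 + (x.1.2 : U) *: n2 + (x.2 : U) *: n3.

Fact of_triple_linear n1 n2 n3 : linear (of_triple n1 n2 n3).
Proof.
move=> c x y; rewrite /of_triple /= !scalerDl !scalerDr !scalerA.
by rewrite [LHS](AC (2*2*2) (1*3*5*(2*4*6))).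
Qed.

Definition triple_hom n1 n2 n3 : hom U3 N := Hom (of_triple_linear n1 n2 n3).

Definition hom_fst (t : hom U3 N) : N := t (1, 0, 0).
Definition hom_snd (t : hom U3 N) : N := t (0, 1, 0).
Definition hom_trd (t : hom U3 N) : N := t (0, 0, 1).

Lemma hom_tripleE (t : hom U3 N) x : t x = of_triple (hom_fst t) (hom_snd t) (hom_trd t) x.
Proof.
case: x => [[x1 x2] x3]; rewrite /of_triple /= -!linearZ /= -!linearD /=; congr (t _).
by congr (_, _, _); rewrite /= ?scaler0 ?addr0 ?add0r; apply/esym/mulr1.
Qed.

Lemma triple_homP (t s : hom U3 N) :
  hom_fst t = hom_fst s -> hom_snd t = hom_snd s -> hom_trd t = hom_trd s -> t = s.
Proof. by move=> te tf th; apply/homP => x; rewrite !hom_tripleE te tf th. Qed.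

Lemma of_triple_basis n1 n2 n3 :
  [/\ of_triple n1 n2 n3 (1, 0, 0) = n1, of_triple n1 n2 n3 (0, 1, 0) = n2
    & of_triple n1 n2 n3 (0, 0, 1) = n3].
Proof. by rewrite /of_triple /= !scale0r !scale1r ?addr0 ?add0r. Qed.

Lemma hom_scaleE (c : k) (t : hom U3 N) x : (c *: t) x = c *: (t x : V) :> V.
Proof. exact: env_scale_cst. Qed.

Lemma hom_linE (c : k) (t s : hom U3 N) x :
  (c *: t + s) x = c *: (t x : V) + s x :> V.
Proof. by rewrite -hom_scaleE. Qed.

Lemma env_eE (v : N) : env_e k *: v = e v. Proof. exact: env_scale_gen. Qed.
Lemma env_fE (v : N) : env_f k *: v = f v. Proof. exact: env_scale_gen. Qed.
Lemma env_hE (v : N) : env_h k *: v = h v. Proof. exact: env_scale_gen. Qed.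

Local Notation K := (koszul_resolution k).

(** A 2-cochain (t_ef, t_eh, t_fh) differs by the coboundary of the cochain supported on
    h, with value t_ef, from one with t_ef = 0; these are the two remaining entries. *)
Definition pair_eh (t : hom U3 N) : V := hom_snd t + e (hom_fst t).
Definition pair_fh (t : hom U3 N) : V := hom_trd t + f (hom_fst t).

Lemma cocycle2P (t : hom (K 2) N) :
  t \in cocycle K N 2 <-> pair_cocycle (pair_eh t) (pair_fh t).
Proof.
have tE u : (t : hom U3 N) (koszul3 k u)
    = u *: (h (hom_fst t) - f (hom_snd t) + e (hom_trd t) : N).
  rewrite hom_tripleE /of_triple /= scaleNr -!scalerA env_eE env_fE env_hE.
  by rewrite -scalerBr -scalerDr.
have abE : e (pair_fh t) - f (pair_eh t) = h (hom_fst t) - f (hom_snd t) + e (hom_trd t).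
  rewrite /pair_eh /pair_fh !repD rep_ef opprD.
  by rewrite [LHS](AC (1*2*2) ((3*4*1)*(2*5))) /= subrr addr0.
rewrite /pair_cocycle; split=> [/asboolP t0|ab].
  have t01 : (t : hom U3 N) (koszul3 k 1) = 0 := t0 1.
  by move: t01; rewrite tE scale1r -abE => /eqP; rewrite subr_eq0 => /eqP.
have t0 u : (t : hom U3 N) (koszul3 k u) = 0.
  by rewrite tE -abE ab subrr; exact: scaler0.
have t0' (u : K 3) : t (res_dif K 2 u) = 0 := t0 u.
by apply/asboolP.
Qed.

Lemma coboundary2P (t : hom (K 2) N) :
  @is_coboundary _ _ _ K N 2 t <-> pair_coboundary (pair_eh t) (pair_fh t).
Proof.
have sE (s : hom U3 N) : [/\
    (* The coboundary of s in the basis e^f, e^h, f^h. *)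
    s (koszul2 k (1, 0, 0)) = - f (hom_fst s) + e (hom_snd s) - hom_trd s,
    s (koszul2 k (0, 1, 0)) = 2 *: (hom_fst s : V) - h (hom_fst s) + e (hom_trd s)
  & s (koszul2 k (0, 0, 1)) = - (h (hom_snd s) + 2 *: (hom_snd s : V)) + f (hom_trd s)].
  rewrite !hom_tripleE /of_triple /= /lin3 /= !(mul0r, mul1r, addr0, add0r).
  rewrite !scale0r !(scaleNr, scalerBl, scalerDl) !scale1r !addr0.
  by rewrite !env_eE !env_fE !env_hE add0r.
split=> [[s tE]|[ne [nf [aE bE]]]].
  have {}tE x : (t : hom U3 N) x = s (koszul2 k x) := tE x.
  have [s1 s2 s3] := sE s; exists (hom_fst s), (hom_snd s) => g.
  have gE : - f (hom_fst s) + e (hom_snd s) = g by rewrite addrC.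
  have te : hom_fst t = g - hom_trd s by rewrite /hom_fst tE s1 gE.
  rewrite /pair_eh /pair_fh te /hom_snd /hom_trd !tE s2 s3 !repB.
  split; first by rewrite addrACA subrr addr0 addrC [_ - h _]addrC addrA.
  by rewrite addrACA subrr addr0 opprD addrC addrA.
pose g := e nf - f ne; rewrite -/g in aE bE.
(* The value on h is forced by the first entry of the coboundary. *)
pose s := triple_hom ne nf (g - hom_fst t : V).
have [se sf sh] : [/\ hom_fst s = ne, hom_snd s = nf & hom_trd s = g - hom_fst t :> V].
  exact: of_triple_basis.
have [s1 s2 s3] := sE s.
have ts : (t : hom U3 N) = comp_hom s (koszul2 k).
  apply: triple_homP; apply/esym.
  - by apply: etrans s1 _; rewrite se sf sh [- f ne + _]addrC -/g subKr.
  - apply: etrans s2 _; rewrite se sh.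
    have -> : hom_snd t = pair_eh t - e (hom_fst t) :> V by rewrite addrK.
    by rewrite aE repB [LHS](AC (2*2) (3*2*1*4)).
  - apply: etrans s3 _; rewrite sf sh.
    have -> : hom_trd t = pair_fh t - f (hom_fst t) :> V by rewrite addrK.
    by rewrite bE repB opprD [LHS](AC (2*2) (3*1*2*4)).
have tsE x : (t : hom U3 N) x = s (koszul2 k x) by rewrite ts.
by exists s => x; exact: tsE.
Qed.

(** Coordinates on the pairs (a, b) give coordinates on Ext^2. *)
Lemma ext2_sl2_dim (I : finType) (lam : V -> V -> I -> k)
    (P : proj_resolution (env_mod (trivial_rep (sl k 2)))) :
  (forall c a b a' b' j, lam (c *: a + a') (c *: b + b') j = c * lam a b j + lam a' b' j) ->
  (forall a b, pair_cocycle a b -> (pair_coboundary a b <-> forall j, lam a b j = 0)) ->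
  (forall j, exists a b, pair_cocycle a b /\ forall j', lam a b j' = (j' == j)%:R) ->
  has_dim (Ext P N 2) #|I|.
Proof.
move=> lamL lam0 lam1.
pose lam2 (t : hom (K 2) N) := lam (pair_eh t) (pair_fh t).
suff /(ext_coordinates_resolution P)[lam' lam'P] : ext_coordinates lam2.
  exact: ext_coordinates_dim lam'P.
split=> [c t s j|t tZ|j].
- rewrite -lamL /lam2; congr (lam _ _ _).
    by rewrite /pair_eh /hom_fst /hom_snd !hom_linE repD repZ scalerDr addrACA.
  by rewrite /pair_fh /hom_fst /hom_trd !hom_linE repD repZ scalerDr addrACA.
- by rewrite coboundary2P lam0 //; apply/cocycle2P.
have [a [b [abZ abE]]] := lam1 j.
pose t : hom (K 2) N := triple_hom 0 a b.
have [te tf th] : [/\ hom_fst t = 0, hom_snd t = a & hom_trd t = b] by exact: of_triple_basis.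
have [ta tb] : pair_eh t = a /\ pair_fh t = b.
  by rewrite /pair_eh /pair_fh te tf th !rep0 !addr0.
exists t; first by apply/cocycle2P; rewrite ta tb.
by move=> j'; rewrite /lam2 ta tb.
Qed.

End SecondExt.

(** * The symmetric algebra *)

Section SymEval.
Variables (k : fieldType) (V : lmodType k) (R : comNzRingType).
Variables (cst : {rmorphism k -> R}) (l : V -> R).
Hypothesis l_lin : forall c u v, l (c *: u + v) = cst c * l u + l v.

Fixpoint term_eval (a : term V) : R :=
  match a with
  | TGen v => l v
  | TCst c => cst c
  | TAdd a b => term_eval a + term_eval b
  | TMul a b => term_eval a * term_eval b
  end.

Lemma cong_eval a b : cong (sym_relations V) a b -> term_eval a = term_eval b.
Proof.
have l0 : l 0 = 0.
  by have := l_lin 1 0 0; rewrite scaler0 addr0 rmorph1 mul1r => /eqP;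
     rewrite -subr_eq subrr eq_sym => /eqP.
elim=> //=.
- by move=> {}a {}b c _ -> _ ->.
- by move=> {}a a' {}b b' _ -> _ ->.
- by move=> {}a a' {}b b' _ -> _ ->.
- by move=> *; rewrite addrA.
- by move=> *; rewrite addrC.
- by move=> *; rewrite rmorph0 add0r.
- by move=> *; rewrite mulrA.
- by move=> *; rewrite rmorph1 mul1r.
- by move=> *; rewrite rmorph0 mul0r.
- by move=> *; rewrite mulrDl.
- by move=> *; rewrite mulrDr.
- by move=> *; rewrite rmorphD.
- by move=> *; rewrite rmorphM.
- by move=> *; rewrite mulrC.
- by move=> u v; rewrite -[u]scale1r l_lin scale1r rmorph1 mul1r.
- by move=> c v; rewrite -[c *: v]addr0 l_lin l0 addr0.
- by move=> {}a {}b [u [v [-> ->]]] /=; rewrite mulrC.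
Qed.

(** The universal property of the symmetric algebra: a linear map l into a commutative
    k-algebra R extends to a ring morphism. *)
Definition sym_eval (s : sym V) : R := term_eval (palg_repr s).

Lemma sym_eval_pi a : sym_eval (palg_pi _ a) = term_eval a.
Proof. exact/cong_eval/palg_repr_pi. Qed.

Lemma sym_eval_gen v : sym_eval (sym_gen v) = l v.
Proof. exact: sym_eval_pi. Qed.

Lemma sym_evalC c : sym_eval c%:A = cst c.
Proof. by rewrite -(palg_piC (sym_relations V)) sym_eval_pi. Qed.

Fact sym_eval_zmod_morphism : zmod_morphism sym_eval.
Proof.
have D s t : sym_eval (s + t) = sym_eval s + sym_eval t.
  by rewrite -[s]palg_reprK -[t]palg_reprK -[_ + _]palg_piD !sym_eval_pi.
move=> s t; apply/eqP; rewrite eq_sym subr_eq; apply/eqP.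
by rewrite -D subrK.
Qed.
HB.instance Definition _ :=
  GRing.isZmodMorphism.Build (sym V) R sym_eval sym_eval_zmod_morphism.

Fact sym_eval_monoid_morphism : monoid_morphism sym_eval.
Proof.
split=> [|s t]; first by rewrite -[1]scale1r sym_evalC rmorph1.
by rewrite -[s]palg_reprK -[t]palg_reprK -[_ * _]palg_piM !sym_eval_pi.
Qed.
HB.instance Definition _ :=
  GRing.isMonoidMorphism.Build (sym V) R sym_eval sym_eval_monoid_morphism.

Lemma sym_evalZ c s : sym_eval (c *: s) = cst c * sym_eval s.
Proof. by rewrite -mulr_algl rmorphM /= sym_evalC. Qed.

End SymEval.

Section SymHomog.
Variables (k : fieldType) (V : lmodType k).

Lemma sym_homog_genM n v (s : sym V) :
  s \in sym_homog V n -> sym_gen v * s \in sym_homog V n.+1.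
Proof.
move=> /asboolP[m [c [u ->]]]; rewrite mulr_sumr rpred_sum // => i _.
rewrite -scalerAr rpredZ //.
have -> : sym_gen v * \prod_(j < n) sym_gen (u i j) =
    \prod_(j < n.+1) sym_gen (if unlift ord0 j is Some j' then u i j' else v).
  rewrite big_ord_recl unlift_none; congr (_ * _).
  by apply: eq_bigr => j _; rewrite liftK.
exact: sym_homog_prod.
Qed.

Lemma sym_homog1 : 1 \in sym_homog V 0.
Proof. by have := @sym_homog_prod k V 0 (fun=> 0); rewrite big_ord0. Qed.

Lemma sym_homogM m n (s t : sym V) :
  s \in sym_homog V m -> t \in sym_homog V n -> s * t \in sym_homog V (m + n).
Proof.
move=> /asboolP[d [c [u ->]]] tn; rewrite mulr_suml rpred_sum // => i _.
rewrite -scalerAl rpredZ //; elim: m {u} (u i) => [|m IH] v.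
  by rewrite big_ord0 mul1r.
by rewrite big_ord_recl -mulrA addSn sym_homog_genM.
Qed.

Lemma sym_homogX m n (s : sym V) : s \in sym_homog V m -> s ^+ n \in sym_homog V (n * m).
Proof.
move=> sm; elim: n => [|n IH]; first exact: sym_homog1.
by rewrite exprS mulSn sym_homogM.
Qed.

End SymHomog.

(** * Monomials in the Casimir element *)

Section DerivationPower.
Variables (k : fieldType) (L : lieAlgType k) (V : lmodType k) (rho : lie_rep L V).

Lemma sym_derX x (s : sym V) n :
  sym_der rho x (s ^+ n) = n%:R * s ^+ n.-1 * sym_der rho x s.
Proof.
elim: n => [|n IH]; first by rewrite expr0 -[1]scale1r sym_derC !mul0r.
rewrite exprS sym_derM {}IH; case: n => [|n]; first by rewrite !expr0 !mul0r mulr0 addr0; ring.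
rewrite !exprS /=; ring.
Qed.

Lemma sym_der_nat x n : sym_der rho x n%:R = 0 :> sym V.
Proof. by rewrite -(scaler_nat n (1 : sym V)) sym_derC. Qed.

End DerivationPower.

Section Monomials.
Variable k : fieldType.
Local Notation g := (sl k 2).
Local Notation S := (sym g).
Local Notation D := (sym_der (adjoint_rep g)).

(** The two sl_2-triples (e, f, h) and (f, e, -h), indexed by a sign: one statement about
    sym_mono then serves for positive and negative weights. *)
Definition sl2_x (s : bool) : g := if s then sl2_e k else sl2_f k.
Definition sl2_y (s : bool) : g := sl2_x (~~ s).
Definition sl2_z (s : bool) : g := if s then sl2_h k else - sl2_h k.

Lemma lie_fe : lie (sl2_f k) (sl2_e k) = - sl2_h k.
Proof. by rewrite lieC lie_ef. Qed.
Lemma lie_eh : lie (sl2_e k) (sl2_h k) = - 2 *: sl2_e k.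
Proof. by rewrite lieC lie_he scaleNr. Qed.
Lemma lie_fh : lie (sl2_f k) (sl2_h k) = 2 *: sl2_f k.
Proof. by rewrite lieC lie_hf scaleNr opprK. Qed.

Lemma lie_xy s : lie (sl2_x s) (sl2_y s) = sl2_z s.
Proof. by case: s; [exact: lie_ef | exact: lie_fe]. Qed.
Lemma lie_xz s : lie (sl2_x s) (sl2_z s) = - 2 *: sl2_x s.
Proof. by case: s; [exact: lie_eh | rewrite /= lieN lie_fh scaleNr]. Qed.
Lemma lie_zx s : lie (sl2_z s) (sl2_x s) = 2 *: sl2_x s.
Proof. by rewrite lieC lie_xz scaleNr opprK. Qed.
Lemma lie_yx s : lie (sl2_y s) (sl2_x s) = - sl2_z s.
Proof. by rewrite lieC lie_xy. Qed.
Lemma lie_yz s : lie (sl2_y s) (sl2_z s) = 2 *: sl2_y s.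
Proof. by case: s; [exact: lie_fh | rewrite /= lieN lie_eh scaleNr opprK]. Qed.
Lemma lie_zy s : lie (sl2_z s) (sl2_y s) = - 2 *: sl2_y s.
Proof. by rewrite lieC lie_yz scaleNr. Qed.

Definition sym_x s : S := sym_gen (sl2_x s).
Definition sym_y s : S := sym_gen (sl2_y s).
Definition sym_z s : S := sym_gen (sl2_z s).
Local Notation X := sym_x.
Local Notation Y := sym_y.
Local Notation Z := sym_z.

(** Invariant under sl_2, see der_casimir, and the same for both triples. *)
Definition casimir : S := Z true ^+ 2 + 4 * X true * Y true.
Local Notation Cas := casimir.

Lemma sym_zN s : Z (~~ s) = - Z s.
Proof. by case: s; rewrite /sym_z /= ?linearN ?opprK. Qed.

Lemma casimirE s : Cas = Z s ^+ 2 + 4 * X s * Y s.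
Proof. by case: s => //; rewrite /casimir (sym_zN true) /sym_x /sym_y /sl2_y /=; ring. Qed.

Lemma nat_scale m (s : S) : m%:R *: s = m%:R * s.
Proof. by rewrite scaler_nat mulr_natl. Qed.
Lemma two_scale (s : S) : 2 *: s = 2 * s.
Proof. exact: nat_scale. Qed.

Lemma der_xX s : D (sl2_x s) (X s) = 0.
Proof. by rewrite sym_der_gen /= liexx linear0. Qed.
Lemma der_xY s : D (sl2_x s) (Y s) = Z s.
Proof. by rewrite sym_der_gen /= lie_xy. Qed.
Lemma der_xZ s : D (sl2_x s) (Z s) = - 2 * X s.
Proof. by rewrite sym_der_gen /= lie_xz linearZ /= scaleNr two_scale mulNr. Qed.
Lemma der_yX s : D (sl2_y s) (X s) = - Z s.
Proof. by rewrite sym_der_gen /= lie_yx linearN. Qed.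
Lemma der_yY s : D (sl2_y s) (Y s) = 0.
Proof. by rewrite sym_der_gen /= liexx linear0. Qed.
Lemma der_yZ s : D (sl2_y s) (Z s) = 2 * Y s.
Proof. by rewrite sym_der_gen /= lie_yz linearZ /= two_scale. Qed.
Lemma der_zX s : D (sl2_z s) (X s) = 2 * X s.
Proof. by rewrite sym_der_gen /= lie_zx linearZ /= two_scale. Qed.
Lemma der_zZ s : D (sl2_z s) (Z s) = 0.
Proof. by rewrite sym_der_gen /= liexx linear0. Qed.

Lemma der_zY s : D (sl2_z s) (Y s) = - 2 * Y s.
Proof. by rewrite sym_der_gen /= lie_zy linearZ /= scaleNr two_scale mulNr. Qed.

Lemma der_casimir s :
  [/\ D (sl2_x s) Cas = 0, D (sl2_y s) Cas = 0 & D (sl2_z s) Cas = 0].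
Proof.
rewrite (casimirE s) !sym_derD !sym_derX !sym_derM !sym_der_nat.
rewrite der_xX der_xY der_xZ der_yX der_yY der_yZ der_zX der_zY der_zZ.
by split; ring.
Qed.

(** The monomial x^w C^i z^c has degree w + 2 i + c; for it to be n, there must be a
    solution i. *)
Definition admissible n w c := (w + c <= n)%N && (odd (w + c) == odd n).

(** The basis vector x^w C^i z^c of S^n, with i determined by the degree, and zero by
    convention if there is none: this spares case distinctions at the ends of weight
    strings. *)
Definition sym_mono n s w c : S :=
  if admissible n w c then X s ^+ w * Cas ^+ (n - w - c)./2 * Z s ^+ c else 0.
Local Notation mono := sym_mono.

Lemma gen_homog v : sym_gen v \in sym_homog g 1.
Proof. by rewrite -[sym_gen v]mulr1; apply: sym_homog_genM; apply: sym_homog1. Qed.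

Lemma casimir_homog : Cas \in sym_homog g 2.
Proof.
rewrite /casimir rpredD //; first exact: (sym_homogX 2 (gen_homog _)).
by rewrite -mulrA mulr_natl rpredMn // -[2%N]/(1 + 1)%N sym_homogM ?gen_homog.
Qed.

Lemma mono_homog n s w c : mono n s w c \in sym_homog g n.
Proof.
rewrite /sym_mono; case: ifP => [/andP[wc /eqP odd_wc]|_]; last exact: rpred0.
have nE : n = (w * 1 + (n - w - c)./2 * 2 + c * 1)%N by lia.
rewrite [X in sym_homog _ X]nE.
by rewrite !sym_homogM ?sym_homogX ?casimir_homog ?gen_homog.
Qed.

Lemma admissible_x n w c : admissible n w.+1 c = admissible n w c.+1.
Proof. by rewrite /admissible addSnnS. Qed.

Lemma der_x_mono n s w c : D (sl2_x s) (mono n s w c) = - (2 * c%:R) *: mono n s w.+1 c.-1.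
Proof.
rewrite /sym_mono; case: c => [|c]; last first.
  rewrite /= admissible_x; case: ifP => _; last by rewrite sym_der0 scaler0.
  have -> : (n - w.+1 - c = n - w - c.+1)%N by lia.
  rewrite !sym_derM !sym_derX der_xX der_xZ; have [-> _ _] := der_casimir s.
  rewrite scaleNr -scalerA !nat_scale [X s ^+ w.+1]exprS /=.
  move: (X s ^+ w) (Cas ^+ _) (Z s ^+ c) => A B E. ring.
rewrite mulr0 oppr0 scale0r; case: ifP => _; last exact: sym_der0.
rewrite !sym_derM !sym_derX der_xX der_xZ; have [-> _ _] := der_casimir s; ring.
Qed.

Lemma der_z_mono n s w c : D (sl2_z s) (mono n s w c) = (2 * w%:R) *: mono n s w c.
Proof.
rewrite /sym_mono; case: ifP => _; last by rewrite sym_der0 scaler0.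
rewrite !sym_derM !sym_derX der_zX der_zZ; have [_ _ ->] := der_casimir s.
rewrite -scalerA !nat_scale; case: w => [|w] /=; last rewrite exprS; ring.
Qed.

Lemma sym_zM_mono n s w c : Z s * mono n s w c = mono n.+1 s w c.+1.
Proof.
rewrite /sym_mono; have -> : admissible n.+1 w c.+1 = admissible n w c.
  by rewrite /admissible; lia.
case: ifP => _; last by rewrite mulr0.
by rewrite (_ : n.+1 - w - c.+1 = n - w - c)%N; [rewrite exprS; ring | lia].
Qed.

Lemma sym_xM_mono n s w c : X s * mono n s w c = mono n.+1 s w.+1 c.
Proof.
rewrite /sym_mono; have -> : admissible n.+1 w.+1 c = admissible n w c.
  by rewrite /admissible; lia.
case: ifP => _; last by rewrite mulr0.
by rewrite subSS [X s ^+ w.+1]exprS; ring.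
Qed.

(** In weight 0 the two triples share their monomials up to the sign of h. *)
Lemma mono_swap n s c : mono n (~~ s) 0 c = (-1) ^+ c *: mono n s 0 c.
Proof.
rewrite /sym_mono; case: ifP => _; last by rewrite scaler0.
have sgnE (t : S) : (-1) ^+ c *: t = (-1) ^+ c * t.
  rewrite -signr_odd -[in RHS]signr_odd; case: (odd c).
    by rewrite !expr1 scaleN1r mulN1r.
  by rewrite !expr0 scale1r mul1r.
by rewrite sgnE sym_zN [(- Z s) ^+ c]exprNn !expr0 mulrCA.
Qed.

Hypothesis two_neq0 : 2 != 0 :> k.

Lemma half_scale (s t : S) : 2 * s = t -> s = 2^-1 *: t.
Proof. by move=> <-; rewrite -two_scale scalerA mulVf // scale1r. Qed.

(** The derivation y turns a factor x into -z, and a factor z into 2 y; in the second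
    case, 4 x y = C - z^2 gives monomials again. *)
Lemma der_y_mono n s w c : admissible n w.+1 c ->
  D (sl2_y s) (mono n s w.+1 c) =
  - w.+1%:R *: mono n s w c.+1 + (c%:R / 2) *: (mono n s w c.-1 - mono n s w c.+1).
Proof.
move=> wc; rewrite /sym_mono wc.
have wc1 : admissible n w c.+1 by rewrite -admissible_x.
have -> : (n - w.+1 - c = n - w - c.+1)%N by lia.
rewrite wc1 !sym_derM !sym_derX der_yX der_yZ scaleNr nat_scale /=; have [_ -> _] := der_casimir s.
case: c wc wc1 => [|c] wc wc1; first by rewrite !mul0r scale0r; ring.
have wc2 : admissible n w c by move: wc; rewrite /admissible; lia.
have -> : (n - w - c)./2 = (n - w - c.+2)./2.+1 by move: wc; rewrite /admissible; lia.
rewrite wc2 -[_ / 2 *: _]scalerA nat_scale /=.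
set N := (_ ./2); set W := w.+1%:R; set K := c.+1%:R.
rewrite -[2^-1 *: _](_ : 2 * (X s ^+ w.+1 * Y s * Cas ^+ N * Z s ^+ c) = _); last first.
  apply: half_scale; rewrite [Cas ^+ _.+1]exprS [X in _ * (X * _ ^+ N)](casimirE s).
  rewrite [X s ^+ _]exprS !exprS.
  move: (X s ^+ w) (Cas ^+ N) (Z s ^+ c) (X s) (Y s) (Z s) => A B E x y z; ring.
rewrite [X s ^+ _.+1]exprS !exprS.
move: (X s ^+ w) (Cas ^+ N) (Z s ^+ c) (X s) (Y s) (Z s) => A B E x y z; ring.
Qed.

(** From 4 x y = C - z^2. *)
Lemma sym_yM_mono n s w c : admissible n w.+1 c ->
  Y s * mono n s w.+1 c = 4^-1 *: (mono n.+1 s w c - mono n.+1 s w c.+2).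
Proof.
move=> wc; have four_neq0 : 4 != 0 :> k by rewrite -[4]/(2 * 2)%:R natrM mulf_neq0.
rewrite /sym_mono wc; have [-> ->] : admissible n.+1 w c /\ admissible n.+1 w c.+2.
  by move: wc; rewrite /admissible; lia.
have -> : ((n - w.+1 - c)./2 = (n.+1 - w - c.+2)./2)%N by lia.
have -> : ((n.+1 - w - c)./2 = (n.+1 - w - c.+2)./2.+1)%N.
  by move: wc; rewrite /admissible; lia.
set N := _./2; set T := LHS; have -> : T = 4^-1 *: (4 * T).
  by rewrite -nat_scale scalerA mulVf // scale1r.
congr (_ *: _); rewrite /T [Cas ^+ _.+1]exprS [X in _ * (X * _ ^+ N)](casimirE s).
rewrite [X s ^+ _.+1]exprS !exprS.
move: (X s ^+ w) (Cas ^+ N) (Z s ^+ c) (X s) (Y s) (Z s) => A B E x y z; ring.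
Qed.

Inductive mono_span n : S -> Prop :=
| MonoSpan0 : mono_span n 0
| MonoSpanD s t : mono_span n s -> mono_span n t -> mono_span n (s + t)
| MonoSpanM a s w c : admissible n w c -> mono_span n (a *: mono n s w c).

Lemma mono_spanZ n a s : mono_span n s -> mono_span n (a *: s).
Proof.
elim=> [|{}s t _ sS _ tS|b {}s w c wc]; first by rewrite scaler0; constructor.
  by rewrite scalerDr; constructor.
by rewrite scalerA; constructor.
Qed.

Lemma mono_span_mono n s w c : mono_span n (mono n s w c).
Proof.
case wc: (admissible n w c); first by rewrite -[mono _ _ _ _]scale1r; constructor.
by rewrite /sym_mono wc; constructor.
Qed.

Lemma mono_span_xM n s t : mono_span n t -> mono_span n.+1 (X s * t).
Proof.
elim=> [|{}t u _ tS _ uS|a b w c wc]; first by rewrite mulr0; constructor.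
  by rewrite mulrDr; constructor.
rewrite -scalerAr; apply: mono_spanZ.
have [<-|/negPf bs] := eqVneq s b; first by rewrite sym_xM_mono; exact: mono_span_mono.
have {bs} bE : b = ~~ s by case: (s) (b) bs => -[].
case: w wc => [|w] wc.
  rewrite bE mono_swap -scalerAr sym_xM_mono; apply: mono_spanZ; exact: mono_span_mono.
have -> : X s = Y b by rewrite bE /sym_x /sym_y /sl2_y negbK.
rewrite sym_yM_mono // -scaleN1r; apply: mono_spanZ; constructor; first exact: mono_span_mono.
apply: mono_spanZ; exact: mono_span_mono.
Qed.

Lemma mono_span_zM n t : mono_span n t -> mono_span n.+1 (Z true * t).
Proof.
elim=> [|{}t u _ tS _ uS|a b w c wc]; first by rewrite mulr0; constructor.
  by rewrite mulrDr; constructor.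
rewrite -scalerAr; apply: mono_spanZ; case: b; first by rewrite sym_zM_mono; exact: mono_span_mono.
rewrite -[Z true]opprK -(sym_zN true) mulNr -scaleN1r sym_zM_mono.
apply: mono_spanZ; exact: mono_span_mono.
Qed.

(** The span of the monomials is stable under multiplication by x, y and z, and S^n is
    spanned by products of n generators. *)
Lemma homog_mono_span n s : s \in sym_homog g n -> mono_span n s.
Proof.
move=> /asboolP[m [c [v ->]]]; elim/big_ind: _ => [||i _]; [constructor | exact: MonoSpanD|].
apply: mono_spanZ; move: (v i) => {c}{}v; elim: n v => [|n IH] v.
  rewrite big_ord0; have -> : 1 = mono 0 true 0 0 by rewrite /sym_mono /= !expr0 !mul1r.
  exact: mono_span_mono.
rewrite big_ord_recl; move: (IH (fun j => v (lift ord0 j))) => /=.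
move: (\prod_(j < n) _) => t tS; rewrite (sl2_basis (v ord0)) !linearD !linearZ /= !mulrDl.
constructor; [constructor|]; rewrite -scalerAl; apply: mono_spanZ.
- exact: (mono_span_xM true tS).
- exact: (mono_span_xM false tS).
- exact: mono_span_zM.
Qed.

End Monomials.

(** * Weight polynomials of elements of S^n *)

Section Coordinates.
Variable k : fieldType.
Local Notation g := (sl k 2).
Local Notation S := (sym g).
Local Notation R := {poly {poly k}}.
Local Notation Cas := (casimir k).
Local Notation X := (sym_x k).
Local Notation Y := (sym_y k).
Local Notation Z := (sym_z k).
Local Notation xs := (sl2_x k).
Local Notation ys := (sl2_y k).
Local Notation zs := (sl2_z k).
Local Notation mono := (sym_mono k).

Definition chart_cst : {rmorphism k -> R} := polyC \o polyC.

(** The value of y in the chart below: from C = z^2 + 4 x y with C = X^2, z = X h and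
    x = X^2 one gets y = (1 - h^2) / 4. *)
Definition quarter_quadric : {poly k} := 4^-1 *: (1 - 'X^2).

(** A chart in which the weight w part of S^n is visible: the morphism x |-> X^2, z |-> X
    h, y |-> (1 - h^2) / 4 from the symmetric algebra to k[h][X], where X is the outer
    variable. It sends C to X^2, so the monomial x^w C^i z^c of S^n goes to X^(n+w) h^c,
    and the power of X separates the weights. *)
Definition chart_gen (s : bool) (v : g) : R :=
  let x := if s then submod_val v 0 1 else submod_val v 1 0 in
  let y := if s then submod_val v 1 0 else submod_val v 0 1 in
  let z := if s then submod_val v 0 0 else - submod_val v 0 0 in
  chart_cst x * 'X^2 + chart_cst y * quarter_quadric%:P + chart_cst z * ('X * 'X%:P).

Lemma chart_gen_lin s c u v : chart_gen s (c *: u + v) = chart_cst c * chart_gen s u + chart_gen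
  s v.
Proof.
by rewrite /chart_gen; case: s; rewrite !mxE ?opprD ?[chart_cst (- _ - _)]rmorphD ?[chart_cst (-
  (_ * _))]rmorphN !rmorphD !rmorphM ?rmorphN; ring.
Qed.

Definition chart s : S -> R := sym_eval chart_cst (chart_gen s).

Lemma chart_x s : chart s (X s) = 'X^2.
Proof.
rewrite /chart sym_eval_gen //; last exact: chart_gen_lin.
by rewrite /chart_gen; case: s; rewrite !mxE /= ?subr0 ?oppr0 rmorph1 !rmorph0 !mul0r mul1r !addr0.
Qed.

Lemma chart_y s : chart s (X (~~ s)) = quarter_quadric%:P.
Proof.
rewrite /chart sym_eval_gen //; last exact: chart_gen_lin.
by rewrite /chart_gen; case: s; rewrite !mxE /= ?subr0 ?oppr0 rmorph1 !rmorph0 !mul0r mul1r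
  !addr0 add0r.
Qed.

Lemma chart_z s : chart s (Z s) = 'X * 'X%:P.
Proof.
rewrite /chart sym_eval_gen //; last exact: chart_gen_lin.
by rewrite /chart_gen; case: s; rewrite !mxE /= ?subr0 ?oppr0 ?opprK rmorph1 !rmorph0 !mul0r
  mul1r !add0r.
Qed.

Fact chart_zmod s : zmod_morphism (chart s).
Proof. exact: (sym_eval_zmod_morphism (chart_gen_lin s)). Qed.
HB.instance Definition _ s := GRing.isZmodMorphism.Build S R (chart s) (chart_zmod s).

Fact chart_monoid s : monoid_morphism (chart s).
Proof. exact: (sym_eval_monoid_morphism (chart_gen_lin s)). Qed.
HB.instance Definition _ s := GRing.isMonoidMorphism.Build S R (chart s) (chart_monoid s).

Lemma chart_scale s c t : chart s (c *: t) = c%:P *: chart s t.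
Proof. by rewrite /chart (sym_evalZ (chart_gen_lin s)) mul_polyC. Qed.

(** The effect of z |-> -z on polynomials in z. *)
Definition flip (q : {poly k}) : {poly k} := q \Po (- 'X).

Lemma flip_linear : linear flip.
Proof. by move=> c u v; rewrite /flip comp_polyD comp_polyZ. Qed.
HB.instance Definition _ := GRing.isLinear.Build k {poly k} {poly k} _ flip flip_linear.

Lemma flip0 : flip 0 = 0. Proof. by rewrite linear0. Qed.

Lemma flipD u v : flip (u + v) = flip u + flip v. Proof. by rewrite linearD. Qed.

Lemma flipZ c u : flip (c *: u) = c *: flip u. Proof. by rewrite linearZ. Qed.

Lemma flipM u v : flip (u * v) = flip u * flip v.
Proof. exact: comp_polyM. Qed.

Lemma flipXn c : flip 'X^c = (-1) ^+ c *: 'X^c.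
Proof.
have sgnE (t : {poly k}) : (-1) ^+ c *: t = (-1) ^+ c * t.
  elim: c => [|c IH]; first by rewrite !expr0 scale1r mul1r.
  by rewrite !exprS !mulN1r scaleNr IH mulNr.
by rewrite sgnE /flip comp_Xn_poly [(- 'X) ^+ c]exprNn.
Qed.

Lemma flipK : involutive flip.
Proof. by move=> q; rewrite /flip -comp_polyA linearN /= comp_polyX opprK comp_polyXr. Qed.

Lemma deriv_flip q : (flip q)^`() = - flip q^`().
Proof. by rewrite /flip deriv_comp derivN derivX mulrN1. Qed.

Definition quadric : {poly k} := 1 - 'X^2.
Local Notation T := quadric.

(** The operator by which y acts from weight w + 1 to weight w, see y_of_wpoly. *)
Definition y_op w (q : {poly k}) : {poly k} := - w.+1%:R *: ('X * q) + 2^-1 *: (T * q^`()).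

Lemma y_op_linear w : linear (y_op w).
Proof.
move=> c u v; rewrite /y_op linearP /= !mulrDr -!scalerAr !scalerDr !scalerA addrACA.
by congr (_ + _ + _); congr (_ *: _); rewrite mulrC.
Qed.
HB.instance Definition _ w :=
  GRing.isLinear.Build k {poly k} {poly k} _ (y_op w) (y_op_linear w).

Lemma y_op0 w : y_op w 0 = 0. Proof. by rewrite linear0. Qed.

Lemma y_opD w u v : y_op w (u + v) = y_op w u + y_op w v. Proof. by rewrite linearD. Qed.

Lemma y_opZ w c u : y_op w (c *: u) = c *: y_op w u. Proof. by rewrite linearZ. Qed.

Lemma y_opXn w c : y_op w 'X^c = - w.+1%:R *: 'X^(c.+1) + (c%:R / 2) *: ('X^(c.-1) - 'X^(c.+1)).
Proof.
rewrite /y_op derivXn -exprS; congr (_ + _); rewrite [c%:R / 2]mulrC -scalerA scaler_nat.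
congr (_ *: _); case: c => [|c]; first by rewrite !mulr0n mulr0.
by rewrite mulrnAr /quadric mulrBl mul1r -exprD.
Qed.

Section Degree.
Variable n : nat.
Local Notation V := (sym_pow g n).
Local Notation rho := (sym_pow_rep (adjoint_rep g) n).

(** The weight polynomial: the coefficient of X^(n+w) in the chart, in which the monomials
    of weight w become powers of h. *)
Definition wpoly s w (a : V) : {poly k} := (chart s (submod_val a))`_(n + w).

Lemma wpoly_linear s w : linear (wpoly s w).
Proof. by move=> c a b; rewrite /wpoly /= raddfD /= chart_scale coefD coefZ mul_polyC. Qed.
HB.instance Definition _ s w :=
  GRing.isLinear.Build k V {poly k} _ (wpoly s w) (wpoly_linear s w).

Lemma wpolyZ s w c a : wpoly s w (c *: a) = c *: wpoly s w a.
Proof. by rewrite linearZ. Qed.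

Lemma wpolyD s w a b : wpoly s w (a + b) = wpoly s w a + wpoly s w b.
Proof. by rewrite linearD. Qed.

Lemma wpolyB s w a b : wpoly s w (a - b) = wpoly s w a - wpoly s w b.
Proof. by rewrite linearB. Qed.

Lemma wpolyN s w a : wpoly s w (- a) = - wpoly s w a.
Proof. by rewrite linearN. Qed.

Lemma wpoly0 s w : wpoly s w 0 = 0.
Proof. by rewrite linear0. Qed.

Definition pow_mono s w c : V := Submod (mono_homog k n s w c).

Lemma pow_mono_val s w c : submod_val (pow_mono s w c) = mono n s w c.
Proof. by []. Qed.

Lemma pow_mono_eq0 s w c : ~~ admissible n w c -> pow_mono s w c = 0.
Proof. by move=> wc; apply: val_inj; rewrite /= /sym_mono (negPf wc). Qed.

Lemma pow_mono_swap s c : pow_mono (~~ s) 0 c = (-1) ^+ c *: pow_mono s 0 c.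
Proof. by apply: val_inj; rewrite /= mono_swap. Qed.

Lemma pow_mono_swapV s c : pow_mono s 0 c = (-1) ^+ c *: pow_mono (~~ s) 0 c.
Proof. by have := pow_mono_swap (~~ s) c; rewrite negbK. Qed.

Lemma x_pow_mono s w c : rho (xs s) (pow_mono s w c) = - (2 * c%:R) *: pow_mono s w.+1 c.-1.
Proof. by apply: val_inj; rewrite /= der_x_mono. Qed.

Lemma z_pow_mono s w c : rho (zs s) (pow_mono s w c) = (2 * w%:R) *: pow_mono s w c.
Proof. by apply: val_inj; rewrite /= der_z_mono. Qed.

(** The polynomials that occur in weight w: degree at most n - w, parity of n - w. *)
Definition adm_poly w (q : {poly k}) := forall c, ~~ admissible n w c -> q`_c = 0.

Lemma adm_polyX w c : admissible n w c -> adm_poly w 'X^c.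
Proof. by move=> wc c' wc'; rewrite coefXn; case: eqP wc' => // ->; rewrite wc. Qed.

Lemma adm_poly_linear w a u v : adm_poly w u -> adm_poly w v -> adm_poly w (a *: u + v).
Proof. by move=> uP vP c wc; rewrite coefD coefZ uP // vP // mulr0 addr0. Qed.

Lemma adm_poly0 w : adm_poly w 0.
Proof. by move=> c _; rewrite coef0. Qed.

Lemma adm_poly_ind (Q : {poly k} -> Prop) w :
  Q 0 -> (forall u v, Q u -> Q v -> Q (u + v)) ->
  (forall t c, admissible n w c -> Q (t *: 'X^c)) -> forall q, adm_poly w q -> Q q.
Proof.
move=> Q0 QD QM q qP; rewrite -[q]coefK poly_def; elim/big_ind: _ => // i _.
case wi: (admissible n w i); first exact: QM.
by rewrite qP ?wi // scale0r.
Qed.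

Definition of_wpoly s w (q : {poly k}) : V := \sum_(c < n.+1) q`_c *: pow_mono s w c.

Fact of_wpoly_linear s w : linear (of_wpoly s w).
Proof.
move=> a u v; rewrite /of_wpoly scaler_sumr -big_split /=; apply: eq_bigr => c _.
by rewrite coefD coefZ scalerDl scalerA.
Qed.
HB.instance Definition _ s w :=
  GRing.isLinear.Build k {poly k} V _ (of_wpoly s w) (of_wpoly_linear s w).

Lemma of_wpolyXn s w c : of_wpoly s w 'X^c = pow_mono s w c.
Proof.
rewrite /of_wpoly; have [cn|cn] := ltnP c n.+1.
  rewrite (bigD1 (Ordinal cn)) //= coefXn eqxx scale1r big1 ?addr0 // => i ic.
  by rewrite coefXn (_ : (i == c :> nat) = false) ?scale0r //; apply/negbTE.
rewrite big1 ?pow_mono_eq0 // => [|i _]; first by rewrite /admissible; lia.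
by rewrite coefXn (_ : (i == c :> nat) = false) ?scale0r //; have := ltn_ord i; lia.
Qed.

Lemma of_wpolyZ s w c q : of_wpoly s w (c *: q) = c *: of_wpoly s w q.
Proof. by rewrite linearZ. Qed.

Lemma of_wpolyD s w q r : of_wpoly s w (q + r) = of_wpoly s w q + of_wpoly s w r.
Proof. by rewrite linearD. Qed.

Lemma of_wpolyB s w q r : of_wpoly s w (q - r) = of_wpoly s w q - of_wpoly s w r.
Proof. by rewrite linearB. Qed.

Lemma of_wpoly0 s w : of_wpoly s w 0 = 0.
Proof. by rewrite linear0. Qed.

Lemma x_of_wpoly s w q : rho (xs s) (of_wpoly s w q) = of_wpoly s w.+1 (- 2 *: q^`()).
Proof.
rewrite -[q]coefK poly_def; elim/big_ind: _ => [|u v uE vE|i _].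
- by rewrite deriv0 scaler0 !of_wpoly0 rep0.
- by rewrite derivD scalerDr !of_wpolyD repD uE vE.
rewrite derivZ scalerA mulrC -scalerA !of_wpolyZ repZ; congr (_ *: _).
rewrite of_wpolyXn x_pow_mono derivXn; case: (nat_of_ord i) => [|c].
  by rewrite mulr0 oppr0 scale0r mulr0n of_wpoly0 scaler0.
by rewrite -scaler_nat of_wpolyZ of_wpolyXn scalerA mulNr.
Qed.

Lemma z_of_wpoly s w q : rho (zs s) (of_wpoly s w q) = (2 * w%:R) *: of_wpoly s w q.
Proof.
rewrite -[q]coefK poly_def; elim/big_ind: _ => [|u v uE vE|i _].
- by rewrite !of_wpoly0 rep0 scaler0.
- by rewrite !of_wpolyD repD uE vE scalerDr.
by rewrite !of_wpolyZ repZ of_wpolyXn z_pow_mono !scalerA mulrC.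
Qed.

Lemma of_wpoly_swap s q : of_wpoly (~~ s) 0 (flip q) = of_wpoly s 0 q.
Proof.
rewrite -[q]coefK poly_def; elim/big_ind: _ => [|u v uE vE|i _].
- by rewrite flip0 !of_wpoly0.
- by rewrite flipD !of_wpolyD uE vE.
rewrite flipZ !of_wpolyZ flipXn of_wpolyZ !of_wpolyXn; congr (_ *: _).
exact/esym/pow_mono_swapV.
Qed.

Hypothesis two_neq0 : 2 != 0 :> k.

Lemma four_neq0 : 4 != 0 :> k.
Proof. by rewrite -[4%N]/(2 * 2)%N natrM mulf_neq0. Qed.

Lemma chart_casimir s : chart s Cas = 'X^2.
Proof.
rewrite (casimirE _ s) rmorphD rmorphXn !rmorphM rmorph_nat /= chart_x chart_z chart_y.
have E : 4 * quarter_quadric%:P = 1 - 'X%:P ^+ 2 :> R.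
  rewrite mulr_natl -polyCMn -scaler_nat scalerA mulfV ?four_neq0 // scale1r.
  by rewrite polyCB polyC1 polyC_exp.
by rewrite mulrAC E; ring.
Qed.

Lemma chart_mono s w c : admissible n w c -> chart s (mono n s w c) = 'X^(n + w) * ('X^c)%:P.
Proof.
move=> wc; rewrite /sym_mono wc !rmorphM !rmorphXn /= chart_x chart_casimir chart_z.
have -> : ('X * 'X%:P) ^+ c = 'X^c * 'X%:P ^+ c :> R by exact: exprMn.
rewrite -!exprM mulrA -!exprD; congr (_ * _); congr (_ ^+ _).
by move: wc; rewrite /admissible; lia.
Qed.

(** Monomials of the opposite triple have small degree in X, because y has degree 0 there;
    so they do not interfere with the coefficients that define weight polynomials. *)
Lemma chart_mono_opp s w c i : (n < i + w)%N -> (chart s (mono n (~~ s) w c))`_i = 0.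
Proof.
move=> ni; rewrite /mono; case: ifP => wc; last by rewrite raddf0 coef0.
rewrite !rmorphM !rmorphXn /= chart_y chart_casimir sym_zN raddfN /= chart_z.
have -> : quarter_quadric%:P ^+ w * 'X^2 ^+ (n - w - c)./2 * (- ('X * 'X%:P)) ^+ c
    = (quarter_quadric ^+ w * (- 'X) ^+ c)%:P * 'X^(2 * (n - w - c)./2 + c) :> R.
  have -> : (- ('X * 'X%:P)) ^+ c = 'X^c * ((- 'X) ^+ c)%:P :> R.
    by rewrite polyC_exp polyCN -mulrN; exact: exprMn.
  by rewrite -exprM polyCM !polyC_exp exprD [LHS](AC (2*2) (1*4*(2*3))).
rewrite coefCM coefXn (_ : i == _ = false) ?mulr0 //.
by move: wc; rewrite /admissible; lia.
Qed.

(** Linear statements about S^n need only be checked on monomials. *)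
Lemma sym_pow_mono_ind (Q : V -> Prop) :
  Q 0 -> (forall a b, Q a -> Q b -> Q (a + b)) ->
  (forall t s w c, admissible n w c -> Q (t *: pow_mono s w c)) -> forall a, Q a.
Proof.
move=> Q0 QD QM [a aP]; have := homog_mono_span two_neq0 aP.
move: aP => /[swap]; elim=> {a}.
- by move=> aP; rewrite (_ : Submod aP = 0) //; apply: val_inj.
- move=> s t sS IHs tS IHt aP.
  have hom u : mono_span n u -> u \in sym_homog g n.
    elim=> [|u1 u2 _ h1 _ h2|c b w d _]; first exact: rpred0.
      exact: rpredD.
    by rewrite rpredZ // mono_homog.
  rewrite (_ : Submod aP = Submod (hom _ sS) + Submod (hom _ tS)); last exact: val_inj.
  exact: QD.
- move=> t s w c wc aP; rewrite (_ : Submod aP = t *: pow_mono s w c); last exact: val_inj.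
  exact: QM.
Qed.

Lemma wpoly_mono s w' w c : admissible n w c ->
  wpoly s w' (pow_mono s w c) = if w' == w then 'X^c else 0.
Proof.
move=> wc; rewrite /wpoly pow_mono_val chart_mono // coefMC coefXn eqn_add2l.
by case: eqP; rewrite ?mul1r ?mul0r.
Qed.

Lemma wpoly_mono_opp s w' w c : wpoly s w' (pow_mono (~~ s) w.+1 c) = 0.
Proof. by rewrite /wpoly pow_mono_val chart_mono_opp //; lia. Qed.

(** The weight 0 part belongs to both triples, and the two descriptions differ by
    z |-> -z. *)
Lemma wpoly_swap s a : wpoly (~~ s) 0 a = flip (wpoly s 0 a).
Proof.
elim/sym_pow_mono_ind: a => [|a b IHa IHb|t b w c wc]; first by rewrite !linear0.
  by rewrite !linearD /= IHa IHb.
rewrite !linearZ /=; congr (_ *: _).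
have sw r : (-1) ^+ c *: ((-1) ^+ c *: r) = r :> {poly k}.
  by rewrite scalerA -expr2 sqrr_sign scale1r.
case: w wc => [|w] wc; last first.
  have [->|] := eqVneq s b; last first.
    move=> sb; have -> : b = ~~ s by case: (s) (b) sb => -[].
    by rewrite wpoly_mono // wpoly_mono_opp linear0.
  by rewrite wpoly_mono // /= linear0 -{2}[b]negbK wpoly_mono_opp.
have [->|] := eqVneq s b.
  by rewrite -{2}[b]negbK pow_mono_swap linearZ /= !wpoly_mono //= flipXn.
move=> sb; have -> : b = ~~ s by case: (s) (b) sb => -[].
by rewrite wpoly_mono // pow_mono_swap linearZ /= wpoly_mono //= linearZ /= flipXn sw.
Qed.

Lemma y_pow_mono s w c : admissible n w.+1 c -> rho (ys s) (pow_mono s w.+1 c) =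
  - w.+1%:R *: pow_mono s w c.+1 + (c%:R / 2) *: (pow_mono s w c.-1 - pow_mono s w c.+1).
Proof. by move=> wc; apply: val_inj; rewrite /= der_y_mono. Qed.

Lemma wpoly_mono_cond s w' w c :
  wpoly s w' (pow_mono s w c) = if (w' == w) && admissible n w c then 'X^c else 0.
Proof.
case wc: (admissible n w c); first by rewrite wpoly_mono // andbT.
by rewrite pow_mono_eq0 ?wc // linear0 andbF.
Qed.

(** Opposite weights do not mix. *)
Lemma wpoly_mono_off s w v c : wpoly s w.+1 (pow_mono (~~ s) v c) = 0.
Proof.
case: v => [|v]; last exact: wpoly_mono_opp.
by rewrite pow_mono_swap linearZ /= wpoly_mono_cond scaler0.
Qed.

Lemma sl2_xN s : xs (~~ s) = ys s. Proof. by []. Qed.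

Lemma sl2_yN s : ys (~~ s) = xs s. Proof. by rewrite /sl2_y negbK. Qed.

Lemma bool_or_neg (s b : bool) : b = s \/ b = ~~ s.
Proof. by case: s b => -[]; [left|right|right|left]. Qed.

(** On monomials of the same sign this is x_pow_mono; those of the opposite sign have
    weight at most 0 and contribute only through weight 0, shared by both signs. *)
Lemma wpoly_x s w a : wpoly s w.+1 (rho (xs s) a) = - 2 *: (wpoly s w a)^`().
Proof.
have same v c : wpoly s w.+1 (rho (xs s) (pow_mono s v c)) = - 2 *: (wpoly s w (pow_mono s v
  c))^`().
  rewrite x_pow_mono linearZ /= !wpoly_mono_cond eqSS; case: eqP => _ /=;
    last by rewrite deriv0 !scaler0.
  case: c => [|c]; first by rewrite mulr0 oppr0 scale0r;
    rewrite expr0 -polyC1 (fun_if deriv) derivC deriv0 if_same scaler0.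
  rewrite /= admissible_x; case: ifP => _; last by rewrite deriv0 !scaler0.
  by rewrite derivXn /= -scaler_nat scalerA mulNr.
elim/sym_pow_mono_ind: a => [|a b IHa IHb|t b v c vc]; first by rewrite rep0 !linear0 ?scaler0.
  by rewrite repD !linearD /= IHa IHb ?scalerDr.
rewrite repZ !wpolyZ derivZ [RHS]scalerA [- 2 * t]mulrC -[RHS]scalerA; congr (_ *: _).
have [->|->] := bool_or_neg s b; first exact: same.
case: v vc => [|v] vc.
  by rewrite pow_mono_swap repZ !wpolyZ same derivZ !scalerA [_ * - 2]mulrC.
rewrite -(sl2_yN s) y_pow_mono // wpolyD !wpolyZ wpolyB !wpoly_mono_off wpoly_mono_opp.
by rewrite deriv0 subrr !scaler0 addr0.
Qed.

(** As for wpoly_x, by y_pow_mono. *)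
Lemma wpoly_y s w a : wpoly s w (rho (ys s) a) = y_op w (wpoly s w.+1 a).
Proof.
elim/sym_pow_mono_ind: a => [|a b IHa IHb|t b v c vc]; first by rewrite rep0 !linear0.
  by rewrite repD !linearD /= IHa IHb.
rewrite repZ !wpolyZ [RHS]linearZ; congr (_ *: _).
have [->|->] := bool_or_neg s b; last first.
  by rewrite -(sl2_xN s) x_pow_mono wpolyZ wpoly_mono_opp wpoly_mono_off !linear0.
case: v vc => [|v] vc.
  rewrite (wpoly_mono_cond s) linear0 pow_mono_swapV repZ -(sl2_xN s).
  by rewrite x_pow_mono !wpolyZ wpoly_mono_opp !scaler0.
rewrite y_pow_mono // wpolyD !wpolyZ wpolyB !wpoly_mono_cond eqSS; case: eqP => [->|_] /=.
  rewrite vc -admissible_x vc y_opXn; case: c vc => [|c] vc; first by rewrite !mul0r !scale0r.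
  by have -> : admissible n v c by move: vc; rewrite /admissible; lia.
by rewrite [in RHS]linear0 subrr !scaler0 addr0.
Qed.

Lemma wpoly_z s w a : wpoly s w (rho (zs s) a) = (2 * w%:R) *: wpoly s w a.
Proof.
elim/sym_pow_mono_ind: a => [|a b IHa IHb|t b v c vc]; first by rewrite rep0 !linear0 ?scaler0.
  by rewrite repD !linearD /= IHa IHb ?scalerDr.
rewrite repZ !wpolyZ [RHS]scalerA [_ * t]mulrC -[RHS]scalerA; congr (_ *: _).
have same : wpoly s w (rho (zs s) (pow_mono s v c)) = (2 * w%:R) *: wpoly s w (pow_mono s v c).
  by rewrite z_pow_mono linearZ /= !wpoly_mono_cond; case: eqP => [->|_] //=; rewrite !scaler0.
have [->//|->] := bool_or_neg s b.
have rep_sl2_zN u : rho (zs s) u = - rho (zs (~~ s)) u.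
  have -> : zs (~~ s) = - zs s by case: (s); rewrite /sl2_z /= ?opprK.
  by rewrite replN opprK.
case: v vc {same} => [|v] vc; last by rewrite rep_sl2_zN z_pow_mono wpolyN wpolyZ wpoly_mono_opp
  !scaler0 oppr0.
rewrite rep_sl2_zN z_pow_mono mulr0 scale0r oppr0 wpoly0 pow_mono_swap wpolyZ wpoly_mono_cond.
by case: eqP => [->|_]; rewrite ?mulr0 ?scale0r ?scaler0.
Qed.

Lemma wpoly_adm s w a : adm_poly w (wpoly s w a).
Proof.
elim/sym_pow_mono_ind: a => [|a b IHa IHb|t b v c vc]; first by rewrite wpoly0; exact: adm_poly0.
  by rewrite -[a]scale1r wpolyD wpolyZ; apply: adm_poly_linear.
rewrite -[t *: _]addr0 wpolyD wpolyZ wpoly0; apply: adm_poly_linear; last exact: adm_poly0.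
have same : adm_poly w (wpoly s w (pow_mono s v c)).
  by rewrite wpoly_mono_cond; case: eqP => [->|_]; rewrite ?vc /=;
    [exact: adm_polyX | exact: adm_poly0].
have [->//|->] := bool_or_neg s b.
case: v vc same => [|v] vc same; last by rewrite wpoly_mono_opp; exact: adm_poly0.
by rewrite pow_mono_swap -[_ *: _]addr0 wpolyD wpolyZ wpoly0; apply: adm_poly_linear => //;
  exact: adm_poly0.
Qed.

Lemma of_wpolyK s w' w q : adm_poly w q -> wpoly s w' (of_wpoly s w q) = if w' == w then q else 0.
Proof.
elim/adm_poly_ind; first by rewrite of_wpoly0 wpoly0 if_same.
  by move=> u v uE vE; rewrite of_wpolyD wpolyD uE vE; case: ifP => _; rewrite ?addr0.
by move=> t c wc; rewrite of_wpolyZ of_wpolyXn wpolyZ wpoly_mono //; case: ifP => _;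
  rewrite ?scaler0.
Qed.

Lemma of_wpoly_opp s w' w q : wpoly s w' (of_wpoly (~~ s) w.+1 q) = 0.
Proof.
rewrite /of_wpoly linear_sum big1 // => c _; rewrite -[LHS]/(wpoly s w' _).
by rewrite wpolyZ wpoly_mono_opp scaler0.
Qed.

Lemma y_of_wpoly s w q : adm_poly w.+1 q -> rho (ys s) (of_wpoly s w.+1 q) = of_wpoly s w (y_op w
  q).
Proof.
elim/adm_poly_ind => [|u v uE vE|t c wc]; first by rewrite y_op0 !of_wpoly0 rep0.
  by rewrite y_opD (of_wpolyD s w.+1 u v) (of_wpolyD s w (y_op w u)) repD uE vE.
rewrite y_opZ !of_wpolyZ repZ; congr (_ *: _).
by rewrite of_wpolyXn y_pow_mono // y_opXn of_wpolyD !of_wpolyZ of_wpolyB !of_wpolyXn.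
Qed.

(** S^n is the direct sum of its weight spaces; weight 0 is counted with the positive
    sign. *)
Lemma wpoly_expansion a :
  a = \sum_(w < n.+1) of_wpoly true w (wpoly true w a) + \sum_(w < n) of_wpoly false w.+1 (wpoly
    false w.+1 a).
Proof.
elim/sym_pow_mono_ind: a => [|a b IHa IHb|t b v c vc].
- by rewrite !big1 ?addr0 // => i _; rewrite wpoly0 of_wpoly0.
- rewrite {1}IHa {1}IHb addrACA -!big_split; congr (_ + _); apply: eq_bigr => i _.
    by rewrite wpolyD of_wpolyD.
  by rewrite wpolyD of_wpolyD.
have pull : forall (m : nat) (F : 'I_m -> bool) (G : 'I_m -> nat) a,
  \sum_(i < m) of_wpoly (F i) (G i) (wpoly (F i) (G i) (t *: a)) =
  t *: \sum_(i < m) of_wpoly (F i) (G i) (wpoly (F i) (G i) a).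
  by move=> m F G a; rewrite scaler_sumr; apply: eq_bigr => i _; rewrite wpolyZ of_wpolyZ.
rewrite (pull n.+1 (fun=> true) (fun i => i)) (pull n (fun=> false) (fun i => i.+1)).
rewrite -scalerDr; congr (_ *: _).
have vn : (v <= n)%N by move: vc; rewrite /admissible; lia.
have pos : pow_mono true v c =
    \sum_(w < n.+1) of_wpoly true w (wpoly true w (pow_mono true v c))
    + \sum_(w < n) of_wpoly false w.+1 (wpoly false w.+1 (pow_mono true v c)).
  rewrite [X in _ + X]big1 ?addr0 => [|w _]; last by rewrite (wpoly_mono_off false w v c) of_wpoly0.
  rewrite (bigD1 (Ordinal (leq_ltn_trans vn (ltnSn n)))) //= wpoly_mono // eqxx of_wpolyXn.
  rewrite big1 ?addr0 // => w wv; rewrite wpoly_mono // (_ : (w == v :> nat) = false) ?of_wpoly0 //.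
  by apply/negbTE.
case: b => //; case: v vc vn pos => [|v] vc vn pos.
  rewrite (pow_mono_swap true) {1}pos scalerDr !scaler_sumr.
  by congr (_ + _); apply: eq_bigr => i _; rewrite wpolyZ of_wpolyZ.
rewrite [X in X + _]big1 ?add0r => [|w _]; last by rewrite (wpoly_mono_opp true w v c) of_wpoly0.
rewrite (bigD1 (Ordinal vn)) //= wpoly_mono // eqxx of_wpolyXn.
rewrite big1 ?addr0 // => w wv; rewrite wpoly_mono // (_ : (w.+1 == v.+1 :> nat) = false)
  ?of_wpoly0 //.
by apply/negbTE.
Qed.

End Degree.
End Coordinates.

(** * Cocycles and coboundaries in a fixed weight *)

Section Pieces.
Variable k : fieldType.
Variable n : nat.
Local Notation g := (sl k 2).
Local Notation xs := (sl2_x k).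
Local Notation ys := (sl2_y k).
Local Notation zs := (sl2_z k).
Local Notation V := (sym_pow g n).
Local Notation rho := (sym_pow_rep (adjoint_rep g) n).
Local Notation B := (@of_wpoly k n).
Local Notation adm_poly := (@adm_poly k n).
Local Notation T := (quadric k).
Local Notation x s := (rho (xs s)).
Local Notation y s := (rho (ys s)).
Local Notation z s := (rho (zs s)).

(** The conditions of Ext^2 by pairs, for either triple. For the positive sign they are
    pair_cocycle and pair_coboundary; the negative sign exchanges a and b, see cocyc_swap
    and cobound_swap. *)
Definition cocyc s (a b : V) := x s b = y s a.
Definition cobound s (a b : V) := exists nx ny,
  let g := x s ny - y s nx in a = x s g - z s nx + 2 *: nx /\ b = y s g - z s ny - 2 *: ny.

Lemma rep_sl2_zN s u : z (~~ s) u = - z s u.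
Proof.
have -> : zs (~~ s) = - zs s by case: (s); rewrite /sl2_z /= ?opprK.
by rewrite replN.
Qed.

Lemma cocyc_swap s a b : cocyc s a b -> cocyc (~~ s) b a.
Proof. by rewrite /cocyc sl2_yN => ->. Qed.

Lemma cobound_swap s a b : cobound s a b -> cobound (~~ s) b a.
Proof.
move=> [nx [ny [aE bE]]]; exists (- ny), (- nx).
have -> : x (~~ s) (- nx) - y (~~ s) (- ny) = x s ny - y s nx.
  by rewrite sl2_yN -[sl2_x k (~~ s)]/(ys s) !repN opprK addrC.
rewrite sl2_yN -[sl2_x k (~~ s)]/(ys s) !rep_sl2_zN !repN !opprK !scalerN opprK.
by split.
Qed.

Lemma coboundD s a b a' b' : cobound s a b -> cobound s a' b' -> cobound s (a + a') (b + b').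
Proof.
move=> [nx [ny [-> ->]]] [nx' [ny' [-> ->]]]; exists (nx + nx'), (ny + ny').
have -> : x s (ny + ny') - y s (nx + nx') = (x s ny - y s nx) + (x s ny' - y s nx').
  by rewrite !repD opprD addrACA.
move: (x s ny - _) (x s ny' - _) => h h'.
cbv zeta; rewrite (repD rho (xs s) h) (repD rho (ys s) h) !(repD rho (zs s)) !scalerDr !opprD.
by split; rewrite [LHS](AC (3*3) (1*4*(2*5)*(3*6))).
Qed.

Lemma cobound0 s : cobound s 0 0.
Proof. by exists 0, 0; cbv zeta; rewrite !(rep0 rho) ?subr0 ?(rep0 rho) ?scaler0 ?subr0 ?addr0. Qed.

Lemma cobound_sum s m (F G : 'I_m -> V) : (forall i, cobound s (F i) (G i)) ->
  cobound s (\sum_i F i) (\sum_i G i).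
Proof.
move=> FG; elim: m F G FG => [|m IH] F G FG; first by rewrite !big_ord0; exact: cobound0.
by rewrite !big_ord_recl; apply: coboundD => //; apply: IH.
Qed.

Lemma adm_poly_deriv w q : adm_poly w q -> adm_poly w.+1 q^`().
Proof. by move=> qP c wc; rewrite coef_deriv qP ?mul0rn // -admissible_x. Qed.

Lemma adm_polyZ w a q : adm_poly w q -> adm_poly w (a *: q).
Proof. by move=> qP c wc; rewrite coefZ qP ?mulr0. Qed.
Lemma adm_polyD w q r : adm_poly w q -> adm_poly w r -> adm_poly w (q + r).
Proof. by move=> qP rP c wc; rewrite coefD qP ?rP ?addr0. Qed.

Lemma adm_poly_quadric w q : adm_poly w.+2 q -> adm_poly w (T * q).
Proof.
move=> qP c wc; rewrite /quadric mulrBl mul1r coefB coefXnM.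
have qc : q`_c = 0.
  by apply: qP; apply: contra wc; rewrite /admissible; lia.
rewrite qc sub0r; case: ifP => [_|c2]; first by rewrite oppr0.
rewrite qP ?oppr0 //; apply: contra wc; rewrite /admissible; lia.
Qed.

Lemma deriv_quadricM q : (T * q)^`() = - 2 *: ('X * q) + T * q^`().
Proof.
by rewrite derivM /quadric derivB derivXn derivC sub0r mulNr mulrnAl expr1 scaleNr scaler_nat.
Qed.

Lemma flip_quadricM q : flip (T * q) = T * flip q.
Proof.
rewrite flipM; congr (_ * _).
by rewrite /quadric /flip linearB /= -polyC1 comp_polyC comp_Xn_poly sqrrN.
Qed.

Hypothesis two_neq0 : 2 != 0 :> k.

(** In weights divisible by p, y is a derivative, like x; this is the source of all the
    cohomology. *)
Lemma y_op_quadric w q : w%:R = 0 :> k -> y_op w q = 2^-1 *: (T * q)^`().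
Proof.
move=> w0; rewrite /y_op -natr1 w0 add0r deriv_quadricM scalerDr scalerA mulrN mulVf //.
Qed.

(** With v + 1 a multiple of p, x b and y a are -2 beta' and (T alpha)' / 2. *)
Lemma cocyc_pos s v al be : v.+1%:R = 0 :> k -> adm_poly v.+2 al ->
  (4 *: be + T * al)^`() = 0 -> cocyc s (B s v.+2 al) (B s v be).
Proof.
move=> v0 alP; rewrite derivD derivZ => rho0.
rewrite /cocyc x_of_wpoly y_of_wpoly // y_op_quadric //; congr of_wpoly.
have {rho0} -> : (T * al)^`() = - (4 *: be^`()) by apply/eqP; rewrite -addr_eq0 addrC rho0.
rewrite scalerN scalerA scaleNr; congr (- (_ *: _)).
by rewrite -[4%N]/(2 * 2)%N natrM mulKf.
Qed.

Lemma cocyc_zero s al be : adm_poly 1 al -> adm_poly 1 be ->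
  (T * (al + flip be))^`() = 0 -> cocyc s (B s 1 al) (B (~~ s) 1 be).
Proof.
move=> alP beP; rewrite mulrDr derivD => rho0.
rewrite /cocyc y_of_wpoly // -sl2_yN y_of_wpoly // -(of_wpoly_swap n (~~ s)) negbK; congr of_wpoly.
rewrite !y_op_quadric // flipZ; congr (_ *: _).
have -> : flip (T * be)^`() = - (T * flip be)^`().
  by rewrite -[LHS]opprK -deriv_flip flip_quadricM.
by apply/esym/eqP; rewrite -addr_eq0 rho0.
Qed.

(** The element z acts by zero on cohomology: its eigenvalue on the class is 2 (v + 1),
    and (a, b), divided by minus this eigenvalue, is a cochain with coboundary (a, b). *)
Lemma cobound_offzero s v al be : v.+1%:R != 0 :> k ->
  cocyc s (B s v.+2 al) (B s v be) -> cobound s (B s v.+2 al) (B s v be).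
Proof.
(* Minus the inverse of the eigenvalue of z on the class. *)
move=> v0 ab; pose t := - (2 * v.+1%:R)^-1 : k.
exists (t *: B s v.+2 al), (t *: B s v be).
have -> : x s (t *: B s v be) - y s (t *: B s v.+2 al) = 0 by rewrite !(repZ rho) ab subrr.
cbv zeta; rewrite (rep0 rho (xs s)) (rep0 rho (ys s)) !(repZ rho (zs s)) !z_of_wpoly !sub0r
  !scalerA -!scaleNr -!scalerDl.
have v2 : (2 * v.+1%:R) != 0 :> k by rewrite mulf_neq0.
have tE : t * (2 * v.+1%:R) = -1 by rewrite mulNr mulVf.
split; rewrite -[LHS]scale1r; congr (_ *: _).
  rewrite -addn1 natrD mulrDr mulr1 mulrDr tE; ring.
transitivity (- (t * (2 * v.+1%:R))); first by rewrite tE opprK.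
by rewrite -[v.+1]addn1 natrD; ring.
Qed.

(** If alpha = gamma'', take ny a multiple of gamma and nx = 0: then g is a multiple of
    gamma', x g is alpha up to scaling, and b is correct because rho = 0 determines beta
    from alpha. *)
Lemma cobound_pos s v al be ga : v.+1%:R = 0 :> k -> adm_poly v ga -> al = ga^`()^`() ->
  4 *: be + T * al = 0 -> cobound s (B s v.+2 al) (B s v be).
Proof.
move=> v0 gaP alE rho0.
have beE : be = - (4^-1 *: (T * al)).
  apply: (scalerI (four_neq0 two_neq0)); rewrite scalerN scalerA mulfV ?four_neq0 // scale1r.
  by apply/eqP; rewrite -addr_eq0 rho0.
pose G := - 2 *: (4^-1 *: ga)^`().
have GP : adm_poly v.+1 G by apply: adm_polyZ; apply: adm_poly_deriv; apply: adm_polyZ.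
have GE : G^`() = - 2^-1 *: al.
  rewrite /G !derivZ scalerA alE; congr (_ *: _).
  by rewrite -[4%N]/(2 * 2)%N natrM invfM mulNr mulrA mulfV // mul1r.
exists 0, (B s v (4^-1 *: ga)).
have -> : x s (B s v (4^-1 *: ga)) - y s 0 = B s v.+1 G.
  by rewrite (rep0 rho (ys s)) subr0 x_of_wpoly.
cbv zeta; rewrite x_of_wpoly y_of_wpoly // z_of_wpoly (rep0 rho (zs s)) scaler0 subr0 addr0; split.
  by congr of_wpoly; rewrite GE scalerA mulrN mulNr opprK mulfV // scale1r.
have v2 : 2 * v%:R + 2 = 0 :> k by rewrite -[X in _ + X]mulr1 -mulrDr natr1 v0 mulr0.
rewrite -addrA -opprD -scalerDl v2 scale0r subr0.
congr of_wpoly; rewrite /y_op v0 oppr0 scale0r add0r GE beE -scalerAr scalerA -scaleNr;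
  congr (_ *: _).
by rewrite -[4%N]/(2 * 2)%N natrM invfM mulrN.
Qed.

(** Here weight 0 is reached by y from the polynomial delta, which gives a multiple of (T
    delta)' for g, and then x on either side gives the second derivative (T delta)''. *)
Lemma cobound_zero s al be de : adm_poly 1 de -> al = (T * de)^`()^`() ->
  flip be = - al -> cobound s (B s 1 al) (B (~~ s) 1 be).
Proof.
move=> deP alE beE; pose q := - (2^-1 *: (T * de)^`()).
have qE : q^`() = - (2^-1 *: al) by rewrite /q derivN derivZ alE.
exists (B s 1 de), 0.
have -> : x s 0 - y s (B s 1 de) = B s 0 q.
  by rewrite (rep0 rho (xs s)) sub0r y_of_wpoly // y_op_quadric // /q -[RHS]opprK -scaleN1r
    -of_wpolyZ scaleN1r opprK.
cbv zeta; rewrite (rep0 rho (zs s)) scaler0 !subr0; split.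
  rewrite x_of_wpoly z_of_wpoly mulr1 subrK; congr of_wpoly.
  by rewrite qE scalerN scalerA mulNr mulfV // scaleN1r opprK.
rewrite -(of_wpoly_swap n s) x_of_wpoly; congr of_wpoly.
rewrite deriv_flip qE scalerN scaleNr opprK -[be]flipK beE.
rewrite -!scaleN1r !flipZ !scalerA; congr (_ *: _).
by rewrite mulrCA mulfV // mulr1.
Qed.

End Pieces.

(** * Derivatives in characteristic p *)

Section Geometric.
Variable k : fieldType.
Local Notation T := (quadric k).

(** The quotient (X^c - X^(odd c)) / (X^2 - 1), which makes X^c divisible by T modulo a
    polynomial of degree at most 1, see quadric_geom_sum. *)
Definition geom_sum c : {poly k} := \sum_(j < c./2) 'X^(c - 2 * j.+1).

Lemma geom_sumSS c : geom_sum c.+2 = 'X^c + geom_sum c.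
Proof.
rewrite /geom_sum /= big_ord_recl /= muln1 subn2 /=; congr (_ + _).
by apply: eq_bigr => j _; congr ('X^ _); rewrite /bump /=; lia.
Qed.

Lemma quadric_geom_sum c : T * geom_sum c = 'X^(odd c) - 'X^c.
Proof.
elim/ltn_ind: c => -[|[|c]] IH; try by rewrite /geom_sum big_ord0 mulr0 subrr.
rewrite geom_sumSS mulrDr IH // /= negbK /quadric mulrBl mul1r -exprD add2n.
by rewrite addrC addrA subrK.
Qed.

End Geometric.

Section Polynomials.
Variables (k : fieldType) (p : nat).
Hypothesis pchar_k : p \in [pchar k].
Local Notation T := (quadric k).

Lemma poly_support_ind (A : pred nat) (Q : {poly k} -> Prop) :
  Q 0 -> (forall u v, Q u -> Q v -> Q (u + v)) ->
  (forall t c, A c -> Q (t *: 'X^c)) -> forall q : {poly k}, (forall c, ~~ A c -> q`_c = 0) -> Q q.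
Proof.
move=> Q0 QD QM q qP; rewrite -[q]coefK poly_def; elim/big_ind: _ => // i _.
case Ai: (A i); first exact: QM.
by rewrite qP ?Ai // scale0r.
Qed.

Lemma natk_eq0 m : (m%:R == 0 :> k) = (p %| m)%N.
Proof. exact: (esym (dvdn_pcharf pchar_k m)). Qed.

(** The coefficient of X^(c-1) in q' is c q_c. *)
Lemma deriv_eq0_coef (q : {poly k}) c : q^`() = 0 -> ~~ (p %| c)%N -> q`_c = 0.
Proof.
case: c => [|c] q0 pc; first by rewrite dvdn0 in pc.
have : q^`()`_c = 0 by rewrite q0 coef0.
by rewrite coef_deriv -mulr_natr => /eqP; rewrite mulf_eq0 natk_eq0 (negPf pc) orbF => /eqP.
Qed.

(** The residues -1 and -2 modulo p: X^c is a second derivative when (c + 1)(c + 2) is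
    invertible. *)
Definition top_residue c := (p %| c.+1)%N || (p %| c.+2)%N.

Lemma coef_deriv2 (q : {poly k}) c : top_residue c -> q^`()^`()`_c = 0.
Proof.
move=> pc; rewrite !coef_deriv -mulrnA -[LHS]mulr_natr.
suff -> : (c.+2 * c.+1)%:R = 0 :> k by rewrite mulr0.
by apply/eqP; rewrite natk_eq0; case/orP: pc => pc; [apply: dvdn_mull | apply: dvdn_mulr].
Qed.

Lemma deriv2Xn c : ('X^(c.+2) : {poly k})^`()^`() = (c.+2 * c.+1)%:R *: 'X^c.
Proof. by rewrite derivXn derivMn derivXn /= scaler_nat -mulrnA mulnC. Qed.

Lemma top_residue_neq0 c : ~~ top_residue c -> (c.+2 * c.+1)%:R != 0 :> k.
Proof.
by rewrite /top_residue negb_or natrM mulf_eq0 !natk_eq0 negb_or => /andP[-> ->].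
Qed.

End Polynomials.

(** * Coordinates on the classes *)

Section Classes.
Variables (k : fieldType) (p : nat).
Hypothesis pchar_k : p \in [pchar k].
Hypothesis p_gt2 : (2 < p)%N.
Variable n : nat.
Local Notation g := (sl k 2).
Local Notation xs := (sl2_x k).
Local Notation ys := (sl2_y k).
Local Notation zs := (sl2_z k).
Local Notation V := (sym_pow g n).
Local Notation rho := (sym_pow_rep (adjoint_rep g) n).
Local Notation adm_poly := (@adm_poly k n).
Local Notation T := (quadric k).
Local Notation x s := (rho (xs s)).
Local Notation y s := (rho (ys s)).
Local Notation z s := (rho (zs s)).
Local Notation natk_eq0 := (natk_eq0 pchar_k).

Lemma two_neq0 : 2 != 0 :> k.
Proof. by rewrite natk_eq0; apply/negP => /dvdn_leq; lia. Qed.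

Lemma pchar_odd : odd p.
Proof.
have [//|p_even] := boolP (odd p).
have p_prime : prime p by case/andP: pchar_k.
have /(prime_oddPn p_prime) := p_even; lia.
Qed.

Local Notation B := (@of_wpoly k n).
Local Notation wpoly := (@wpoly k n).

Lemma natk_pmul i : (p * i)%:R = 0 :> k.
Proof. by apply/eqP; rewrite natk_eq0 dvdn_mulr. Qed.

Lemma pmul_predK i : (0 < i)%N -> (p * i).-1.+1 = (p * i)%N.
Proof. by move=> i0; rewrite prednK // muln_gt0 i0; lia. Qed.

(** A linear map whose image contains every monomial outside the residues -1 and -2
    reaches every polynomial without these residues; the predicate Q keeps track of the
    weight. *)
Lemma nonresidue_ind w (L : {poly k} -> {poly k}) (Q : {poly k} -> Prop) :
  linear L -> Q 0 -> (forall c u v, Q u -> Q v -> Q (c *: u + v)) ->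
  (forall c, admissible n w c -> ~~ top_residue p c -> exists2 de, Q de & L de = 'X^c) ->
  forall al, adm_poly w al -> (forall c, top_residue p c -> al`_c = 0) ->
  exists2 de, Q de & al = L de.
Proof.
move=> Ll Q0 QL QX al alP al0.
have L0 : L 0 = 0.
  by apply: (addIr (L 0)); have := Ll 1 0 0; rewrite !scale1r !addr0 add0r => <-.
pose A := [pred c | admissible n w c && ~~ top_residue p c].
apply: (@poly_support_ind k A (fun al => exists2 de, Q de & al = L de)).
- by exists 0; rewrite ?L0.
- move=> u v [du duQ ->] [dv dvQ ->]; exists (1 *: du + dv); first exact: QL.
  by rewrite Ll scale1r.
- move=> t c /andP[wc /(QX c wc)[de deQ deE]]; exists (t *: de + 0); first exact: QL.
  by rewrite Ll L0 addr0 deE.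
by move=> c; rewrite negb_and negbK => /orP[/alP|/al0].
Qed.

Lemma antideriv2 w al : adm_poly w.+2 al -> (forall c, top_residue p c -> al`_c = 0) ->
  exists2 ga, adm_poly w ga & al = ga^`()^`().
Proof.
apply: (nonresidue_ind (L := fun q => q^`()^`())).
- by move=> c u v; rewrite !derivE.
- exact: adm_poly0.
- by move=> c u v; apply: adm_poly_linear.
move=> c wc pc; exists ((c.+2 * c.+1)%:R^-1 *: 'X^(c.+2)).
  by apply: adm_polyZ; apply: adm_polyX; rewrite -!admissible_x.
by rewrite !derivZ deriv2Xn scalerA mulVf ?scale1r // (top_residue_neq0 pchar_k).
Qed.

Lemma adm_poly_geom c : admissible n 1 c -> adm_poly 1 (geom_sum k c.+2).
Proof.
move=> cP c' c'P; rewrite coef_sum big1 // => j _; rewrite coefXn.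
case: eqP => // c'E; case/negP: c'P; rewrite c'E; have := ltn_ord j.
by move: cP; rewrite /admissible /=; lia.
Qed.

(** Division by T is possible up to polynomials of degree at most 1, which two derivatives
    kill; hence X^c = (T delta)'' is solved by a multiple of the geometric sum. *)
Lemma antideriv2_quadric al : adm_poly 1 al -> (forall c, top_residue p c -> al`_c = 0) ->
  exists2 de, adm_poly 1 de & al = (T * de)^`()^`().
Proof.
apply: (nonresidue_ind (L := fun q => (T * q)^`()^`())).
- by move=> c u v; rewrite mulrDr -scalerAr !derivE.
- exact: adm_poly0.
- by move=> c u v; apply: adm_poly_linear.
move=> c wc pc; exists (- (c.+2 * c.+1)%:R^-1 *: geom_sum k c.+2); first by apply: adm_polyZ;
  apply: adm_poly_geom.
have o0 : ('X^(odd c) : {poly k})^`()^`() = 0.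
  by case: (odd c); rewrite ?expr1 ?expr0 ?derivX -?polyC1 !derivC ?deriv0.
rewrite -scalerAr quadric_geom_sum !derivZ !derivB deriv2Xn /= negbK o0 sub0r.
by rewrite scalerN scaleNr opprK scalerA mulVf ?scale1r // (top_residue_neq0 pchar_k).
Qed.

(** Selects a for the positive triple and b for the negative one, so that cocyc s applies
    to sel s a b and its counterpart of opposite sign. *)
Definition sel (s : bool) (a b : V) := if s then a else b.
Definition alpha_poly s i a b := wpoly s (p * i).+1 (sel s a b).

(** The combination whose derivative measures the failure to be a cocycle; for i = 0 the
    partner of alpha is not a polynomial of smaller weight but that of opposite weight. *)
Definition rho_poly s i a b :=
  if i is 0 then T * (wpoly s 1 (sel s a b) + flip (wpoly (~~ s) 1 (sel (~~ s) a b)))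
  else 4 *: wpoly s (p * i).-1 (sel (~~ s) a b) + T * alpha_poly s i a b.

Lemma cocyc_sel s a b : cocyc true a b -> cocyc s (sel s a b) (sel (~~ s) a b).
Proof. by case: s => // /cocyc_swap. Qed.

Lemma cobound_sel s a b : cobound true a b -> cobound s (sel s a b) (sel (~~ s) a b).
Proof. by case: s => // /cobound_swap. Qed.

Lemma half_inj (u v : {poly k}) : 2^-1 *: u = v -> u = 2 *: v.
Proof. by move=> <-; rewrite scalerA mulfV ?two_neq0 // scale1r. Qed.

Lemma rho_poly_deriv s i a b : cocyc true a b -> (rho_poly s i a b)^`() = 0.
Proof.
move=> /(cocyc_sel s); set a' := sel s a b; set b' := sel (~~ s) a b => ab.
case: i => [|i].
  have yE : wpoly s 0 (y s a') = 2^-1 *: (T * wpoly s 1 a')^`().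
    by rewrite (wpoly_y two_neq0) y_op_quadric //; exact: two_neq0.
  have xE : wpoly s 0 (x s b') = flip (2^-1 *: (T * wpoly (~~ s) 1 b')^`()).
    have := wpoly_swap two_neq0 (~~ s) (x s b'); rewrite negbK => ->; congr flip.
    by rewrite -sl2_yN (wpoly_y two_neq0) y_op_quadric //; exact: two_neq0.
  have := congr1 (wpoly s 0) ab; rewrite yE xE flipZ => /(scalerI (invr_neq0 two_neq0)) E.
  rewrite /rho_poly -/a' -/b' mulrDr derivD -E -[flip _]opprK -deriv_flip flip_quadricM.
  by rewrite addNr.
have := congr1 (wpoly s (p * i.+1)) ab; rewrite (wpoly_y two_neq0) y_op_quadric;
  last exact: natk_pmul; last exact: two_neq0.
rewrite -[in LHS](pmul_predK (ltn0Sn i)) (wpoly_x two_neq0) => /esym/half_inj E.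
rewrite /rho_poly -/b' derivD derivZ /alpha_poly -/a' E scalerA mulrN scaleNr.
by rewrite -[4%N]/(2 * 2)%N natrM subrr.
Qed.

(** With w = p i the weight of g, alpha = -2 g' and 4 beta = - T alpha; and g itself is a
    derivative, being x ny - y nx in weight divisible by p. *)
Lemma cobound_coords s i a b : cobound true a b ->
  rho_poly s i a b = 0 /\ exists D, alpha_poly s i a b = D^`()^`().
Proof.
move=> /(cobound_sel s); set a' := sel s a b; set b' := sel (~~ s) a b.
move=> [nx [ny]]; set gg := _ - _; have ggE : gg = x s ny - y s nx by [].
move: gg ggE => gg ggE [aE bE].
have alE : alpha_poly s i a b = - 2 *: (wpoly s (p * i) gg)^`().
  rewrite /alpha_poly -/a' aE wpolyD wpolyB wpolyZ (wpoly_x two_neq0) (wpoly_z two_neq0).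
  by rewrite -[(p * i).+1%:R]natr1 natk_pmul add0r mulr1 subrK.
have [D DE] : exists D, wpoly s (p * i) gg = D^`().
  have xD : exists D, wpoly s (p * i) (x s ny) = D^`().
    case: i {alE} => [|i]; last first.
      by rewrite -(pmul_predK (ltn0Sn i)) (wpoly_x two_neq0) -derivZ; eexists.
    rewrite muln0; have := wpoly_swap two_neq0 (~~ s) (x s ny); rewrite negbK => ->.
    rewrite -sl2_yN (wpoly_y two_neq0) y_op_quadric ?two_neq0 // -derivZ.
    by exists (- flip (2^-1 *: (T * wpoly (~~ s) 1 ny))); rewrite derivN deriv_flip opprK.
  have [D1 D1E] := xD.
  exists (D1 - 2^-1 *: (T * wpoly s (p * i).+1 nx)).
  rewrite ggE wpolyB D1E derivB derivZ (wpoly_y two_neq0) y_op_quadric //;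
    [exact: two_neq0 | exact: natk_pmul].
split; last by exists (- 2 *: D); rewrite alE DE !derivZ.
case: i alE DE => [|i] alE DE; last first.
  rewrite /rho_poly -/b' alE bE !wpolyB wpolyZ (wpoly_y two_neq0) (wpoly_z two_neq0).
  set m := (p * i.+1).-1.
  have m0 : m.+1%:R = 0 :> k by rewrite /m pmul_predK // natk_pmul.
  have -> : (2 * m%:R) *: wpoly s m ny = - (2 *: wpoly s m ny).
    apply/eqP; rewrite -addr_eq0 -scalerDl -[X in _ + X]mulr1 -mulrDr natr1 m0 mulr0 scale0r //.
  rewrite opprK addrK /y_op m0 oppr0 scale0r add0r /m pmul_predK //.
  rewrite scalerA -scalerAr scaleNr -[4%N]/(2 * 2)%N natrM mulfK ?two_neq0 //.
  by rewrite subrr.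
rewrite /rho_poly -/a' -/b'; rewrite /alpha_poly muln0 -/a' in alE; rewrite alE.
have -> : wpoly (~~ s) 1 b' = - 2 *: (flip (wpoly s 0 gg))^`().
  have zE : wpoly (~~ s) 1 (z s ny) = - (2 *: wpoly (~~ s) 1 ny).
    by rewrite -[z s ny]opprK -rep_sl2_zN wpolyN (wpoly_z two_neq0) mulr1.
  have yE : wpoly (~~ s) 1 (y s gg) = - 2 *: (wpoly (~~ s) 0 gg)^`() by rewrite -(wpoly_x two_neq0).
  by rewrite bE !wpolyB wpolyZ zE yE (wpoly_swap two_neq0) opprK addrK.
rewrite flipZ deriv_flip -scaleN1r flipZ flipK.
by rewrite scaleN1r scalerN addrN mulr0.
Qed.

(** In weight p i, the exponents c of alpha satisfy adm0 (p i + 1 + c), and those of rho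
    satisfy adm1 (p i + c). *)
Definition adm0 m := (m <= n)%N && (odd m == odd n).
Definition adm1 m := (m <= n.+1)%N && (odd m != odd n).

(** Which coefficients are used as coordinates, for sign s and weight p i: t = 0 for the
    coefficient of rho at p c, t = 1 and t = 2 for those of alpha at p c + p - 1 and p
    c + p - 2. Weight 0 is listed for the positive sign only; there rho(1) = 0 makes one
    of the exponents 0 and p redundant, and no more than one of them has the right parity,
    so c > 1 is required. *)
Definition valid (s : bool) (i c t : nat) :=
  (s || (0 < i)%N) &&
  match t with
  | 0 => adm1 (p * (i + c)) && ((0 < i)%N || (1 < c)%N)
  | 1 => adm0 (p * (i + c).+1)
  | _ => adm1 (p * (i + c).+1)
  end.

Definition coord a b (s : bool) (i c t : nat) : k :=
  match t with
  | 0 => (rho_poly s i a b)`_(p * c)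
  | 1 => (alpha_poly s i a b)`_(p * c + p.-1)
  | _ => (alpha_poly s i a b)`_(p * c + p.-2)
  end.

Lemma sel_lin s u a b a' b' :
  sel s (u *: a + a') (u *: b + b') = u *: sel s a b + sel s a' b'.
Proof. by case: s. Qed.

Lemma alpha_poly_lin s i u a b a' b' :
  alpha_poly s i (u *: a + a') (u *: b + b') = u *: alpha_poly s i a b + alpha_poly s i a' b'.
Proof. by rewrite /alpha_poly sel_lin wpolyD wpolyZ. Qed.

Lemma rho_poly_lin s i u a b a' b' :
  rho_poly s i (u *: a + a') (u *: b + b') = u *: rho_poly s i a b + rho_poly s i a' b'.
Proof.
case: i => [|i]; rewrite /rho_poly.
  rewrite !sel_lin !wpolyD !wpolyZ flipD flipZ scalerAr -mulrDr scalerDr; congr (_ * _).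
  by rewrite addrACA.
rewrite alpha_poly_lin sel_lin wpolyD wpolyZ mulrDr -scalerAr !scalerDr !scalerA [4 * u]mulrC.
by rewrite addrACA.
Qed.

Lemma coord_lin s i c t u a b a' b' :
  coord (u *: a + a') (u *: b + b') s i c t = u * coord a b s i c t + coord a' b' s i c t.
Proof. by case: t => [|[|t]]; rewrite /coord ?rho_poly_lin ?alpha_poly_lin coefD coefZ. Qed.

Lemma top_residueP c : top_residue p c ->
  exists c', c = (p * c' + p.-1)%N \/ c = (p * c' + p.-2)%N.
Proof.
case/orP => /dvdnP[[|m] mE]; rewrite ?mul0n // in mE; exists m; [left|right];
  move: mE; rewrite mulSn mulnC; lia.
Qed.

Lemma top_residue_residue c : top_residue p (p * c + p.-1) /\ top_residue p (p * c + p.-2).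
Proof.
rewrite /top_residue (_ : (p * c + p.-1).+1 = p * c.+1)%N ?dvdn_mulr //; last by rewrite mulnS; lia.
by rewrite (_ : (p * c + p.-2).+2 = p * c.+1)%N ?dvdn_mulr ?orbT //; rewrite mulnS; lia.
Qed.

Lemma cobound_coord_eq0 a b s i c t : cobound true a b -> coord a b s i c t = 0.
Proof.
move=> /(cobound_coords s i)[R0 [D DE]]; have [r1 r2] := top_residue_residue c.
by case: t => [|[|t]]; rewrite /coord ?R0 ?DE ?coef0 // (coef_deriv2 pchar_k).
Qed.

Lemma coord_alpha_poly_eq0 a b s i : (s || (0 < i)%N) ->
  (forall c t, valid s i c t -> coord a b s i c t = 0) ->
  forall c, top_residue p c -> (alpha_poly s i a b)`_c = 0.
Proof.
move=> si ab0 c /top_residueP[c' cE].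
have [wc|] := boolP (admissible n (p * i).+1 c); last by apply: wpoly_adm; exact: two_neq0.
case: cE => cE; rewrite cE; [apply: (ab0 _ 1%N) | apply: (ab0 _ 2%N)]; rewrite /valid si /=.
  rewrite (_ : p * (i + c').+1 = (p * i).+1 + c)%N //; rewrite cE mulnS mulnDr; lia.
have pE : (p * (i + c').+1 = ((p * i).+1 + c).+1)%N by rewrite cE mulnS mulnDr; lia.
by rewrite pE /adm1 ltnS /=; move: wc; rewrite /admissible; lia.
Qed.

Lemma adm_poly_flip w q : adm_poly w q -> adm_poly w (flip q).
Proof.
apply: (@adm_poly_ind k n (fun q => adm_poly w (flip q))) => [|u v uP vP|t c wc].
- by rewrite flip0; exact: adm_poly0.
- by rewrite flipD; apply: adm_polyD.
- by rewrite flipZ flipXn; do 2!apply: adm_polyZ; apply: adm_polyX.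
Qed.

Lemma wpolyP s w a : adm_poly w (wpoly s w a).
Proof. by apply: wpoly_adm; exact: two_neq0. Qed.

Lemma rho_poly_coef_eq0 s i a b c : ~~ adm1 (p * i + c) -> (rho_poly s i a b)`_c = 0.
Proof.
case: i => [|i] ic.
  set q := wpoly s 1 (sel s a b) + flip (wpoly (~~ s) 1 (sel (~~ s) a b)).
  have qP : adm_poly 1 q by apply: adm_polyD; [|apply: adm_poly_flip]; exact: wpolyP.
  rewrite /rho_poly -/q /quadric mulrBl mul1r coefB coefXnM.
  rewrite muln0 in ic; rewrite qP ?sub0r; last first.
    by apply: contra ic; rewrite /admissible /adm1; lia.
  case: ifP => [_|c2]; first by rewrite oppr0.
  by rewrite qP ?oppr0 //; apply: contra ic; rewrite /admissible /adm1; lia.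
have : adm_poly (p * i.+1).-1 (rho_poly s i.+1 a b).
  apply: adm_polyD; first by apply: adm_polyZ; exact: wpolyP.
  by apply: adm_poly_quadric; rewrite pmul_predK //; exact: wpolyP.
apply; apply: contra ic; rewrite -{2}(pmul_predK (ltn0Sn i)).
by move: (_.-1) => m; rewrite /admissible /adm1; lia.
Qed.

(** A rho with zero derivative has only exponents p c, and the vanishing coordinates leave
    nothing, except in weight 0, where one of the exponents 0 and p may remain; the factor
    T then excludes it, by evaluation at 1. *)
Lemma rho_poly_eq0 a b s i : (s || (0 < i)%N) -> cocyc true a b ->
  (forall c t, valid s i c t -> coord a b s i c t = 0) -> rho_poly s i a b = 0.
Proof.
move=> si abZ ab0; have R'0 := rho_poly_deriv s i abZ.
have R0 c : (0 < i)%N || (p < c)%N -> (rho_poly s i a b)`_c = 0.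
  move=> ic; have [/dvdnP[c' cE]|] := boolP (p %| c)%N; last exact: (deriv_eq0_coef pchar_k R'0).
  have [wc|] := boolP (adm1 (p * i + c)); last exact: rho_poly_coef_eq0.
  rewrite cE mulnC; apply: (ab0 c' 0%N); rewrite /valid si /= mulnDr -(mulnC c') -cE wc /=.
  by case/orP: ic => [-> //|]; rewrite cE -[X in (X < _)%N]mul1n ltn_mul2r => /andP[_ ->];
    rewrite orbT.
case: i si ab0 R'0 R0 => [|i] si ab0 R'0 R0; last by apply/polyP => c; rewrite R0 // coef0.
(* Only the exponents 0 and p remain, of opposite parities. *)
have [c0 R0c0] : exists c0, forall c, c != c0 -> (rho_poly s 0 a b)`_c = 0.
  exists (if odd n then 0%N else p) => c cc0.
  have [pc|cp] := ltnP p c; first exact: R0.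
  have [/dvdnP[c' cE]|] := boolP (p %| c)%N; last exact: (deriv_eq0_coef pchar_k R'0).
  apply: rho_poly_coef_eq0; rewrite muln0 add0n /adm1.
  move: pchar_odd cc0 cp; rewrite cE; case: c' {cE} => [|[|c']]; case: (odd n) => //=;
   rewrite ?mul0n ?mul1n ?eqxx // => podd _; rewrite ?podd ?andbF //; nia.
have RE : rho_poly s 0 a b = (rho_poly s 0 a b)`_c0 *: 'X^c0.
  apply/polyP => c; rewrite coefZ coefXn; case: eqP => [->|/eqP cc0]; first by rewrite mulr1.
  by rewrite R0c0 // mulr0.
have : (rho_poly s 0 a b).[1] = 0 by rewrite /rho_poly hornerM /quadric !hornerE expr1n subrr mul0r.
by rewrite RE hornerZ hornerXn expr1n mulr1 => ->; rewrite scale0r.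
Qed.

Lemma of_wpoly_big s w q : (n < w)%N -> B s w q = 0.
Proof.
move=> nw; rewrite /of_wpoly big1 // => c _; rewrite pow_mono_eq0 ?scaler0 //.
by rewrite /admissible; lia.
Qed.

(** The weights at least 2 of one sign, weight 1, and the weights at least 0 of the other
    sign: in this form the summand v + 2 for a pairs with the summand v for b. *)
Lemma wpoly_split s a : a = \sum_(v < n.+1) B s v.+2 (wpoly s v.+2 a) + B s 1 (wpoly s 1 a)
  + \sum_(v < n.+1) B (~~ s) v (wpoly (~~ s) v a).
Proof.
have swap0 : B (~~ s) 0 (wpoly (~~ s) 0 a) = B s 0 (wpoly s 0 a).
  by rewrite (wpoly_swap two_neq0) of_wpoly_swap.
have aE : a = \sum_(w < n.+1) B s w (wpoly s w a) + \sum_(w < n) B (~~ s) w.+1 (wpoly (~~ s) w.+1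
  a).
  case: (s) swap0 => /= swap0; first exact: (wpoly_expansion two_neq0 a).
  rewrite {1}(wpoly_expansion two_neq0 a) big_ord_recl [in RHS]big_ord_recl /= -swap0.
  by rewrite -addrA [X in _ + X]addrC addrA.
have PE : \sum_(w < n.+1) B s w (wpoly s w a)
    = B s 0 (wpoly s 0 a) + (B s 1 (wpoly s 1 a) + \sum_(v < n.+1) B s v.+2 (wpoly s v.+2 a)).
  transitivity (\sum_(w < n.+3) B s w (wpoly s w a)).
    by rewrite 2![in RHS]big_ord_recr /= !of_wpoly_big ?addr0 //; lia.
  by rewrite big_ord_recl; congr (_ + _); rewrite big_ord_recl.
have RE : \sum_(v < n.+1) B (~~ s) v (wpoly (~~ s) v a)
    = B s 0 (wpoly s 0 a) + \sum_(w < n) B (~~ s) w.+1 (wpoly (~~ s) w.+1 a).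
  by rewrite big_ord_recl /= swap0.
by rewrite {1}aE PE RE [LHS](AC (1*2*1) (3*2*(1*4))).
Qed.

Lemma quadric_neq0 : T != 0.
Proof.
apply/eqP => /(congr1 (horner^~ 0)); rewrite /quadric !hornerE expr0n /= subr0.
by move/eqP; rewrite oner_eq0.
Qed.

(** A cocycle is the sum of its components (a of weight w + 1, b of weight w - 1): for
    each of them, off the multiples of p it is a coboundary for free, and at a multiple of
    p by the vanishing of the coordinates. *)
Lemma cobound_of_coords a b : cocyc true a b ->
  (forall s i c t, valid s i c t -> coord a b s i c t = 0) -> cobound true a b.
Proof.
move=> abZ ab0.
have piece s v : cobound s (B s v.+2 (wpoly s v.+2 (sel s a b))) (B s v (wpoly s v (sel (~~ s) a
  b))).
  have [/eqP v0|v0] := boolP (v.+1%:R == 0 :> k); last first.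
    apply: (cobound_offzero two_neq0) => //; have /(congr1 (wpoly s v.+1)) := cocyc_sel s abZ.
    rewrite (wpoly_x two_neq0) (wpoly_y two_neq0) /cocyc x_of_wpoly (y_of_wpoly two_neq0) =>
      [->//|]; exact: wpolyP.
  have /dvdnP[i iE] : (p %| v.+1)%N by rewrite -natk_eq0 v0.
  have i0 : (0 < i)%N by case: i iE.
  have vE : v = (p * i).-1 by rewrite mulnC -iE.
  have si : s || (0 < i)%N by rewrite i0 orbT.
  have R0 := rho_poly_eq0 si abZ (ab0 s i).
  have [|ga gaP gaE] := @antideriv2 v (alpha_poly s i a b) _ (coord_alpha_poly_eq0 si (ab0 s i)).
    by rewrite vE pmul_predK //; exact: wpolyP.
  have v2 : v.+2 = (p * i).+1 by rewrite vE pmul_predK.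
  have := @cobound_pos k n two_neq0 s v (wpoly s v.+2 (sel s a b)) (wpoly s v (sel (~~ s) a b))
    ga v0 gaP; apply.
    by rewrite -gaE /alpha_poly v2.
  by case: (i) i0 R0 v2 vE => // i' _ R0 -> ->.
have zero : cobound true (B true 1 (wpoly true 1 a)) (B false 1 (wpoly false 1 b)).
  have R0 := rho_poly_eq0 (isT : true || (0 < 0)%N) abZ (ab0 true 0%N).
  have := coord_alpha_poly_eq0 (isT : true || (0 < 0)%N) (ab0 true 0%N).
  rewrite /alpha_poly muln0 /= => al0; have [de deP deE] := antideriv2_quadric (@wpolyP true 1 a)
    al0.
  apply: (@cobound_zero _ _ two_neq0 true _ _ de) => //; move: R0; rewrite /rho_poly /= => /eqP.
  by rewrite mulf_eq0 (negPf quadric_neq0) /= addrC addr_eq0 => /eqP.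
rewrite {1}(wpoly_split true a) {1}(wpoly_split false b) /=.
rewrite [X in cobound _ _ X](AC (2*1) (3*2*1)).
apply: coboundD; first apply: coboundD => //; apply: cobound_sum => v.
  exact: (piece true).
exact: (cobound_swap (piece false v)).
Qed.

Lemma negb_eqbP (s s' : bool) : s' != s -> s' = ~~ s.
Proof. by case: s s' => -[]. Qed.

(** Any alpha, and any rho with zero derivative, occur for a cocycle concentrated in the
    given weight: solve rho = 4 beta + T alpha for beta. *)
Lemma realize_pos s i al ro : (0 < i)%N -> adm_poly (p * i).+1 al -> adm_poly (p * i).-1 ro ->
  ro^`() = 0 -> exists a b, cocyc true a b /\
  forall s' i', (s' || (0 < i')%N) ->
    alpha_poly s' i' a b = (if (s' == s) && (i' == i) then al else 0) /\
    rho_poly s' i' a b = (if (s' == s) && (i' == i) then ro else 0).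
Proof.
move=> i0 alP roP ro0; set v := (p * i).-1.
have v1 : v.+1 = (p * i)%N by rewrite /v pmul_predK.
have [v' vE] : exists v', v = v'.+1.
  by exists v.-1; rewrite prednK // -ltnS v1; move: i0; case: (i) => // ? _; rewrite mulnS; lia.
pose be := 4^-1 *: (ro - T * al).
have beE : 4 *: be + T * al = ro by rewrite scalerA mulfV ?(four_neq0 two_neq0) // scale1r subrK.
have alP' : adm_poly v.+2 al by rewrite v1.
have beP : adm_poly v be.
  apply: adm_polyZ; apply: adm_polyD => //; rewrite -scaleN1r; apply: adm_polyZ.
  exact: adm_poly_quadric.
pose a' := B s v.+2 al; pose b' := B s v be.
have abZ : cocyc s a' b'.
  by apply: (cocyc_pos two_neq0) => //; [rewrite v1; exact: natk_pmul | rewrite beE].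
exists (sel s a' b'), (sel s b' a'); split.
  by case: (s) abZ => // /cocyc_swap.
have selE s' : sel s' (sel s a' b') (sel s b' a') = if s' == s then a' else b'.
  by case: s' (s) => -[].
have aE s' w : wpoly s' w.+1 (if s' == s then a' else b') = if (s' == s) && (w.+1 == v.+2) then
  al else 0.
  have [->|/negb_eqbP->] := eqVneq s' s; first by rewrite (of_wpolyK two_neq0).
  by rewrite /= /b' vE -{2}[s]negbK (of_wpoly_opp n two_neq0).
have bE s' w : wpoly s' w.+1 (if s' == s then b' else a') = if (s' == s) && (w.+1 == v) then be
  else 0.
  have [->|/negb_eqbP->] := eqVneq s' s; first by rewrite (of_wpolyK two_neq0).
  by rewrite /= /a' -{2}[s]negbK (of_wpoly_opp n two_neq0).
have selE' s' : sel (~~ s') (sel s a' b') (sel s b' a') = if s' == s then b' else a'.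
  by case: s' (s) => -[].
have pE i' : ((p * i').+1 == v.+2) = (i' == i) by rewrite eqSS v1 eqn_pmul2l //; lia.
have alE s' i' : alpha_poly s' i' (sel s a' b') (sel s b' a') = if (s' == s) && (i' == i) then al
  else 0.
  by rewrite /alpha_poly selE aE pE.
move=> s' [|i'] si'; split=> //; rewrite /rho_poly selE' ?selE.
  have -> : (if s' == s then b' else a') = (if ~~ s' == s then a' else b') by case: s' (s) {si'}
    => -[].
  by rewrite !aE eqSS !andbF flip0 addr0 mulr0 (ltn_eqF i0) andbF.
have [w wE] : exists w, (p * i'.+1).-1 = w.+1.
  by exists (p * i'.+1).-2; rewrite mulnS; lia.
have wv : (w.+1 == v) = (i'.+1 == i).
  by rewrite -wE -eqSS v1 pmul_predK // eqn_pmul2l //; lia.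
rewrite wE bE wv alE; case: ifP => _; first exact: beE.
by rewrite scaler0 mulr0 addr0.
Qed.

(** The same in weight 0, where rho = T sigma and sigma is split between the two signs. *)
Lemma realize_zero al sg : adm_poly 1 al -> adm_poly 1 sg -> (T * sg)^`() = 0 ->
  exists a b, cocyc true a b /\
  forall s' i', (s' || (0 < i')%N) ->
    alpha_poly s' i' a b = (if s' && (i' == 0)%N then al else 0) /\
    rho_poly s' i' a b = (if s' && (i' == 0)%N then T * sg else 0).
Proof.
move=> alP sgP sg0; pose be := flip (sg - al).
have beP : adm_poly 1 be.
  by apply: adm_poly_flip; apply: adm_polyD => //; rewrite -scaleN1r; apply: adm_polyZ.
have beE : al + flip be = sg by rewrite /be flipK addrC subrK.
exists (B true 1 al), (B false 1 be); split.
  by have := @cocyc_zero k n two_neq0 true al be alP beP; rewrite beE; apply.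
have aE w : wpoly true w.+1 (B true 1 al) = if w == 0%N then al else 0 by rewrite (of_wpolyK
  two_neq0).
have bE w : wpoly false w.+1 (B false 1 be) = if w == 0%N then be else 0 by rewrite (of_wpolyK
  two_neq0).
have p0 i' : (p * i' == 0)%N = (i' == 0)%N by rewrite muln_eq0 (_ : p == 0 = false)%N //; lia.
have alE s' i' : (s' || (0 < i')%N) -> alpha_poly s' i' (B true 1 al) (B false 1 be) = if s' &&
  (i' == 0)%N then al else 0.
  rewrite /alpha_poly; case: s' => /= i'0; rewrite ?aE ?bE p0 //.
  by rewrite (gtn_eqF i'0).
move=> s' i' si'; split; first exact: alE.
case: i' si' => [|i'] si'; rewrite /rho_poly.
  by case: s' si' => //= _; rewrite aE bE eqxx beE.
rewrite alE // !andbF mulr0 addr0.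
have [w wE] : exists w, (p * i'.+1).-1 = w.+1.
  by exists (p * i'.+1).-2; rewrite mulnS; lia.
rewrite wE; case: s' {si'} => /=.
  by rewrite (@of_wpoly_opp k n two_neq0 true w.+1 0 be) scaler0.
by rewrite (@of_wpoly_opp k n two_neq0 false w.+1 0 al) scaler0.
Qed.

Definition index_eq (s s' : bool) (i i' c c' t t' : nat) := [&& s == s', i == i', c == c' & t ==
  t'].

Definition residue t := if t == 1%N then p.-1 else p.-2.

Lemma residue_lt t : (residue t < p)%N.
Proof. by rewrite /residue; case: ifP; lia. Qed.

Lemma residue_eq c1 c2 t1 t2 : (0 < t1 < 3)%N -> (0 < t2 < 3)%N ->
  (p * c1 + residue t1 == p * c2 + residue t2)%N = (c1 == c2) && (t1 == t2).
Proof.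
move=> t13 t23; apply/eqP/andP=> [E|[/eqP-> /eqP->]//].
have := congr1 (divn^~ p) E; have := congr1 (modn^~ p) E.
have [l1 l2] := (residue_lt t1, residue_lt t2).
rewrite ![(p * _)%N]mulnC !modnMDl !modn_small // !divnMDl; try lia.
rewrite !divn_small // !addn0 => tE ->; split=> //; apply/eqP.
move: t13 t23 tE {E l1 l2}; rewrite /residue.
by case: t1 => [|[|[|]]] //; case: t2 => [|[|[|]]] //=; lia.
Qed.

Lemma coord_residue a b s i c t : (0 < t < 3)%N ->
  coord a b s i c t = (alpha_poly s i a b)`_(p * c + residue t).
Proof. by case: t => [|[|[|t]]]. Qed.

Lemma adm_poly_geom_adm1 m : adm1 m -> adm_poly 1 (geom_sum k m).
Proof.
case: m => [|[|m]] mP; try by rewrite /geom_sum big_ord0; exact: adm_poly0.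
by apply: adm_poly_geom; move: mP; rewrite /adm1 /admissible /=; lia.
Qed.

(** The dual cocycle of a coordinate of rho has rho = X^(p c); in weight 0, where rho must
    be divisible by T, it has rho = X^(p c) - X^(p c0) with c0 at most 1 of the parity of
    c, and X^(p c0) is not a coordinate. For the other coordinates alpha is a monomial and
    rho = 0. *)
Lemma coord_dual s i c t : (t < 3)%N -> valid s i c t -> exists a b, cocyc true a b /\
  forall s' i' c' t', (t' < 3)%N -> valid s' i' c' t' ->
    coord a b s' i' c' t' = (index_eq s' s i' i c' c t' t)%:R.
Proof.
move=> t3 /andP[si]; case: t t3 => [|t] t3.
  move=> /andP[wc ic].
  have deriv_pX c1 : ('X^(p * c1) : {poly k})^`() = 0.
    by rewrite derivXn -scaler_nat natk_pmul scale0r.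
  have pcE c1 c2 : (p * c1 == p * c2)%N = (c1 == c2) by rewrite eqn_pmul2l //; lia.
  have [i0|i0] := posnP i.
    have sT : s = true by move: si; rewrite i0 orbF.
    rewrite i0 /= in ic; rewrite i0 add0n in wc.
    pose c0 := nat_of_bool (odd c); pose sg := geom_sum k (p * c0) - geom_sum k (p * c).
    have oc0 : odd (p * c0) = odd (p * c) by rewrite !oddM /c0 oddb.
    have sgE : T * sg = 'X^(p * c) - 'X^(p * c0).
      by rewrite mulrBr !quadric_geom_sum oc0 opprB addrC addrA subrK.
    have sgP : adm_poly 1 sg.
      apply: adm_polyD; first apply: adm_poly_geom_adm1.
        have : (p * c0 <= p * c)%N by rewrite leq_mul2l /c0; case: (c) ic => // ? _; case: odd;
          rewrite orbT.
        by move: wc; rewrite /adm1 oc0; lia.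
      by rewrite -scaleN1r; apply: adm_polyZ; apply: adm_poly_geom_adm1.
    have [|a [b [abZ abE]]] := realize_zero (@adm_poly0 k n 1) sgP.
      by rewrite sgE derivB !deriv_pX subr0.
    exists a, b; split=> // s' i' c' t' t'3 /andP[si' v'].
    have [alE RE] := abE s' i' si'; rewrite /index_eq sT i0.
    case: t' t'3 v' => [|t'] t'3 v'; last first.
      by rewrite coord_residue // alE if_same coef0 !andbF.
    rewrite /= RE andbT eqb_id andbA; case: ifP => [/andP[_ /eqP i'0]|_]; last by rewrite coef0.
    move: v'; rewrite i'0 => /andP[_ /= c'1].
    rewrite sgE coefB !coefXn !pcE /= (_ : (c' == c0) = false) ?subr0 //.
    by rewrite /c0; case: odd; lia.
  have roP : adm_poly (p * i).-1 'X^(p * c).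
    apply: adm_polyX; move: wc; rewrite mulnDr -(pmul_predK i0) /adm1 /admissible.
    by move: (_.-1) => m; lia.
  have [a [b [abZ abE]]] := realize_pos s i0 (@adm_poly0 k n _) roP (deriv_pX c).
  exists a, b; split=> // s' i' c' t' t'3 /andP[si' v'].
  have [alE RE] := abE s' i' si'; rewrite /index_eq.
  case: t' t'3 {v'} => [|t'] t'3; last by rewrite coord_residue // alE if_same coef0 !andbF.
  by rewrite /= RE andbT andbA; case: ifP => _; rewrite ?coef0 // coefXn pcE.
move=> vt; have t13 : (0 < t.+1 < 3)%N by [].
have alP : adm_poly (p * i).+1 'X^(p * c + residue t.+1).
  apply: adm_polyX; case: t t3 vt {t13} => [|[|]] //= _;
    rewrite /residue /= mulnS mulnDr /adm0 /adm1 /admissible.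
    by rewrite (_ : p + (p * i + p * c) = (p * i).+1 + (p * c + p.-1))%N //; lia.
  by rewrite (_ : p + (p * i + p * c) = ((p * i).+1 + (p * c + p.-2)).+1)%N /=; lia.
have [a [b [abZ abE]]] : exists a b, cocyc true a b /\
  forall s' i', (s' || (0 < i')%N) ->
    alpha_poly s' i' a b = (if (s' == s) && (i' == i) then 'X^(p * c + residue t.+1) else 0) /\
    rho_poly s' i' a b = 0.
  have [i0|i0] := posnP i.
    have sT : s = true by move: si; rewrite i0 orbF.
    rewrite i0 muln0 in alP.
    have [|a [b [abZ abE]]] := realize_zero alP (@adm_poly0 k n 1); first by rewrite mulr0 deriv0.
    exists a, b; split=> // s' i' si'; have [-> ->] := abE s' i' si'.
    by rewrite mulr0 if_same sT i0 eqb_id.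
  have [a [b [abZ abE]]] := realize_pos s i0 alP (@adm_poly0 k n _) (deriv0 k).
  by exists a, b; split=> // s' i' si'; have [-> ->] := abE s' i' si'; rewrite if_same.
exists a, b; split=> // s' i' c' t' t'3 /andP[si' v'].
have [alE RE] := abE s' i' si'; rewrite /index_eq.
case: t' t'3 {v'} => [|t'] t'3; first by rewrite /= RE coef0 !andbF.
rewrite coord_residue // alE andbA; case: ifP => _; last by rewrite coef0.
by rewrite coefXn residue_eq.
Qed.

End Classes.

(** * Counting the coordinates *)

Section Counting.
Local Open Scope nat_scope.

(** There are j + 1 pairs (i, c) with i + c = j. *)
Lemma sum_diagonal M (H : nat -> nat) : (forall j, M <= j -> H j = 0) ->
  \sum_(i < M) \sum_(c < M) H (i + c) = \sum_(j < M) j.+1 * H j.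
Proof.
move=> H0.
have row (i : 'I_M) : \sum_(c < M) H (i + c) = \sum_(j < M) (i <= j) * H j.
  rewrite -(big_mkord xpredT (fun c => H (i + c))) -(big_mkord xpredT (fun j => (i <= j) * H j)).
  have iM := ltnW (ltn_ord i).
  have low0 : \sum_(0 <= j < i) (i <= j) * H j = 0.
    by rewrite big_nat big1 // => j /andP[_ ji]; rewrite leqNgt ji.
  rewrite [RHS](big_cat_nat (leq0n i) iM) /= low0 add0n.
  transitivity (\sum_(0 + i <= j < M + i) H j).
    by rewrite big_addn addnK; apply: eq_bigr => c _; rewrite addnC.
  rewrite add0n (big_cat_nat iM (leq_addr i M)) /=.
  have high0 : \sum_(M <= j < M + i) H j = 0.
    by rewrite big_nat big1 // => j /andP[Mj _]; exact: H0.
  by rewrite high0 addn0; apply: eq_big_nat => j /andP[-> _]; rewrite mul1n.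
rewrite (eq_bigr _ (fun i _ => row i)) exchange_big /=; apply: eq_bigr => j _.
rewrite -big_distrl /=; congr (_ * _).
rewrite -(big_mkord xpredT (fun i => (i <= j) : nat)) (big_cat_nat (leq0n j.+1) (ltn_ord j)) /=.
rewrite [X in X + _](eq_big_nat _ _ (F2 := fun=> 1)); last by move=> i /andP[_]; rewrite ltnS => ->.
have high0 : \sum_(j.+1 <= i < M) (i <= j) = 0.
  by rewrite big_nat big1 // => i /andP[ji _]; rewrite leqNgt ji.
by rewrite high0 sum_nat_const_nat subn0 muln1 addn0.
Qed.

(** Counting the pairs with sign, i = 0 once, gives 2 (j + 1) - 1 = 2 j + 1 of them for
    each sum j. F counts the coordinates of rho, from which c = 0 and c = 1 are excluded
    for i = 0: this is why F 0 + F 1 is added. *)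
Lemma sum_signed_diagonal M (F G : nat -> nat) :
  (forall j, M.+2 <= j -> F j = 0) -> (forall j, M.+2 <= j -> G j = 0) ->
  \sum_(s : bool) \sum_(i < M.+2) \sum_(c < M.+2)
    (s || (0 < i)) * (F (i + c) * ((0 < i) || (1 < c)) + G (i + c)) + F 0 + F 1
  = \sum_(j < M.+2) j.*2.+1 * (F j + G j).
Proof.
move=> F0 G0; pose H j := F j + G j.
have H0 j : M.+2 <= j -> H j = 0 by move=> jM; rewrite /H F0 ?G0.
have HE := sum_diagonal H0.
pose R := \sum_(i < M.+1) \sum_(c < M.+2) H (i.+1 + c).
pose row0 := \sum_(c < M.+2) H c.
have rE : row0 + R = \sum_(j < M.+2) j.+1 * H j.
  by rewrite -HE [in RHS]big_ord_recl.
have row0E : \sum_(c < M.+2) 1 * (F (0 + c) * ((0 < 0) || (1 < c)) + G (0 + c)) + F 0 + F 1 = row0.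
  have low : \sum_(c < M.+2) F c * ~~ (1 < c) = F 0 + F 1.
    rewrite 2!big_ord_recl big1 ?addn0 /= ?muln1 // => c _.
    by rewrite /bump /= muln0.
  rewrite -addnA -low -big_split /=; apply: eq_bigr => c _; rewrite /H add0n.
  by case: (1 < c); rewrite /= ?muln1 ?muln0; lia.
have R1 : \sum_(i < M.+1) \sum_(c < M.+2) 1 * (F (i.+1 + c) * ((0 < i.+1) || (1 < c)) + G (i.+1 +
  c)) = R.
  by apply: eq_bigr => i _; apply: eq_bigr => c _; rewrite /= muln1 mul1n.
have zero0 : \sum_(c < M.+2) (0 < 0) * (F (0 + c) * ((0 < 0) || (1 < c)) + G (0 + c)) = 0.
  by rewrite big1.
have S1 : \sum_(i < M.+2) \sum_(c < M.+2)
    1 * (F (i + c) * ((0 < i) || (1 < c)) + G (i + c)) + F 0 + F 1 = row0 + R.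
  rewrite -row0E [X in X + _ + _ = _](_ : _ =
    \sum_(c < M.+2) 1 * (F (0 + c) * ((0 < 0) || (1 < c)) + G (0 + c)) + R); first by lia.
  by rewrite [LHS]big_ord_recl; congr (_ + _); exact: R1.
have S2 : \sum_(i < M.+2) \sum_(c < M.+2)
    (0 < i) * (F (i + c) * ((0 < i) || (1 < c)) + G (i + c)) = R.
  by rewrite [LHS]big_ord_recl zero0; exact: R1.
have SE : \sum_(j < M.+2) j.*2.+1 * (F j + G j) + row0 = (\sum_(j < M.+2) j.+1 * H j).*2.
  rewrite /row0 -big_split /= -mul2n big_distrr /=; apply: eq_bigr => j _.
  by rewrite -/(H j); lia.
rewrite big_bool S2; move: S1 SE; rewrite -rE /=; lia.
Qed.

Lemma bin2S m : 'C(m.+1, 2) = 'C(m, 2) + m.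
Proof. by rewrite binS bin1. Qed.

(** The sums 1 + 5 + 9 + ... and 3 + 7 + 11 + ... are the binomial coefficients C(m, 2)
    with m even and odd, respectively. *)
Lemma sum_parity Q b : \sum_(j < Q.+1) (odd j != b) * j.*2.+1 =
  if odd Q == b then 'C(Q.+1, 2) else 'C(Q.+2, 2).
Proof.
elim: Q b => [|Q IH] b; first by rewrite big_ord1; case: b.
rewrite big_ord_recr IH /= !bin2S; case: (odd Q); case: b => /=; lia.
Qed.

Lemma sum_parity_shift Q b : \sum_(j < Q) (odd j.+1 == b) * j.*2.+1 =
  if odd Q == b then 'C(Q.+1, 2) else 'C(Q, 2).
Proof.
case: Q => [|Q]; first by rewrite big_ord0; case: b.
rewrite -[in RHS]if_neg; have := sum_parity Q b; case: b => /= sumE.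
  transitivity (\sum_(j < Q.+1) (odd j != true) * j.*2.+1); last by rewrite sumE; case: (odd Q).
  by apply: eq_bigr => j _; case: (odd j).
transitivity (\sum_(j < Q.+1) (odd j != false) * j.*2.+1); last by rewrite sumE; case: (odd Q).
by apply: eq_bigr => j _; case: (odd j).
Qed.

Lemma sum_ltn_widen M K (h : nat -> nat) : K <= M ->
  \sum_(j < M) (j < K) * h j = \sum_(j < K) h j.
Proof.
move=> KM; rewrite (big_ord_widen _ h KM) [RHS]big_mkcond; apply: eq_bigr => j _.
by case: ifP; rewrite ?mul1n ?mul0n.
Qed.

Section Index.
Variables (p n q r : nat).
Hypotheses (p_gt2 : 2 < p) (p_odd : odd p) (r_lt_p : r < p) (nE : n = q * p + r).

(** The bounds on i and c only make the type finite: they hold for all valid indices, by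
    valid_bound. *)
Definition index_set :=
  {x : bool * 'I_n.+2 * 'I_n.+2 * 'I_3 | valid p n x.1.1.1 x.1.1.2 x.1.2 x.2}.

Definition dimension :=
  if ~~ odd r && (r != p.-1)
  then 3 * 'C(q, 2) + 'C(q + 1, 2) - 'C(q - 1, 2)
  else if r == p.-1 then 3 * 'C(q + 2, 2)
  else 3 * 'C(q + 1, 2).

(** The largest j with p j <= n + 1. *)
Definition level1 := if r == p.-1 then q.+1 else q.

Lemma adm0_mul j : adm0 n (p * j) = (j <= q) && (odd j == odd n).
Proof.
rewrite /adm0 oddM p_odd /= mulnC -leq_divRL; last by lia.
by rewrite nE divnMDl ?(divn_small r_lt_p) ?addn0 //; lia.
Qed.

Lemma adm1_mul j : adm1 n (p * j) = (j <= level1) && (odd j != odd n).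
Proof.
rewrite /adm1 oddM p_odd /= mulnC -leq_divRL; last by lia.
have -> : n.+1 %/ p = level1; last by [].
rewrite /level1 nE -addnS divnMDl; last by lia.
have p_gt0 : 0 < p by lia.
case: eqP => [->|rp]; first by rewrite prednK // divnn p_gt0 addn1.
by rewrite divn_small ?addn0 //; lia.
Qed.

(** By the parities of adm0_mul and adm1_mul, the coordinates with t = 0, 1, 2 amount to
    three sums of 2 j + 1 over one parity, from which the two excluded coordinates of
    weight 0 are subtracted. The bound of the sums is q, except that adm1 reaches q + 1
    when r = p - 1. *)
Lemma card_index_set : #|{: index_set}| = dimension.
Proof.
rewrite card_sig -sum1_card big_mkcond /=.
pose F j := adm1 n (p * j) : nat.
pose G j := adm0 n (p * j.+1) + adm1 n (p * j.+1).
transitivity (\sum_(s : bool) \sum_(i < n.+2) \sum_(c < n.+2) \sum_(t < 3)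
    (valid p n s i c t : nat)).
  by rewrite !pair_bigA /=; apply: eq_bigr => x _; rewrite inE; case: valid.
transitivity (\sum_(s : bool) \sum_(i < n.+2) \sum_(c < n.+2)
    (s || (0 < i)) * (F (i + c) * ((0 < i) || (1 < c)) + G (i + c))).
  do 3!(apply: eq_bigr => ? _); rewrite !big_ord_recl big_ord0 /= /valid /= /F /G.
  by case: (_ || _) => //=; case: adm0; case: adm1; case: adm1; case: (_ || _).
have large j : n.+2 <= j -> n.+1 < p * j by nia.
have F_large j : n.+2 <= j -> F j = 0.
  by move=> /large jn; rewrite /F /adm1 leqNgt jn.
have G_large j : n.+2 <= j -> G j = 0.
  move=> /leqW/large jn; rewrite /G /adm0 /adm1 [_ <= n.+1]leqNgt jn /=.
  by rewrite leqNgt (leq_trans _ jn).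
have := sum_signed_diagonal F_large G_large.
set total := \sum_(s : bool) _.
have q_le : q <= n by nia.
have level_le : level1.+1 <= n.+2 by rewrite /level1; case: eqP; nia.
have -> : \sum_(j < n.+2) j.*2.+1 * (F j + G j) =
  \sum_(j < level1.+1) (odd j != odd n) * j.*2.+1
  + \sum_(j < q) (odd j.+1 == odd n) * j.*2.+1
  + \sum_(j < level1) (odd j.+1 != odd n) * j.*2.+1.
  rewrite -(sum_ltn_widen (fun j => (odd j != odd n) * j.*2.+1) level_le).
  rewrite -(sum_ltn_widen (M := n.+2) (fun j => (odd j.+1 == odd n) * j.*2.+1)); last by lia.
  rewrite -(sum_ltn_widen (M := n.+2) (fun j => (odd j.+1 != odd n) * j.*2.+1)); last by lia.
  rewrite -!big_split; apply: eq_bigr => j _ /=.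
  rewrite /F /G !adm0_mul !adm1_mul ltnS /=.
  by case: (j <= level1); case: (j < level1); case: (j < q); case: (odd j); case: (odd n) => /=;
    lia.
have odd_n : odd n = odd q (+) odd r by rewrite nE oddD oddM p_odd andbT.
rewrite {1 2}/F !adm1_mul /dimension.
have pe : odd p.-1 = false by move: p_odd; rewrite -{1}(prednK (ltnW (ltnW p_gt2))) /= => /negPf.
have shiftN : \sum_(j < level1) (odd j.+1 != odd n) * j.*2.+1
    = \sum_(j < level1) (odd j.+1 == ~~ odd n) * j.*2.+1.
  by apply: eq_bigr => j _; case: (odd j.+1); case: (odd n).
rewrite shiftN sum_parity !sum_parity_shift odd_n /level1 /=.
have [->|rp] := eqVneq r p.-1.
  by rewrite pe andbF addbF !addn2 /= !bin2S; case: (odd q) => /=; lia.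
have qE : q = 0 \/ exists q', q = q'.+1 by case: (q); [left | right; eexists].
rewrite !andbT addn1 subn1; case: qE => [->|[q' ->]]; rewrite /= ?bin2S.
  by case: (odd r) => /=; lia.
by case: (odd q'); case: (odd r) => /=; lia.
Qed.

End Index.
End Counting.

(** * The dimension of Ext^2 *)

(** The defining inequalities of valid bound p (i + c) by n + 1. *)
Lemma valid_bound p n s i c t : (2 < p)%N -> valid p n s i c t -> (i < n.+2)%N /\ (c < n.+2)%N.
Proof.
move=> p2 /andP[_]; case: t => [/andP[/andP[le _] _]|[/andP[le _]|t /andP[le _]]]; nia.
Qed.

Theorem proposition5p5 (k : fieldType) (p : nat)
    (pchar_k : p \in [pchar k]) (p_gt2 : (2 < p)%N)
    (n q r : nat) (r_lt_p : (r < p)%N) (nE : n = (q * p + r)%N)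
    (P : proj_resolution (env_mod (trivial_rep (sl k 2)))) :
  has_dim (Ext P (env_mod (sym_pow_rep (adjoint_rep (sl k 2)) n)) 2)
    (if ~~ odd r && (r != p.-1)
     then 3 * 'C(q, 2) + 'C(q + 1, 2) - 'C(q - 1, 2)
     else if r == p.-1 then 3 * 'C(q + 2, 2)
     else 3 * 'C(q + 1, 2))%N.
Proof.
rewrite -[X in has_dim _ X]/(dimension p q r).
rewrite -(card_index_set p_gt2 (pchar_odd pchar_k p_gt2) r_lt_p nE).
pose lam (a b : sym_pow (sl k 2) n) (x : index_set p n) :=
  coord p a b (val x).1.1.1 (val x).1.1.2 (val x).1.2 (val x).2.
have lam0 a b : cocyc true a b ->
    (forall x, lam a b x = 0) -> forall s i c t, valid p n s i c t -> coord p a b s i c t = 0.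
  move=> abZ ab0 s i c t vt; have [il cl] := valid_bound p_gt2 vt.
  (* Every t above 2 has the same condition and the same coordinate as t = 2. *)
  pose t' := if t is t'.+3 then 2%N else t.
  have t3 : (t' < 3)%N by rewrite /t'; case: (t) => [|[|[|]]].
  have vt' : valid p n s i c t' by move: vt; rewrite /t'; case: (t) => [|[|[|]]].
  have := ab0 (exist _ (s, Ordinal il, Ordinal cl, Ordinal t3) vt' : index_set p n).
  by rewrite /lam /= /t'; case: (t) => [|[|[|]]].
apply: (ext2_sl2_dim (lam := lam)) => [c a b a' b' x|a b abZ|x].
- exact: coord_lin.
- split=> [abB x|ab0]; last first.
    exact: (cobound_of_coords pchar_k p_gt2 abZ (lam0 a b abZ ab0)).
  exact: cobound_coord_eq0.
case: x => [[[[s i] c] t] vx]; have := coord_dual pchar_k p_gt2 (ltn_ord t) vx.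
move=> [a [b [abZ abE]]]; exists a, b; split=> // -[[[[s' i'] c'] t'] vx'].
rewrite /lam /= (abE s' i' c' t' (ltn_ord t') vx'); congr (nat_of_bool _)%:R.
by rewrite -val_eqE /= /index_eq !xpair_eqE -!andbA.
Qed.
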